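(* Let $M$ be a smooth manifold of dimension $m$, $\mathcal{V}$ an involutive distribution on $M$ of dimension $n$ with $2n\le m$, and $F$ a vector field on $M$ such that $[F,\mathcal{V}]\cap\mathcal{V}=\{0\}$ and such that $\mathcal{W}=\mathcal{V}+[F,\mathcal{V}]$ is a distribution of dimension $2n$. Assume that both $\mathcal{V}$ and $\mathcal{W}$ are involutive. (1) Suppose that $F\in\mathcal{W}$, and assume that the set $N=\{z\in M: F(z)\in\mathcal{V}_z\}$ is nonempty. Then around each point of $N$ there are local coordinates $(t^p,x^i,y^i)$ on $M$, $p=1,\dots,m-2n$, $i=1,\dots,n$, with $\mathcal{V}$ spanned by the $\partial/\partial y^i$, with respect to which $$F=y^i\frac{\partial}{\partial x^i}+F^i(t,x,y)\frac{\partial}{\partial y^i}$$ for some smooth functions $F^i$. (2) Suppose that $F$ is everywhere independent of $\mathcal{W}$, i.e. $F(z)\notin\mathcal{W}_z$ for all $z\in M$ (so that in particular $m>2n$), and that $[F,\mathcal{W}]\subset\mathcal{W}$. Then around each point of $M$ there are local coordinates $(t^p,x^i,y^i)$, $p=1,\dots,m-2n$, $i=1,\dots,n$, with $\mathcal{V}$ spanned by the $\partial/\partial y^i$, with respect to which $$F=\frac{\partial}{\partial t^1}+y^i\frac{\partial}{\partial x^i}+F^i(t,x,y)\frac{\partial}{\partial y^i}$$ for some smooth functions $F^i$.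
   Context: Everything is smooth ($C^\infty$), and repeated indices are summed. A distribution is a smooth constant-rank choice of subspaces $\mathcal{V}_z\subset T_zM$; the same symbol $\mathcal{V}$ denotes the $C^\infty(M)$-module of vector fields taking values in it. $[F,\mathcal{V}]\cap\mathcal{V}=\{0\}$ means: if $V\in\mathcal{V}$ and $[F,V]\in\mathcal{V}$ then $V=0$. $\mathcal{V}+[F,\mathcal{V}]$ denotes the collection of vector fields of the form $V_1+[F,V_2]$ with $V_1,V_2\in\mathcal{V}$, which is a $C^\infty(M)$-submodule of the vector fields on $M$; $\mathcal{W}_z$ is the subspace of $T_zM$ spanned by the values at $z$ of elements of $\mathcal{W}$, and $\mathcal{W}$ being a distribution of dimension $2n$ means $\dim\mathcal{W}_z=2n$ for all $z$. $[F,\mathcal{W}]\subset\mathcal{W}$ means $[F,W]\in\mathcal{W}$ for all $W\in\mathcal{W}$. *)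

(* Defs.v *)
From HB Require Import structures.
From mathcomp Require Import all_boot all_order all_algebra.
From mathcomp Require Import all_classical all_reals all_analysis.
From mathcomp Require Import zify.

Set Implicit Arguments.
Unset Strict Implicit.
Unset Printing Implicit Defensive.

Import Order.TTheory GRing.Theory Num.Theory.
Import numFieldNormedType.Exports.

Local Open Scope classical_set_scope.
Local Open Scope ring_scope.

Section EuclideanSmoothness.
Context {R : realType} {m : nat}.
Implicit Types (U : set 'rV[R]_m) (f g : 'rV[R]_m -> R) (k : nat).

Definition partial (j : 'I_m) f : 'rV[R]_m -> R :=
  fun u => 'D_(delta_mx 0 j) f u.

(* [Ck U k f]: all partial derivatives of f of order at most k exist and are
   continuous at every point of U; only meaningful for U open. *)
Fixpoint Ck U k f : Prop :=
  (forall u, U u -> {for u, continuous f}) /\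
  if k is k'.+1 then
    forall j, (forall u, U u -> derivable f u (delta_mx 0 j)) /\
              Ck U k' (partial j f)
  else True.

Definition Cinfty U f : Prop := forall k, Ck U k f.

Lemma Ck_cont U k f u : Ck U k f -> U u -> {for u, continuous f}.
Proof. by case: k => [|k] [fc _]; exact: fc. Qed.

Lemma CkS U k f : Ck U k.+1 f -> Ck U k f.
Proof.
elim: k f => [|k IH] f [fc fd]; split=> // j.
by have [fj fk] := fd j; split=> //; exact: IH.
Qed.

Lemma Ck_ext U k f g : open U -> (forall u, U u -> f u = g u) ->
  Ck U k f -> Ck U k g.
Proof.
move=> oU; elim: k f g => [|k IH] f g fg [fc fd].
all: have nfg u : U u -> \forall v \near u, f v = g v
  by move=> Uu; near=> v; apply: fg; near: v; exact: open_nbhs_nbhs.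
all: have gc u : U u -> {for u, continuous g} by
  move=> Uu; rewrite /prop_for /continuous_at -(fg u Uu);
  apply: cvg_trans (fc u Uu); exact: near_eq_cvg (nfg u Uu).
- by split.
- split=> // j; have [fj fk] := fd j; split=> [u Uu|].
  + exact: near_eq_derivable (nfg u Uu) (fj u Uu).
  + apply: IH fk => u Uu; exact: near_eq_derive (nfg u Uu).
Unshelve. all: by end_near. Qed.

Lemma Ck_cst U k (c : R) : open U -> Ck U k (cst c).
Proof.
move=> oU; elim: k c => [|k IH] c; split=> //; try by move=> u _; exact: cst_continuous.
move=> j; split=> [u _|]; first exact: derivable_cst.
  apply: Ck_ext (IH 0) => // u _; exact/esym/derive_cst.
Qed.

Lemma CkD U k f g : open U -> Ck U k f -> Ck U k g -> Ck U k (f + g).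
Proof.
move=> oU; elim: k f g => [|k IH] f g Hf Hg; split=> //;
  try by move=> u Uu; exact: continuousD (Ck_cont Hf Uu) (Ck_cont Hg Uu).
move=> j; have [fj fk] := Hf.2 j; have [gj gk] := Hg.2 j.
  split=> [u Uu|]; first by apply: derivableD; [exact: fj|exact: gj].
  apply: Ck_ext (IH _ _ fk gk) => // u Uu.
  by rewrite /partial deriveD //; [exact: fj|exact: gj].
Qed.

Lemma CkM U k f g : open U -> Ck U k f -> Ck U k g -> Ck U k (f * g).
Proof.
move=> oU; elim: k f g => [|k IH] f g Hf Hg; split=> //;
  try by move=> u Uu; exact: continuousM (Ck_cont Hf Uu) (Ck_cont Hg Uu).
move=> j; have [fj fk] := Hf.2 j; have [gj gk] := Hg.2 j.
  split=> [u Uu|]; first by apply: derivableM; [exact: fj|exact: gj].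
  apply: Ck_ext (CkD oU (IH _ _ (CkS Hf) gk) (IH _ _ (CkS Hg) fk)) => // u Uu.
  by rewrite /partial deriveM //; [exact: fj|exact: gj].
Qed.

End EuclideanSmoothness.

(* A chart is a homeomorphism from an open set of M onto an open set of R^m.
   Its inverse is part of the data; outside the image its value is junk. *)
Record chart (R : realType) (m : nat) (M : topologicalType) := Chart {
  cdom : set M;
  cmap : M -> 'rV[R]_m;
  cinv : 'rV[R]_m -> M;
  cdom_open : open cdom;
  cimg_open : open (cmap @` cdom);
  cmapK : forall z, cdom z -> cinv (cmap z) = z;
  cmap_continuous : {within cdom, continuous cmap};
  cinv_continuous : {within cmap @` cdom, continuous cinv} }.

Definition smooth_transition (R : realType) (m : nat) (M : topologicalType)
    (c d : chart R m M) : Prop :=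
  forall j : 'I_m, Cinfty (cmap c @` (cdom c `&` cdom d))
    (fun u => cmap d (cinv c u) 0 j).

Definition compatible_charts (R : realType) (m : nat) (M : topologicalType)
    (c d : chart R m M) : Prop :=
  smooth_transition c d /\ smooth_transition d c.

(* M may be empty. *)
Record smooth_manifold (R : realType) (m : nat) := SmoothManifold {
  carrier :> topologicalType;
  manifold_hausdorff : hausdorff_space carrier;
  manifold_second_countable : @second_countable carrier;
  atlas : set (chart R m carrier);
  atlas_cover : forall z, exists2 c, atlas c & cdom c z;
  atlas_compatible : forall c d, atlas c -> atlas d -> compatible_charts c d;
  atlas_maximal : forall c,
    (forall d, atlas d -> compatible_charts c d) -> atlas c }.

Section Manifold.
Context {R : realType} {m : nat} (M : smooth_manifold R m).

Definition smooth_on (U : set M) (f : M -> R) : Prop :=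
  forall c, atlas c ->
    Cinfty (cmap c @` (cdom c `&` U)) (fun u => f (cinv c u)).

Definition smoothT : {pred M -> R} := mem [set f | smooth_on setT f].
Definition smoothT_key : pred_key smoothT. Proof. exact. Qed.
Canonical smoothT_keyed := KeyedPred smoothT_key.

Lemma smoothT_subring_closed : subring_closed smoothT.
Proof.
have oc (c : chart R m M) : open (cmap c @` (cdom c `&` setT)).
  by rewrite setIT; exact: cimg_open.
have closedM f g : smooth_on setT f -> smooth_on setT g -> smooth_on setT (f * g).
  by move=> Hf Hg c Ac k; apply: CkM (Hf c Ac k) (Hg c Ac k).
have closed_cst a : smooth_on setT (cst a) by move=> c _ k; exact: Ck_cst.
split=> [|f g|f g]; rewrite !inE/=.
- exact: closed_cst.
- move=> Hf Hg; rewrite -[g]mul1r -mulNr => c Ac k.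
  exact: CkD (Hf c Ac k) (closedM (cst (-1)) g (closed_cst _) Hg c Ac k).
- exact: closedM.
Qed.
HB.instance Definition _ :=
  GRing.isSubringClosed.Build _ smoothT smoothT_subring_closed.

Lemma smoothT_scaler_closed : scaler_closed smoothT.
Proof.
move=> a f; rewrite !inE/= => Hf c Ac k.
have oc : open (cmap c @` (cdom c `&` setT)) by rewrite setIT; exact: cimg_open.
exact: CkM oc (Ck_cst k a oc) (Hf c Ac k).
Qed.
HB.instance Definition _ :=
  GRing.isScaleClosed.Build R (M -> R) smoothT smoothT_scaler_closed.

Record smooth_fun := SmoothFun {
  smooth_fun_val :> M -> R;
  smooth_fun_mem : smooth_fun_val \in smoothT }.

HB.instance Definition _ := [isSub for smooth_fun_val].
HB.instance Definition _ := [Choice of smooth_fun by <:].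
HB.instance Definition _ :=
  GRing.SubChoice_isSubComPzRing.Build _ _ smooth_fun (subringClosedP smoothT).
HB.instance Definition _ := [SubZmodule_isSubLmodule of smooth_fun by <:].

(* Tangent vectors are realized as functionals on the algebra C^oo(M). *)
Definition functional := smooth_fun -> R.

(* T_z M: the derivations of C^oo(M) at z. *)
Definition tangent (z : M) : set functional :=
  [set v | scalar v /\
    forall f g : smooth_fun, v (f * g) = f z * v g + v f * g z].

(* Smooth vector fields on M, as derivations of the algebra C^oo(M). *)
Record vfield := VField {
  vfield_fun :> {linear smooth_fun -> smooth_fun};
  vfieldM : forall f g : smooth_fun,
    vfield_fun (f * g) = f * vfield_fun g + vfield_fun f * g }.

Definition value_at (X : vfield) (z : M) : functional := fun f => X f z.

Definition lie_fun (X Y : vfield) : {linear smooth_fun -> smooth_fun} :=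
  (X \o Y) \- (Y \o X).

Lemma lie_funM (X Y : vfield) (f g : smooth_fun) :
  lie_fun X Y (f * g) = f * lie_fun X Y g + lie_fun X Y f * g.
Proof.
rewrite /= !vfieldM !linearD /= !vfieldM mulrBr mulrBl.
rewrite -opprD [Y f * X g + _]addrC [X f * Y g + Y (X f) * g]addrC.
rewrite (addrACA (f * X (Y g))) (addrACA (f * Y (X g))).
rewrite [X f * Y g + _]addrC opprD [LHS]addrACA subrr addr0 opprD.
exact: addrACA.
Qed.

Definition lie (X Y : vfield) : vfield := VField (lie_funM X Y).

Definition span_fam k (e : 'I_k -> functional) : set functional :=
  [set v | exists a : 'I_k -> R, v = \sum_(i < k) a i *: e i].

Definition span_set (S : set functional) : set functional :=
  [set v | exists k (e : 'I_k -> functional),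
    (forall i, S (e i)) /\ span_fam e v].

Definition lin_indep k (e : 'I_k -> functional) : Prop :=
  forall a : 'I_k -> R, \sum_(i < k) a i *: e i = 0 -> forall i, a i = 0.

Definition has_dim k (S : set functional) : Prop :=
  exists2 e : 'I_k -> functional, lin_indep e & S = span_fam e.

(* The second clause requires a smooth local frame around every point. *)
Definition smooth_distribution k (V : M -> set functional) : Prop :=
  (forall z, V z `<=` tangent z /\ has_dim k (V z)) /\
  (forall z, exists U : set M, [/\ open U, U z &
    exists X : 'I_k -> M -> functional,
      [/\ forall i w, U w -> tangent w (X i w),
          forall i (f : smooth_fun), smooth_on U (fun w => X i w f) &
          forall w, U w -> V w = span_fam (X^~ w)]]).

Definition sections (V : M -> set functional) : set vfield :=
  [set X : vfield | forall z, V z (value_at X z)].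

Definition involutive_fields (S : set vfield) : Prop :=
  forall X Y, S X -> S Y -> S (lie X Y).

Definition plus_lie (F : vfield) (V : set vfield) : set vfield :=
  [set X : vfield | exists V1 V2 : vfield, [/\ V V1, V V2 & X =1 V1 \+ lie F V2]].

Definition values_span (W : set vfield) (z : M) : set functional :=
  span_set [set value_at X z | X in W].

(* The vector d/du^j at z; the junk values of cinv outside the (open) image of
   the chart play no role. *)
Definition coord_vec (c : chart R m M) (j : 'I_m) (z : M) : functional :=
  fun f => partial j (fun u => f (cinv c u)) (cmap c z).

End Manifold.

(* The m = (m - 2n) + n + n coordinates are ordered as (t^p, x^i, y^i). *)
Section CoordinateBlocks.
Variables (m n : nat) (hnm : (2 * n <= m)%N).

Fact t_idx_subproof (p : 'I_(m - 2 * n)) : (p < m)%N.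
Proof. have := ltn_ord p; lia. Qed.
Definition t_idx p := Ordinal (t_idx_subproof p).

Fact x_idx_subproof (i : 'I_n) : (m - 2 * n + i < m)%N.
Proof. have := ltn_ord i; lia. Qed.
Definition x_idx i := Ordinal (x_idx_subproof i).

Fact y_idx_subproof (i : 'I_n) : (m - n + i < m)%N.
Proof. have := ltn_ord i; lia. Qed.
Definition y_idx i := Ordinal (y_idx_subproof i).

End CoordinateBlocks.

(* Main.v *)
Require Import Defs.
From HB Require Import structures.
From mathcomp Require Import all_boot all_order all_algebra.
From mathcomp Require Import all_classical all_reals all_analysis.
From mathcomp Require Import zify ring lra.

Import Order.TTheory GRing.Theory Num.Theory.
Import numFieldNormedType.Exports.

Set Implicit Arguments.
Unset Strict Implicit.
Unset Printing Implicit Defensive.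

Local Open Scope classical_set_scope.
Local Open Scope ring_scope.

(** The coordinates $(t,x,y)$ are found one block at a time, as functions whose
    derivatives along the fields are prescribed. Let $a_i$ be a local frame of $V$
    and $e_i=[F,a_i]$, so that $(a,e)$ is a frame of $W$.

    The functions $t$ are independent and annihilated by $W$. They exist by the
    theorem of Frobenius ([frobenius]); when $F$ is transverse to $W$ and preserves
    it, $F$ is straightened together with $W$, which makes $Ft$ constant and equal to
    a coordinate vector, while $Ft=0$ when $F$ belongs to $W$. The functions $x$ are
    annihilated by $V$, by the same theorem for the involutive frame $a$, and
    chosen so that $e_ix^j=\delta_i^j$ at the given point. Finally $y=Fx$. Then
    $a_iy^j=a_iFx^j=-[F,a_i]x^j+Fa_ix^j=-e_ix^j$ is invertible, hence
    $(t,x,y)$ is a coordinate system by the inverse function theorem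
    ([inverse_function]). In it $V$, which annihilates $t$ and $x$, is spanned by the
    $\partial/\partial y^i$, and $Fx=y$ together with the value of $Ft$ is the asserted
    form of $F$. This argument in coordinates is [normal_form]; it covers
    both cases, which differ by the number, zero or one, of transverse fields.

    The theorem of Frobenius is reduced to commuting frames, by a
    normalisation which makes all brackets vanish, and commuting frames are
    straightened by following their flows ([straighten]). This needs the smooth
    dependence of solutions of differential equations on parameters
    ([ode_smooth]), obtained from Picard iteration ([ode_exists]), Grönwall's
    inequality ([ode_param_cont]) and the variational equation ([variational]).

    On the manifold, tangent vectors are derivations of the algebra of smooth
    functions and vector fields are derivations of this algebra into itself. Bump functions
    make them local ([tangent_local]) and extend local frames to fields on the
    whole manifold ([field_extension]); the lemma of Hadamard ([hadamard])
    expresses them in coordinates ([tangent_dvec]), where their Lie bracket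
    is the usual one ([lie_components]). With $W=V+[F,V]$ thus
    described by the frame $(a,e)$, the normal form passes to
    the manifold ([local_form]). *)

(** * Limits and derivatives of matrix-valued maps *)

Section Normed.
Context {R : realType}.

Lemma mx_norm_le m n (A : 'M[R]_(m, n)) c :
  0 <= c -> (forall i j, `|A i j| <= c) -> `|A| <= c.
Proof.
move=> c0 H; by rewrite /Num.Def.normr/= mx_normrE (bigmax_le _ c0).
Qed.

Lemma mx_entry_le m n (A : 'M[R]_(m, n)) i j : `|A i j| <= `|A|.
Proof.
rewrite [leRHS]/Num.Def.normr/= mx_normrE.
exact: (le_bigmax _ (fun ij => `|A ij.1 ij.2|) (i, j)).
Qed.

Lemma mulmx_norm_le m n p (A : 'M[R]_(m, n)) (B : 'M[R]_(n, p)) :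
  `|A *m B| <= n%:R * `|A| * `|B|.
Proof.
apply: mx_norm_le => [|i j]; first by rewrite !mulr_ge0.
rewrite mxE (le_trans (ler_norm_sum _ _ _))//.
rewrite (le_trans (ler_sum (G := fun=> `|A| * `|B|) _ _))//.
  by move=> k _; rewrite normrM ler_pM// mx_entry_le.
by rewrite sumr_const card_ord -[leLHS]mulr_natl mulrA.
Qed.

Lemma cvg_mx (T : Type) (F : set_system T) {FF : Filter F} m n
    (f : T -> 'M[R]_(m, n)) (A : 'M[R]_(m, n)) :
  (forall i j, f x i j @[x --> F] --> A i j) -> f x @[x --> F] --> A.
Proof.
move=> H; apply/cvgrPdist_le => e e0.
have : \forall x \near F, forall ij : 'I_m * 'I_n,
    `|A ij.1 ij.2 - f x ij.1 ij.2| <= e.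
  apply: filter_forall => -[i j]/=.
  by have /cvgrPdist_le/(_ _ e0) := H i j.
apply: filterS => x Hx; apply: mx_norm_le => [|i j]; first exact: ltW.
by rewrite !mxE; exact: (Hx (i, j)).
Qed.

Lemma cvg_entry (T : Type) (F : set_system T) {FF : Filter F} m n
    (f : T -> 'M[R]_(m, n)) (A : 'M[R]_(m, n)) i j :
  f x @[x --> F] --> A -> f x i j @[x --> F] --> A i j.
Proof. by move=> H; apply: (cvg_comp _ (fun M : 'M[R]_(m, n) => M i j) H); exact: coord_continuous. Qed.

Lemma cvg_sumr (T I : Type) (F : set_system T) {FF : Filter F} (r : seq I)
    (f : I -> T -> R) (l : I -> R) :
  (forall i, f i x @[x --> F] --> l i) ->
  \sum_(i <- r) f i x @[x --> F] --> \sum_(i <- r) l i.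
Proof.
move=> H; elim: r => [|i r IH].
  rewrite big_nil (_ : (fun x => _) = cst 0); first exact: cvg_cst.
  by apply/funext => x; rewrite big_nil.
rewrite big_cons (_ : (fun x => _) = f i \+ (fun x => \sum_(j <- r) f j x)).
  by apply: cvgD.
by apply/funext => x; rewrite big_cons.
Qed.

(** The form of differentiability used throughout: it needs neither a quotient
    nor a punctured neighbourhood. *)
Lemma is_derive_epsP (V : normedModType R) (f : V -> R) (u v : V) (l : R) :
  is_derive u v f l <->
  forall e, 0 < e ->
    \forall h \near (0 : R), `|f (h *: v + u) - f u - h * l| <= e * `|h|.
Proof.
have E (h e : R) : h != 0 ->
  (`|l - h^-1 *: ((f \o shift u) (h *: v) - f u)| <= e) =
  (`|f (h *: v + u) - f u - h * l| <= e * `|h|).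
  move=> h0; rewrite -ler_pdivrMr ?normr_gt0// -normfV -normrM distrC.
  by congr (`| _ | <= _); rewrite /= /GRing.scale/= mulrBl [h * l]mulrC mulfK// mulrC.
split=> [[df dl] e e0|H].
  move: df; rewrite /derivable => /cvgrPdist_le/(_ _ e0).
  rewrite near_withinE; apply: filterS => h Hh.
  have [->|h0] := eqVneq h 0.
    by rewrite scale0r add0r subrr mul0r subr0 normr0 mulr0.
  by rewrite -E//; have := Hh h0; rewrite /= -[lim _]/('D_v f u) dl.
suff C : h^-1 *: ((f \o shift u) (h *: v) - f u) @[h --> 0^'] --> l.
  by split; [apply/cvg_ex; exists l|exact/cvg_lim].
apply/cvgrPdist_le => e e0; rewrite near_withinE.
apply: filterS (H e e0) => h Hh h0; by rewrite E.
Qed.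

Lemma is_derive_line (V : normedModType R) (f : V -> R) (u v : V) (t l : R) :
  is_derive (t *: v + u) v f l <-> is_derive t 1 (fun s : R => f (s *: v + u)) l.
Proof.
split=> /is_derive_epsP H; apply/is_derive_epsP => e e0; apply: filterS (H e e0) => h.
  by rewrite [h *: 1]mulr1 scalerDl addrA.
by rewrite [h *: 1]mulr1 scalerDl addrA.
Qed.

Lemma is_derive_near (V : normedModType R) (f g : V -> R) (u v : V) (l : R) :
  (\forall w \near u, f w = g w) -> is_derive u v f l -> is_derive u v g l.
Proof.
move=> fg [df dl]; split; first exact: near_eq_derivable df.
by rewrite -dl; apply/esym; exact: near_eq_derive.
Qed.

Lemma is_derive_cvg_line (V : normedModType R) (f : V -> R) (u v : V) (l : R) :
  is_derive u v f l -> f (h *: v + u) @[h --> (0 : R)] --> f u.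
Proof.
move=> H; have /is_derive_line[+ _] : is_derive ((0 : R) *: v + u) v f l.
  by rewrite scale0r add0r.
move=> /derivable1_diffP/differentiable_continuous.
by rewrite /prop_for /continuous_at /= scale0r add0r.
Qed.

Lemma is_derive_cont (f : R -> R) (t l : R) : is_derive t 1 f l -> {for t, continuous f}.
Proof. by move=> [/derivable1_diffP/differentiable_continuous]. Qed.

Lemma near_fst (S T : topologicalType) (s : S) (t : T) (P : S -> Prop) :
  (\forall x \near s, P x) -> \forall q \near (s, t), P q.1.
Proof. by move=> H; exists (P, setT) => //=; [split => //; exact: filterT|case=> ? ? []]. Qed.

Lemma near_snd (S T : topologicalType) (s : S) (t : T) (P : T -> Prop) :
  (\forall x \near t, P x) -> \forall q \near (s, t), P q.2.
Proof. by move=> H; exists (setT, P) => //=; [split => //; exact: filterT|case=> ? ? []]. Qed.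

Lemma cvg_to_pair (T : Type) (F : set_system T) {FF : Filter F}
    (S1 S2 : topologicalType) (f : T -> S1) (g : T -> S2) (s1 : S1) (s2 : S2) :
  f x @[x --> F] --> s1 -> g x @[x --> F] --> s2 ->
  (f x, g x) @[x --> F] --> (s1, s2).
Proof. by move=> H1 H2; exact: (cvg_pair H1 H2). Qed.

Lemma near0_lt (d : R) : 0 < d -> \forall h \near (0 : R), `|h| < d.
Proof.
move=> d0; apply/nbhs_ballP; exists d => // h.
by rewrite -ball_normE/= sub0r normrN.
Qed.

Lemma is_derive_mulr (t c : R) : is_derive t 1 (fun s : R => s * c) c.
Proof.
apply/is_derive_epsP => e e0; near=> h.
by rewrite [h *: 1]mulr1 mulrDl addrK subrr normr0 mulr_ge0// ltW.
Unshelve. all: by end_near. Qed.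

Lemma MVT01 (f df : R -> R) :
  (forall s : R, 0 <= s <= 1 -> is_derive s 1 f (df s)) ->
  exists2 c : R, 0 <= c <= 1 & f 1 - f 0 = df c.
Proof.
move=> H; have [|x||c c01 ->] := @MVT_segment R f df 0 1.
- exact: ler01.
- by rewrite in_itv/= => /andP[x0 x1]; apply: H; rewrite !ltW.
- apply: derivable_within_continuous => x; rewrite in_itv/= => x01.
  by have [] := H x x01.
- by exists c; [move: c01; rewrite in_itv|rewrite subr0 mulr1].
Qed.

End Normed.

(** * Slopes and the chain rule *)

Section Slopes.
Context {R : realType}.

(** Walking from [y] to [y'] one coordinate at a time and applying the mean
    value theorem to each step. *)
Lemma coordinate_mean_value N (f : 'rV[R]_N -> R) (y y' : 'rV[R]_N) :
  (forall xi, `|xi - y| <= `|y' - y| ->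
    forall j, derivable f xi (delta_mx 0 j)) ->
  exists A : 'I_N -> R,
    f y' - f y = \sum_j A j * (y' 0 j - y 0 j) /\
    forall j, exists2 xi, `|xi - y| <= `|y' - y| & A j = partial j f xi.
Proof.
move=> df; pose mix k := \row_j (if (j < k)%N then y' 0 j else y 0 j) : 'rV[R]_N.
have step (j : 'I_N) : exists a,
    f (mix j.+1) - f (mix j) = a * (y' 0 j - y 0 j) /\
    exists2 xi, `|xi - y| <= `|y' - y| & a = partial j f xi.
  pose c := y' 0 j - y 0 j; pose e : 'rV[R]_N := delta_mx 0 j.
  pose xi (s : R) := (s * c) *: e + mix j.
  have xiE s i : xi s 0 i - y 0 i = if (i < j)%N then y' 0 i - y 0 i
      else if i == j then s * c else 0.
    rewrite !mxE eqxx/=; case: (ltngtP i j) => ij.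
    - by rewrite -(inj_eq val_inj) ltn_eqF// mulr0 add0r.
    - by rewrite -(inj_eq val_inj) gtn_eqF// mulr0 add0r subrr.
    - by have -> : i = j by [apply: val_inj]; rewrite eqxx mulr1 addrK.
  have xiB s : 0 <= s <= 1 -> `|xi s - y| <= `|y' - y|.
    move=> /andP[s0 s1]; apply: mx_norm_le => // i0 i; rewrite ord1 {i0}.
    have -> : (xi s - y) 0 i = xi s 0 i - y 0 i by rewrite !mxE.
    have yE k : `|y' 0 k - y 0 k| <= `|y' - y|.
      by have := mx_entry_le (y' - y) 0 k; rewrite !mxE.
    rewrite xiE; case: ifP => // _; case: ifP => [_|]; last by rewrite normr0.
    by rewrite normrM ger0_norm// (le_trans _ (yE j))// ler_piMl.
  have [s s01|s s01] := @MVT01 R (fun s => f (xi s)) (fun s => partial j f (xi s) * c).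
    apply: (@is_derive1_comp R (fun t => f (t *: e + mix j)) (fun s => s * c)).
      by apply: (is_derive_line f (mix j) e (s * c) _).1; apply: derivableP; exact/df/xiB.
    exact: is_derive_mulr.
  rewrite (_ : xi 1 = mix j.+1); last first.
    apply/rowP => i; apply: (addIr (- y 0 i)); rewrite xiE !mxE ltnS mul1r.
    by rewrite -(inj_eq val_inj); case: (ltngtP i j) => [||/ord_inj->]//=; rewrite subrr.
  rewrite (_ : xi 0 = mix j); last by rewrite /xi mul0r scale0r add0r.
  by move=> E; exists (partial j f (xi s)); split => //; exists (xi s) => //; exact: xiB.
have [A HA] := choice step; exists A; split; last by move=> j; have [] := HA j.
have -> : y = mix 0%N by apply/rowP => i; rewrite mxE.
have {1}-> : y' = mix N by apply/rowP => i; rewrite mxE ltn_ord.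
rewrite -(telescope_sumr (fun k => f (mix k)))// big_mkord.
apply: eq_bigr => j _; have [-> _] := HA j; congr (_ * (_ - _)); by rewrite mxE.
Qed.

Lemma slope_exists N (f : 'rV[R]_N -> R) y y' : exists A : 'I_N -> R,
  (forall xi, `|xi - y| <= `|y' - y| ->
    forall j, derivable f xi (delta_mx 0 j)) ->
  f y' - f y = \sum_j A j * (y' 0 j - y 0 j) /\
    forall j, exists2 xi, `|xi - y| <= `|y' - y| & A j = partial j f xi.
Proof.
have [H|nH] := pselect (forall xi, `|xi - y| <= `|y' - y| ->
    forall j, derivable f xi (delta_mx 0 j)); last by exists (fun=> 0).
by have [A HA] := coordinate_mean_value H; exists A.
Qed.

(** [slope f y y'] plays the role of Hadamard's factor
    $\int_0^1 Df(y + s(y'-y))\,ds$, without an integral: only its values near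
    the diagonal matter. *)
Definition slope N (f : 'rV[R]_N -> R) y y' : 'I_N -> R :=
  projT1 (cid (slope_exists f y y')).

Lemma slope_near N (f : 'rV[R]_N -> R) y0 :
  (\forall xi \near y0, forall j, derivable f xi (delta_mx 0 j)) ->
  (forall j, {for y0, continuous (partial j f)}) ->
  forall e, 0 < e -> exists2 d, 0 < d &
    forall y y', `|y - y0| < d -> `|y' - y0| < d ->
    f y' - f y = \sum_j slope f y y' j * (y' 0 j - y 0 j) /\
    forall j, `|slope f y y' j - partial j f y0| <= e.
Proof.
move=> df cf e e0.
have : \forall xi \near y0, (forall j, derivable f xi (delta_mx 0 j)) /\
    (forall j, `|partial j f y0 - partial j f xi| <= e).
  near=> xi; split; first by near: xi.
  near: xi; apply: filter_forall => j.
  by have /cvgrPdist_le/(_ _ e0) := cf j.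
move=> /nbhs_ballP[d /= d0 dP]; exists (d / 3) => [|y y' yd y'd]; first by rewrite divr_gt0.
have near0 xi : `|xi - y| <= `|y' - y| -> ball y0 d xi.
  move=> xiy; rewrite -ball_normE/=.
  have H1 : `|y' - y| < d / 3 + d / 3.
    rewrite -(subrKA y0) (le_lt_trans (ler_normD _ _))// ltrD//.
    by rewrite distrC.
  have H2 : `|y0 - xi| <= `|y - y0| + `|xi - y|.
    by rewrite -(subrKA y) (le_trans (ler_normD _ _))// distrC [`|y - xi|]distrC.
  by lra.
rewrite /slope; case: cid => A /= [xi /near0/dP[]//|-> AP].
split=> // j; have [xi /near0 /dP[_ H] ->] := AP j.
by rewrite distrC.
Unshelve. all: by end_near. Qed.

(** Increments of [f] factor through slopes, which are continuous on the
    diagonal. *)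
Lemma chain_rule (V : normedModType R) N (f : 'rV[R]_N -> R) (g : V -> 'rV[R]_N)
    (u v : V) (dg : 'rV[R]_N) :
  (forall j, is_derive u v (fun w => g w 0 j) (dg 0 j)) ->
  (\forall xi \near g u, forall j, derivable f xi (delta_mx 0 j)) ->
  (forall j, {for g u, continuous (partial j f)}) ->
  is_derive u v (fun w => f (g w)) (\sum_j partial j f (g u) * dg 0 j).
Proof.
move=> Dg df cf.
have gc : g (h *: v + u) @[h --> (0 : R)] --> g u.
  apply: cvg_mx => i j; rewrite ord1; exact: is_derive_cvg_line (Dg j).
pose A h j := slope f (g u) (g (h *: v + u)) j.
have Ae : \forall h \near (0 : R), f (g (h *: v + u)) - f (g u) =
    \sum_j A h j * (g (h *: v + u) 0 j - g u 0 j).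
  have [d d0 dP] := slope_near df cf ltr01.
  have /cvgrPdist_lt/(_ _ d0) := gc; apply: filterS => h Hh.
  have [||-> //] := dP (g u) (g (h *: v + u)); rewrite ?subrr ?normr0//.
  by rewrite distrC.
have Ac j : A h j @[h --> (0 : R)] --> partial j f (g u).
  apply/cvgrPdist_le => e e0; have [d d0 dP] := slope_near df cf e0.
  have /cvgrPdist_lt/(_ _ d0) := gc; apply: filterS => h Hh.
  have [|| _ /(_ j)] := dP (g u) (g (h *: v + u)); rewrite ?subrr ?normr0//.
    by rewrite distrC.
  by rewrite distrC.
suff C : h^-1 *: (((fun w => f (g w)) \o shift u) (h *: v) - f (g u)) @[h --> 0^'] -->
    \sum_j partial j f (g u) * dg 0 j.
  by split; [apply/cvg_ex; eexists; exact: C|exact/cvg_lim].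
have C : \sum_j A h j * (h^-1 * (g (h *: v + u) 0 j - g u 0 j)) @[h --> 0^'] -->
    \sum_j partial j f (g u) * dg 0 j.
  apply: cvg_sumr => j; apply: cvgM; first by apply: cvg_within_filter; exact: Ac.
  have [dgj <-] := Dg j; exact: dgj.
apply: cvg_trans C; apply: near_eq_cvg; rewrite near_withinE.
apply: filterS Ae => h /= -> _; rewrite /GRing.scale/= mulr_sumr.
by apply: eq_bigr => j _; rewrite mulrCA.
Qed.

End Slopes.

(** * Smooth functions and smooth matrices *)

Section CkTools.
Context {R : realType}.
Implicit Types m n N k : nat.

Lemma Ck_sub m (U U' : set 'rV[R]_m) k f : U `<=` U' -> Ck U' k f -> Ck U k f.
Proof.
move=> UU'; elim: k f => [|k IH] f [fc fd]; split=> //.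
- by move=> u /UU'; exact: fc.
- by move=> u /UU'; exact: fc.
- by move=> j; have [dj kj] := fd j; split=> [u /UU'|]; [exact: dj|exact: IH].
Qed.

Lemma Ck_local m (U : set 'rV[R]_m) k f :
  (forall u, U u -> exists2 N, N u & Ck N k f) -> Ck U k f.
Proof.
elim: k f => [|k IH] f H; split=> //.
- by move=> u /H[N Nu []] + _; exact.
- by move=> u /H[N Nu []] + _; exact.
- move=> j; split; first by move=> u /H[N Nu [_ /(_ j)[+ _]]]; exact.
  by apply: IH => u /H[N Nu [_ /(_ j)[_]]]; exists N.
Qed.

Lemma Ck_derivable m (U : set 'rV[R]_m) k f u j :
  Ck U k.+1 f -> U u -> derivable f u (delta_mx 0 j).
Proof. by move=> [_ /(_ j)[+ _]]; exact. Qed.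

Lemma Ck_partial m (U : set 'rV[R]_m) k f j : Ck U k.+1 f -> Ck U k (partial j f).
Proof. by move=> [_ /(_ j)[]]. Qed.

Lemma is_derive_coord m (u v : 'rV[R]_m) j : is_derive u v (fun w => w 0 j) (v 0 j).
Proof.
apply/is_derive_epsP => e e0; near=> h.
by rewrite !mxE addrK subrr normr0 mulr_ge0// ltW.
Unshelve. all: by end_near. Qed.

Lemma Ck_is_derive m (U : set 'rV[R]_m) k f u v : open U -> Ck U k.+1 f -> U u ->
  is_derive u v f (\sum_j partial j f u * v 0 j).
Proof.
move=> oU fk Uu; apply: (@chain_rule R _ _ f id u v v) => [j||j].
- exact: is_derive_coord.
- near=> xi => j; apply: (Ck_derivable fk).
  by near: xi; exact: open_nbhs_nbhs.
- exact: Ck_cont (Ck_partial j fk) Uu.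
Unshelve. all: by end_near. Qed.

Lemma Ck_sum m (U : set 'rV[R]_m) k (I : Type) (r : seq I) (f : I -> 'rV[R]_m -> R) :
  open U -> (forall i, Ck U k (f i)) -> Ck U k (fun u => \sum_(i <- r) f i u).
Proof.
move=> oU H; elim: r => [|i r IH].
  by apply: Ck_ext (Ck_cst k 0 oU) => // u _; rewrite big_nil.
by apply: Ck_ext (CkD oU (H i) IH) => // u _; rewrite big_cons.
Qed.

Lemma Ck_coord m (U : set 'rV[R]_m) k j : open U -> Ck U k (fun u => u 0 j).
Proof.
move=> oU; have cc (u : 'rV[R]_m) : {for u, continuous (fun u : 'rV[R]_m => u 0 j)}.
  exact: coord_continuous.
case: k => [|k]; split=> // i; split=> [u _|].
  by have [] := is_derive_coord u (delta_mx 0 i) j.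
apply: Ck_ext (Ck_cst k ((delta_mx 0 i : 'rV[R]_m) 0 j) oU) => // u _.
by have [_ <-] := is_derive_coord u (delta_mx 0 i) j.
Qed.

(** Induction on the order: the derivatives of $f\circ g$ are sums of products
    of derivatives of $g$ with functions $(\partial_j f)\circ g$ of the same
    shape. *)
Lemma Ck_comp m N (U : set 'rV[R]_m) (U' : set 'rV[R]_N) k
    (f : 'rV[R]_N -> R) (g : 'rV[R]_m -> 'rV[R]_N) :
  open U -> open U' -> (forall u, U u -> U' (g u)) ->
  (forall j, Ck U k (fun u => g u 0 j)) -> Ck U' k f -> Ck U k (fun u => f (g u)).
Proof.
move=> oU oU' gU; elim: k f => [|k IH] f gk fk.
all: have gc u : U u -> g w @[w --> u] --> g u
  by move=> Uu; apply: (@cvg_mx R _ (nbhs u) _) => i j; rewrite ord1; exact: Ck_cont (gk j) Uu.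
all: have cc u : U u -> {for u, continuous (fun u => f (g u))}
  by move=> Uu; exact: (cvg_comp _ _ (gc u Uu) (Ck_cont fk (gU _ Uu))).
  by split.
split=> // i.
have D u : U u -> is_derive u (delta_mx 0 i) (fun w => f (g w))
    (\sum_j partial j f (g u) * partial i (fun w => g w 0 j) u).
  move=> Uu; have := @chain_rule R _ _ f g u (delta_mx 0 i)
    (\row_j partial i (fun w => g w 0 j) u).
  under eq_bigr do rewrite mxE; apply => [j||j].
  - by rewrite mxE; apply: derivableP; exact: Ck_derivable (gk j) Uu.
  - near=> xi => j; apply: (Ck_derivable fk).
    by near: xi; apply: open_nbhs_nbhs; split => //; exact: gU.
  - exact: Ck_cont (Ck_partial j fk) (gU _ Uu).
split=> [u /D[]//|].
apply: (Ck_ext (f := fun u => \sum_j partial j f (g u) * partial i (fun w => g w 0 j) u)) => //.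
  by move=> u /D[_ <-].
apply: Ck_sum => // j; apply: CkM => //; last exact: Ck_partial.
apply: IH; [by move=> j'; exact: CkS|exact: Ck_partial].
Unshelve. all: by end_near. Qed.

Lemma CkV m (U : set 'rV[R]_m) k f : open U -> (forall u, U u -> f u != 0) ->
  Ck U k f -> Ck U k (fun u => (f u)^-1).
Proof.
move=> oU f0; elim: k => [|k IH] fk.
all: have cc u : U u -> {for u, continuous (fun u => (f u)^-1)}
  by move=> Uu; have C := Ck_cont fk Uu; exact: (cvgV (f0 u Uu) C).
  by split.
split=> // i; split=> [u Uu|]; first by apply: derivableV; [exact: f0|exact: Ck_derivable fk Uu].
have Vk := IH (CkS fk).
apply: (Ck_ext (f := fun u => - 1 * ((f u)^-1 * (f u)^-1 * partial i f u))) => //.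
  move=> u Uu; rewrite /partial deriveV; [|exact: f0|exact: Ck_derivable fk Uu].
  by rewrite mulN1r /GRing.scale/= mulNr expr2 invfM.
apply: CkM => //; first exact: Ck_cst.
by apply: CkM => //; [exact: CkM|exact: Ck_partial].
Qed.

End CkTools.

Section CinftyTools.
Context {R : realType}.
Implicit Types m n N k : nat.

Lemma smooth_sub m (U U' : set 'rV[R]_m) f : U `<=` U' -> Cinfty U' f -> Cinfty U f.
Proof. by move=> UU' fs k; exact: Ck_sub (fs k). Qed.

Lemma smooth_local m (U : set 'rV[R]_m) f :
  (forall u, U u -> exists2 N, N u & Cinfty N f) -> Cinfty U f.
Proof. by move=> H k; apply: Ck_local => u /H[N Nu Nf]; exists N. Qed.

Lemma smooth_ext m (U : set 'rV[R]_m) f g : open U -> (forall u, U u -> f u = g u) ->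
  Cinfty U f -> Cinfty U g.
Proof. by move=> oU fg fs k; exact: Ck_ext (fs k). Qed.

Lemma smooth_cst m (U : set 'rV[R]_m) (c : R) : open U -> Cinfty U (fun=> c).
Proof. by move=> oU k; exact: Ck_cst. Qed.

Lemma smooth_coord m (U : set 'rV[R]_m) j : open U -> Cinfty U (fun u => u 0 j).
Proof. by move=> oU k; exact: Ck_coord. Qed.

Lemma smoothD m (U : set 'rV[R]_m) f g : open U -> Cinfty U f -> Cinfty U g ->
  Cinfty U (fun u => f u + g u).
Proof. by move=> oU fs gs k; exact: CkD (fs k) (gs k). Qed.

Lemma smoothM m (U : set 'rV[R]_m) f g : open U -> Cinfty U f -> Cinfty U g ->
  Cinfty U (fun u => f u * g u).
Proof. by move=> oU fs gs k; exact: CkM (fs k) (gs k). Qed.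

Lemma smoothN m (U : set 'rV[R]_m) f : open U -> Cinfty U f ->
  Cinfty U (fun u => - f u).
Proof.
move=> oU fs; apply: (smooth_ext oU (f := fun u => -1 * f u)) => [u _|].
  by rewrite mulN1r.
exact: smoothM (smooth_cst _ oU) fs.
Qed.

Lemma smoothB m (U : set 'rV[R]_m) f g : open U -> Cinfty U f -> Cinfty U g ->
  Cinfty U (fun u => f u - g u).
Proof. by move=> oU fs gs; exact: smoothD oU fs (smoothN oU gs). Qed.

Lemma smoothV m (U : set 'rV[R]_m) f : open U -> (forall u, U u -> f u != 0) ->
  Cinfty U f -> Cinfty U (fun u => (f u)^-1).
Proof. by move=> oU f0 fs k; exact: CkV (fs k). Qed.

Lemma smooth_sum m (U : set 'rV[R]_m) (I : Type) (r : seq I) (f : I -> 'rV[R]_m -> R) :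
  open U -> (forall i, Cinfty U (f i)) -> Cinfty U (fun u => \sum_(i <- r) f i u).
Proof. by move=> oU fs k; apply: Ck_sum => // i; exact: fs. Qed.

Lemma smooth_prod m (U : set 'rV[R]_m) (I : Type) (r : seq I) (f : I -> 'rV[R]_m -> R) :
  open U -> (forall i, Cinfty U (f i)) -> Cinfty U (fun u => \prod_(i <- r) f i u).
Proof.
move=> oU fs; elim: r => [|i r IH].
  by apply: (smooth_ext oU _ (smooth_cst 1 oU)) => u _; rewrite big_nil.
by apply: (smooth_ext oU _ (smoothM oU (fs i) IH)) => u _; rewrite big_cons.
Qed.

Lemma smooth_partial m (U : set 'rV[R]_m) f j : Cinfty U f -> Cinfty U (partial j f).
Proof. by move=> fs k; exact: Ck_partial (fs k.+1). Qed.

Lemma smooth_cont m (U : set 'rV[R]_m) f u : Cinfty U f -> U u -> {for u, continuous f}.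
Proof. by move=> /(_ 0%N); exact: Ck_cont. Qed.

Lemma smooth_derivable m (U : set 'rV[R]_m) f u j :
  Cinfty U f -> U u -> derivable f u (delta_mx 0 j).
Proof. by move=> /(_ 1%N); exact: Ck_derivable. Qed.

Lemma smooth_is_derive m (U : set 'rV[R]_m) f u v : open U -> Cinfty U f -> U u ->
  is_derive u v f (\sum_j partial j f u * v 0 j).
Proof. by move=> oU /(_ 1%N); exact: Ck_is_derive. Qed.

Definition smooth_mx m p q (U : set 'rV[R]_m) (A : 'rV[R]_m -> 'M[R]_(p, q)) : Prop :=
  forall i j, Cinfty U (fun u => A u i j).

Lemma smooth_mx_cont m p q (U : set 'rV[R]_m) (A : 'rV[R]_m -> 'M[R]_(p, q)) u :
  smooth_mx U A -> U u -> {for u, continuous A}.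
Proof. by move=> As Uu; apply: (@cvg_mx R _ (nbhs u) _) => i j; exact: smooth_cont (As i j) Uu. Qed.

Lemma smooth_mx_sub m p q (U U' : set 'rV[R]_m) (A : 'rV[R]_m -> 'M[R]_(p, q)) :
  U `<=` U' -> smooth_mx U' A -> smooth_mx U A.
Proof. by move=> UU' As i j; exact: smooth_sub (As i j). Qed.

Lemma smooth_mx_ext m p q (U : set 'rV[R]_m) (A B : 'rV[R]_m -> 'M[R]_(p, q)) :
  open U -> (forall u, U u -> A u = B u) -> smooth_mx U A -> smooth_mx U B.
Proof. by move=> oU AB As i j; apply: smooth_ext (As i j) => // u /AB->. Qed.

Lemma smooth_mx_cst m p q (U : set 'rV[R]_m) (A : 'M[R]_(p, q)) : open U ->
  smooth_mx U (fun=> A).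
Proof. by move=> oU i j; exact: smooth_cst. Qed.

Lemma smooth_mx_id m (U : set 'rV[R]_m) : open U -> smooth_mx U id.
Proof. by move=> oU i j; rewrite ord1; exact: smooth_coord. Qed.

Lemma smooth_mxD m p q (U : set 'rV[R]_m) (A B : 'rV[R]_m -> 'M[R]_(p, q)) :
  open U -> smooth_mx U A -> smooth_mx U B -> smooth_mx U (fun u => A u + B u).
Proof.
move=> oU As Bs i j; apply: (smooth_ext oU _ (smoothD oU (As i j) (Bs i j))) => u _.
by rewrite !mxE.
Qed.

Lemma smooth_mxB m p q (U : set 'rV[R]_m) (A B : 'rV[R]_m -> 'M[R]_(p, q)) :
  open U -> smooth_mx U A -> smooth_mx U B -> smooth_mx U (fun u => A u - B u).
Proof.
move=> oU As Bs i j; apply: (smooth_ext oU _ (smoothB oU (As i j) (Bs i j))) => u _.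
by rewrite !mxE.
Qed.

Lemma smooth_mulmx m p q r (U : set 'rV[R]_m) (A : 'rV[R]_m -> 'M[R]_(p, q))
    (B : 'rV[R]_m -> 'M[R]_(q, r)) :
  open U -> smooth_mx U A -> smooth_mx U B -> smooth_mx U (fun u => A u *m B u).
Proof.
move=> oU As Bs i j.
apply: (smooth_ext (f := fun u => \sum_k A u i k * B u k j)) => // [u _|].
  by rewrite mxE.
by apply: smooth_sum => // k; exact: smoothM.
Qed.

Lemma smooth_lsubmx n1 n2 (U : set 'rV[R]_(n1 + n2)) : open U ->
  smooth_mx U (fun w => lsubmx w).
Proof.
move=> oU i j; rewrite ord1.
by apply: (smooth_ext oU _ (smooth_coord (lshift n2 j) oU)) => w _; rewrite mxE.
Qed.

Lemma smooth_rsubmx n1 n2 (U : set 'rV[R]_(n1 + n2)) : open U ->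
  smooth_mx U (fun w => rsubmx w).
Proof.
move=> oU i j; rewrite ord1.
by apply: (smooth_ext oU _ (smooth_coord (rshift n1 j) oU)) => w _; rewrite mxE.
Qed.

Lemma smooth_row_mx m n n1 n2 (U : set 'rV[R]_m) (f : 'rV[R]_m -> 'M[R]_(n, n1))
    (g : 'rV[R]_m -> 'M[R]_(n, n2)) :
  open U -> smooth_mx U f -> smooth_mx U g -> smooth_mx U (fun w => row_mx (f w) (g w)).
Proof.
move=> oU fs gs i j; case: (split_ordP j) => j1 ->.
  by apply: (smooth_ext oU _ (fs i j1)) => w _; rewrite row_mxEl.
by apply: (smooth_ext oU _ (gs i j1)) => w _; rewrite row_mxEr.
Qed.

Lemma smooth_comp m N (U : set 'rV[R]_m) (U' : set 'rV[R]_N)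
    (f : 'rV[R]_N -> R) (g : 'rV[R]_m -> 'rV[R]_N) :
  open U -> open U' -> (forall u, U u -> U' (g u)) ->
  smooth_mx U g -> Cinfty U' f -> Cinfty U (fun u => f (g u)).
Proof. by move=> oU oU' gU gs fs k; apply: Ck_comp (fs k) => // j; exact: gs. Qed.

Lemma smooth_mx_comp m N p q (U : set 'rV[R]_m) (U' : set 'rV[R]_N)
    (A : 'rV[R]_N -> 'M[R]_(p, q)) (g : 'rV[R]_m -> 'rV[R]_N) :
  open U -> open U' -> (forall u, U u -> U' (g u)) ->
  smooth_mx U g -> smooth_mx U' A -> smooth_mx U (fun u => A (g u)).
Proof. by move=> oU oU' gU gs As i j; exact: smooth_comp (As i j). Qed.

Lemma smooth_det m n (U : set 'rV[R]_m) (A : 'rV[R]_m -> 'M[R]_n) :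
  open U -> smooth_mx U A -> Cinfty U (fun u => \det (A u)).
Proof.
move=> oU As; apply: smooth_sum => // s.
by apply: smoothM => //; [exact: smooth_cst|apply: smooth_prod => // i; exact: As].
Qed.

(** Cramer's rule. *)
Lemma smooth_invmx m n (U : set 'rV[R]_m) (A : 'rV[R]_m -> 'M[R]_n) :
  open U -> (forall u, U u -> A u \in unitmx) ->
  smooth_mx U A -> smooth_mx U (fun u => invmx (A u)).
Proof.
move=> oU Au As i j.
apply: (smooth_ext (f := fun u => (\det (A u))^-1 * cofactor (A u) j i)) => //.
  by move=> u /Au Auu; rewrite /invmx Auu !mxE.
apply: smoothM => //; first apply: smoothV => //.
- by move=> u /Au; rewrite unitmxE unitfE.
- exact: smooth_det.
- apply: smoothM => //; first exact: smooth_cst.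
  apply: smooth_det => // i' j'; apply: (smooth_ext oU _ (As (lift j i') (lift i j'))).
  by move=> u _; rewrite !mxE.
Qed.

End CinftyTools.

(** * The inverse function theorem *)

HB.instance Definition _ (R : realType) (m n : nat) :=
  Uniform_isComplete.Build 'M[R]_(m, n) (@mx_complete R m n).

Section InverseFunction.
Context {R : realType}.

(** Points are row vectors, so derivatives act on the right: the derivative of
    [g] at [u] in the direction [v] is [v *m jac g u]. *)
Definition jac m N (g : 'rV[R]_m -> 'rV[R]_N) (u : 'rV[R]_m) : 'M[R]_(m, N) :=
  \matrix_(i, j) partial i (fun w => g w 0 j) u.

Lemma smooth_jac m N (U : set 'rV[R]_m) (g : 'rV[R]_m -> 'rV[R]_N) :
  open U -> smooth_mx U g -> smooth_mx U (jac g).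
Proof.
move=> oU gs i j; apply: (smooth_ext oU _ (smooth_partial i (gs 0 j))) => u _.
by rewrite mxE.
Qed.

Lemma jac_is_derive m N (U : set 'rV[R]_m) (g : 'rV[R]_m -> 'rV[R]_N) u v j :
  open U -> smooth_mx U g -> U u ->
  is_derive u v (fun w => g w 0 j) ((v *m jac g u) 0 j).
Proof.
move=> oU gs Uu; rewrite mxE.
have := smooth_is_derive v oU (gs 0 j) Uu.
by under eq_bigr do rewrite mulrC; under [in X in _ -> X]eq_bigr do rewrite mxE.
Qed.

Lemma jac_comp m N p (U : set 'rV[R]_m) (U' : set 'rV[R]_N)
    (g : 'rV[R]_m -> 'rV[R]_N) (f : 'rV[R]_N -> 'rV[R]_p) u :
  open U -> open U' -> smooth_mx U g -> smooth_mx U' f -> U u -> U' (g u) ->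
  jac (fun w => f (g w)) u = jac g u *m jac f (g u).
Proof.
move=> oU oU' gs fs Uu U'gu; apply/matrixP => i j; rewrite !mxE.
rewrite [LHS]/partial; have [|||_ ->] := @chain_rule R _ _ (fun w => f w 0 j) g u (delta_mx 0 i) (row i (jac g u)).
- move=> k; rewrite !mxE; apply: derivableP; exact: smooth_derivable (gs 0 k) Uu.
- near=> xi => k; apply: (smooth_derivable (fs 0 j)).
  by near: xi; exact: open_nbhs_nbhs.
- by move=> k; exact: smooth_cont (smooth_partial k (fs 0 j)) U'gu.
- by apply: eq_bigr => k _; rewrite !mxE mulrC.
Unshelve. all: by end_near. Qed.

Definition slope_mx m N (g : 'rV[R]_m -> 'rV[R]_N) y y' : 'M[R]_(m, N) :=
  \matrix_(i, j) slope (fun w => g w 0 j) y y' i.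

Lemma slope_mx_near m N (U : set 'rV[R]_m) (g : 'rV[R]_m -> 'rV[R]_N) y0 :
  open U -> smooth_mx U g -> U y0 ->
  forall e, 0 < e -> exists2 d, 0 < d &
    forall y y', `|y - y0| < d -> `|y' - y0| < d ->
    g y' - g y = (y' - y) *m slope_mx g y y' /\
    `|slope_mx g y y' - jac g y0| <= e.
Proof.
move=> oU gs Uy0 e e0.
pose P d (j : 'I_N) := forall y y', `|y - y0| < d -> `|y' - y0| < d ->
    g y' 0 j - g y 0 j = \sum_i slope (fun w => g w 0 j) y y' i * (y' 0 i - y 0 i) /\
    forall i, `|slope (fun w => g w 0 j) y y' i - partial i (fun w => g w 0 j) y0| <= e.
have : \forall d \near 0^'+, forall j, P d j.
  apply: filter_forall => j.
  have [||d d0 dP] := @slope_near R _ (fun w => g w 0 j) y0 _ _ e e0.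
  - near=> xi => k; apply: (smooth_derivable (gs 0 j)).
    by near: xi; exact: open_nbhs_nbhs.
  - by move=> k; exact: smooth_cont (smooth_partial k (gs 0 j)) Uy0.
  - near=> d' => y y' yd y'd; apply: dP.
    + by apply: lt_le_trans yd _; near: d'; exact: nbhs_right_le.
    + by apply: lt_le_trans y'd _; near: d'; exact: nbhs_right_le.
move=> H.
have [d [d0 dP]] : exists d : R, 0 < d /\ forall j, P d j.
  near (0 : R)^'+ => d; exists d; split => //.
  by near: d.
exists d => // y y' yd y'd; split.
  apply/rowP => j; rewrite !mxE; have [-> _] := dP j y y' yd y'd.
  by apply: eq_bigr => i _; rewrite !mxE mulrC.
apply: mx_norm_le => [|i j]; first exact: ltW.
by rewrite !mxE; have [_ ->] := dP j y y' yd y'd.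
Unshelve. all: by end_near. Qed.

Lemma mulmx2_norm_le m n p q (A : 'M[R]_(m, n)) (B : 'M[R]_(n, p)) (C : 'M[R]_(p, q)) :
  `|A *m B *m C| <= p%:R * n%:R * `|C| * `|B| * `|A|.
Proof.
rewrite (le_trans (mulmx_norm_le _ _))//.
rewrite (_ : _ * _ * _ * _ * _ = p%:R * (n%:R * `|A| * `|B|) * `|C|); last by ring.
by rewrite ler_wpM2r// ler_wpM2l// mulmx_norm_le.
Qed.

(** Slopes of [f] are close to the derivative at [u0]. The estimate gives the
    injectivity of [f] near [u0], and the contraction that inverts it. *)
Lemma near_identity m (U : set 'rV[R]_m) (f : 'rV[R]_m -> 'rV[R]_m) u0 :
  open U -> smooth_mx U f -> U u0 -> jac f u0 \in unitmx ->
  exists2 d, 0 < d & forall y y', `|y - u0| < d -> `|y' - u0| < d ->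
    `|(y' - y) - (f y' - f y) *m invmx (jac f u0)| <= 2^-1 * `|y' - y|.
Proof.
move=> oU fs Uu0 Ju; set J := jac f u0; set K := invmx J.
pose c : R := m%:R * m%:R * `|K|.
have c0 : 0 <= c by rewrite !mulr_ge0.
have e0 : 0 < (2 * (c + 1))^-1 by rewrite invr_gt0 mulr_gt0// ltr_wpDl.
have [d d0 dP] := slope_mx_near oU fs Uu0 e0.
exists d => // y y' yd y'd; have [-> AJ] := dP y y' yd y'd.
set A := slope_mx f y y' in AJ *.
have -> : (y' - y) - (y' - y) *m A *m K = (y' - y) *m (J - A) *m K.
  by move: (y' - y) => q; rewrite mulmxBr mulmxBl /K mulmxK.
rewrite (le_trans (mulmx2_norm_le _ _ _))// ler_wpM2r// -/c distrC.
rewrite (le_trans (ler_wpM2l c0 AJ))// invfM mulrCA ler_piMr//.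
by rewrite ler_pdivrMr ?mul1r ?lerDl// ltr_wpDl.
Qed.

Definition local_diffeo m (D D' : set 'rV[R]_m) (f g : 'rV[R]_m -> 'rV[R]_m) : Prop :=
  [/\ open D /\ open D', forall u, D u -> D' (f u) /\ g (f u) = u,
      forall w, D' w -> D (g w) /\ f (g w) = w, smooth_mx D f & smooth_mx D' g].

Lemma unit_near m r (U : set 'rV[R]_m) (A : 'rV[R]_m -> 'M[R]_r) u0 :
  open U -> U u0 -> smooth_mx U A -> A u0 \in unitmx ->
  exists U', [/\ open U', U' u0, U' `<=` U & forall u, U' u -> A u \in unitmx].
Proof.
move=> oU Uu0 As Au0.
have dc : {for u0, continuous (fun u => \det (A u))}.
  exact: smooth_cont (smooth_det oU As) Uu0.
have nz : nbhs (\det (A u0)) [set x : R | x != 0].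
  apply: open_nbhs_nbhs; split; first exact: open_neq.
  by move: Au0; rewrite unitmxE unitfE.
have : nbhs u0 (fun u => U u /\ A u \in unitmx).
  near=> u; split; first by near: u; exact: open_nbhs_nbhs.
  by rewrite unitmxE unitfE; near: u; exact: (dc _ nz).
by rewrite nbhsE => -[U' [oU' U'u0] U'P]; exists U'; split => // u /U'P[].
Unshelve. all: by end_near. Qed.

(** A point with a given image $w$ is a fixed point of
    $x\mapsto x-(f(x)-w)Df(u_0)^{-1}$, a contraction near [u0]. The inverse [g] is Lipschitz,
    hence differentiable with derivative $Df(g(w))^{-1}$, and this formula
    propagates its regularity from one order to the next. *)
Theorem inverse_function m (U : set 'rV[R]_m) (f : 'rV[R]_m -> 'rV[R]_m) u0 :
  open U -> smooth_mx U f -> U u0 -> jac f u0 \in unitmx ->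
  exists (D D' : set 'rV[R]_m) (g : 'rV[R]_m -> 'rV[R]_m),
    [/\ local_diffeo D D' f g, D u0 & D `<=` U].
Proof.
move=> oU fs Uu0 Ju; set K := invmx (jac f u0).
have [d1 d10 d1P] := near_identity oU fs Uu0 Ju; rewrite -/K in d1P.
have [B' [oB' B'u0 B'U B'J]] := unit_near oU Uu0 (smooth_jac oU fs) Ju.
have [d2 /= d20 d2P] : exists2 d2, 0 < d2 & forall x, ball u0 d2 x -> B' x.
  by apply/nbhs_ballP; exact: open_nbhs_nbhs.
(* On the ball of radius r, f is injective and its derivative is invertible. *)
pose r := Num.min d1 d2 / 2.
have r0 : 0 < r by rewrite divr_gt0// lt_min d10.
have rd1 : r < d1 by rewrite /r (le_lt_trans (y := d1 / 2))// ?ler_pM2r ?ge_min ?lexx//; lra.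
have rd2 : r < d2 by rewrite /r (le_lt_trans (y := d2 / 2))// ?ler_pM2r ?ge_min ?lexx ?orbT//; lra.
pose c : R := m%:R * `|K| + 1.
have c0 : 0 < c by rewrite ltr_wpDl// mulr_ge0.
have cP (v : 'rV[R]_m) : `|v *m K| <= c * `|v|.
  rewrite (le_trans (mulmx_norm_le _ _))// mulrAC ler_wpM2r//.
  by rewrite lerDl.
pose D' := [set w : 'rV[R]_m | `|w - f u0| < r / 2 / c].
pose D := [set x : 'rV[R]_m | `|x - u0| < r /\ D' (f x)].
have BU x : `|x - u0| <= r -> U x /\ jac f x \in unitmx.
  move=> xr; suff B'x : B' x by split; [exact: B'U|exact: B'J].
  by apply: d2P; rewrite -ball_normE/= distrC (le_lt_trans xr).
have oD' : open D'.
  rewrite (_ : D' = ball (f u0) (r / 2 / c)); first exact: ball_open.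
  by apply/seteqP; split => w; rewrite /D' -ball_normE/= distrC.
have oD : open D.
  rewrite openE => x [xr D'x]; rewrite /interior.
  have Ux := BU x (ltW xr).
  near=> y; split.
    suff : ball u0 r y by rewrite -ball_normE/= distrC.
    near: y; apply: open_nbhs_nbhs; split; first exact: ball_open.
    by rewrite -ball_normE/= distrC.
  near: y; apply: (smooth_mx_cont fs Ux.1); exact: open_nbhs_nbhs.
(* The radius of D' makes the contraction map the ball into its interior. *)
have fix_pt w : D' w -> exists2 x, D x & f x = w.
  move=> D'w; pose T x := x - (f x - w) *m K.
  pose B := [set x : 'rV[R]_m | `|x - u0| <= r].
  have wK : `|(f u0 - w) *m K| < r / 2.
    by rewrite (le_lt_trans (cP _))// mulrC -ltr_pdivlMr// distrC.
  have T2 x y : B x -> B y -> `|T x - T y| <= 2^-1 * `|x - y|.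
    move=> Bx By; rewrite (_ : T x - T y = (x - y) - (f x - f y) *m K).
      by apply: d1P; exact: le_lt_trans rd1.
    by rewrite /T !mulmxBl !opprD !opprK; apply/rowP => j; rewrite !mxE; ring.
  have Bu0 : B u0 by rewrite /B/= subrr normr0 ltW.
  have TB x : B x -> `|T x - u0| < r.
    move=> Bx; rewrite -(subrKA (T u0)) (le_lt_trans (ler_normD _ _))//.
    rewrite (splitr r) ler_ltD//; last by rewrite /T addrAC subrr add0r normrN.
    by rewrite (le_trans (T2 _ _ Bx Bu0))// mulrC ler_pM2r.
  have fT : {homo T : x / B x >-> B x} by move=> x /TB/ltW.
  have [|||x Bx xT] := @banach_fixed_point R 'rV[R]_m B (mkfun_fun fT).
  - exists (2^-1)%:nng; split => /=; first by lra.
    by move=> [x y]/= [Bx By]; exact: T2.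
  - rewrite (_ : B = closed_ball u0 r); first exact: closed_ball_closed.
    rewrite closed_ballE//; apply/seteqP; split => x; by rewrite /B /closed_ball_/= distrC.
  - by exists u0.
  have fxw : f x = w.
    have : (f x - w) *m K = 0.
      have xTx : x = T x := xT.
      by rewrite -[LHS](subKr x) -/(T x) -xTx subrr.
    move=> /(congr1 (mulmx^~ (jac f u0))); rewrite mulmxKV// mul0mx.
    by move/subr0_eq.
  exists x => //; split; last by rewrite fxw.
  by rewrite xT; exact: TB.
pose g w := xget u0 [set x | D x /\ f x = w].
have gP w : D' w -> D (g w) /\ f (g w) = w.
  by move=> /fix_pt[x Dx fx]; rewrite /g; case: xgetP => [y _ //|/(_ x)]; case.
have lip x y : D x -> D y -> `|x - y| <= 2 * c * `|f x - f y|.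
  move=> [xr _] [yr _].
  have H1 := d1P y x (lt_trans yr rd1) (lt_trans xr rd1).
  have H2 := cP (f x - f y).
  have H3 : `|x - y| <= `|(x - y) - (f x - f y) *m K| + `|(f x - f y) *m K|.
    by rewrite (le_trans _ (ler_normD _ _))// subrK.
  by lra.
have gK u : D u -> g (f u) = u.
  move=> Du; have [Dg fg] := gP _ Du.2.
  apply/subr0_eq/eqP; rewrite -normr_le0 (le_trans (lip _ _ Dg Du))//.
  by rewrite fg subrr normr0 mulr0.
have DU : D `<=` U by move=> x [/ltW/BU[]].
suff gs : smooth_mx D' g.
  exists D, D', g; split => //; last first.
    split; first by rewrite subrr normr0.
    by rewrite /D'/= subrr normr0 divr_gt0// divr_gt0.
  split => //; last exact: smooth_mx_sub fs.
  by move=> u Du; split; [exact: Du.2|exact: gK].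
pose G x := invmx (jac f x).
have Dg w v j : D' w -> is_derive w v (fun w' => g w' 0 j) ((v *m G (g w)) 0 j).
  move=> D'w; set x := g w; have [Dx fx] := gP _ D'w; rewrite -/x in Dx fx.
  have [Ux Jx] := BU x (ltW Dx.1).
  pose C : R := m%:R * m%:R * `|G x| * (2 * c * (`|v| + 1)) + 1.
  have C0 : 0 < C by rewrite ltr_wpDl// !mulr_ge0// ltW.
  apply/is_derive_epsP => e e0.
  have [d d0 dP] := slope_mx_near oU fs Ux (divr_gt0 e0 C0).
  have Nw : \forall h \near (0 : R), D' (h *: v + w).
    suff : h *: v + w @[h --> (0 : R)] --> w by apply; exact: open_nbhs_nbhs.
    rewrite -[X in _ --> X]add0r -(scale0r v); apply: cvgD; last exact: cvg_cst.
    by apply: cvgZr_tmp; exact: cvg_id.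
  have d1_gt0 : 0 < (2 * c * (`|v| + 1))^-1 * d.
    by rewrite mulr_gt0// invr_gt0 !mulr_gt0// ltr_wpDl.
  near=> h.
  have D'h : D' (h *: v + w) by near: h.
  have [Dq fq] := gP _ D'h; set q := g (h *: v + w) in Dq fq *.
  have qx : `|q - x| <= 2 * c * (`|v| + 1) * `|h|.
    rewrite (le_trans (lip _ _ Dq Dx))// fq fx addrK normrZ -!mulrA.
    rewrite ler_wpM2l// ler_wpM2l//; first exact: ltW.
    by rewrite mulrC ler_wpM2r// lerDl.
  have [||E AJ] := dP x q; first by rewrite subrr normr0.
    rewrite (le_lt_trans qx)// -ltr_pdivlMl; last first.
      by rewrite !mulr_gt0// ltr_wpDl.
    by near: h; exact: near0_lt.
  set A := slope_mx f x q in E AJ.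
  have E2 : q - x - h *: (v *m G x) = (q - x) *m (jac f x - A) *m G x.
    rewrite mulmxBr mulmxBl /G (mulmxK Jx) -E fq fx addrK.
    by rewrite -scalemxAl.
  have -> : q 0 j - x 0 j - h * (v *m G x) 0 j = (q - x - h *: (v *m G x)) 0 j.
    by rewrite !mxE.
  rewrite (le_trans (mx_entry_le _ _ _))// E2 (le_trans (mulmx2_norm_le _ _ _))//.
  rewrite distrC in AJ.
  have : m%:R * m%:R * `|G x| * `|jac f x - A| * `|q - x| <=
      m%:R * m%:R * `|G x| * (e / C) * (2 * c * (`|v| + 1) * `|h|).
    by rewrite ler_pM// ?mulr_ge0// ler_wpM2l// !mulr_ge0.
  move=> /le_trans; apply.
  rewrite (_ : _ * _ * _ * _ * _ = (C - 1) / C * (e * `|h|)); last first.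
    by rewrite /C addrK; ring.
  rewrite ler_piMl//; first by rewrite mulr_ge0// ltW.
  by rewrite ler_pdivrMr// mul1r lerBlDr lerDl.
pose D0 := [set x | U x /\ jac f x \in unitmx].
suff Cg k : forall j, Ck D' k (fun w => g w 0 j) by move=> i j k; rewrite ord1; exact: Cg.
have gc j w : D' w -> {for w, continuous (fun w => g w 0 j)}.
  move=> D'w; apply/(@cvgrPdist_le _ _ _ (nbhs w) _) => e e0; near=> y.
  have D'y : D' y by near: y; exact: open_nbhs_nbhs.
  have [[Dy fy] [Dw fw]] := (gP _ D'y, gP _ D'w).
  rewrite (_ : _ - _ = (g w - g y) 0 j); last by rewrite !mxE.
  rewrite (le_trans (mx_entry_le _ _ _))// (le_trans (lip _ _ Dw Dy))// fy fw.
  rewrite -ler_pdivlMl ?mulr_gt0//.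
  suff : ball w ((2 * c)^-1 * e) y by rewrite -ball_normE/= => /ltW.
  by near: y; apply: nbhsx_ballx; rewrite mulr_gt0// invr_gt0 mulr_gt0.
elim: k => [|k IH] j; split=> //; try exact: gc.
move=> i; split=> [w D'w|]; first by have [] := Dg w (delta_mx 0 i) j D'w.
have sG : smooth_mx D G.
  apply: smooth_invmx => //; first by move=> x [/ltW/BU[]].
  by apply: smooth_mx_sub (smooth_jac oU fs) => x [/ltW/BU[]].
apply: (Ck_ext (f := fun w => G (g w) i j)) => // [w D'w|].
  by have [_ /esym] := Dg w (delta_mx 0 i) j D'w; rewrite -rowE mxE.
apply: (Ck_comp oD' oD (f := fun x => G x i j) (g := g)) => //.
- by move=> w /gP[].
- exact: sG.
Unshelve. all: by end_near. Qed.

End InverseFunction.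

(** * Growth estimates for curves *)

Section OneVariable.
Context {R : realType}.

Lemma le0_geometric (x c : R) : (forall k, x <= c * 2^-1 ^+ k) -> x <= 0.
Proof.
move=> H; rewrite leNgt; apply/negP => x0.
have c0 : 0 < c by have := H 0%N; rewrite expr0 mulr1; exact: lt_le_trans.
pose k := Num.bound (c / x).
have ck : c / x < k%:R by rewrite archi_boundP// divr_ge0// ltW.
have k2 : (k%:R : R) < 2 ^+ k by rewrite -natrX ltr_nat ltn_expl.
have := H k; rewrite exprVn ler_pdivlMr ?exprn_gt0// leNgt => /negP; apply.
by rewrite mulrC -ltr_pdivrMr// (lt_trans ck).
Qed.

(** The limit is the supremum of the lower barriers $u_k - 2C2^{-k}$, all of
    which lie below all the upper ones. *)
Lemma geometric_limit (u : nat -> R) C :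
  (forall k, `|u k.+1 - u k| <= C * 2^-1 ^+ k) ->
  exists l, forall k, `|u k - l| <= 2 * C * 2^-1 ^+ k.
Proof.
move=> H; pose a k := u k - 2 * C * 2^-1 ^+ k; pose b k := u k + 2 * C * 2^-1 ^+ k.
have C0 : 0 <= C by have := H 0%N; rewrite expr0 mulr1; exact: le_trans.
have aS k : a k <= a k.+1.
  by have := H k; rewrite ler_norml => /andP[+ _]; rewrite /a exprS; lra.
have bS k : b k.+1 <= b k.
  by have := H k; rewrite ler_norml => /andP[_ +]; rewrite /b exprS; lra.
have aM k l : a k <= a (k + l)%N.
  by elim: l => [|l IH]; [rewrite addn0|rewrite addnS (le_trans IH)].
have bM k l : b (k + l)%N <= b k.
  by elim: l => [|l IH]; [rewrite addn0|rewrite addnS (le_trans _ IH)].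
have ab k l : a k <= b l.
  rewrite (le_trans (aM k l))// (le_trans _ (bM l k))// addnC /a /b.
  by rewrite lerBlDr -addrA lerDl addr_ge0// !mulr_ge0// ?exprn_ge0.
have sa : has_sup (range a).
  by split; [exists (a 0%N); exists 0%N|exists (b 0%N) => _ [k _ <-]].
exists (sup (range a)) => k.
have H1 : a k <= sup (range a) by apply: ub_le_sup; [case: sa|exists k].
have H2 : sup (range a) <= b k by apply: ge_sup => [|_ [l _ <-]//]; case: sa.
by rewrite ler_norml; move: H1 H2; rewrite /a /b; lra.
Qed.

Lemma is_derive_ndecr (g dg : R -> R) t : 0 <= t ->
  (forall s : R, 0 <= s <= t -> is_derive s 1 g (dg s) /\ 0 <= dg s) -> g 0 <= g t.
Proof.
move=> t0 H; have [||c c01] := @MVT_segment R g dg 0 t t0.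
- by move=> x; rewrite in_itv/= => /andP[x0 x1]; apply: (H x _).1; rewrite !ltW.
- apply: derivable_within_continuous => x; rewrite in_itv/= => x01.
  by have [[]] := H x x01.
- move: c01; rewrite in_itv/= => /H[_ g0] E.
  by rewrite -subr_ge0 E mulr_ge0// subr0.
Qed.

Lemma is_derive_rev (g : R -> R) (t l : R) :
  is_derive (- t) 1 g l -> is_derive t 1 (fun s => g (- s)) (- l).
Proof.
by move=> gl; rewrite -mulrN1; apply: (@is_derive1_comp R g -%R t l (-1)).
Qed.

Lemma is_derive_expRM (c t : R) : is_derive t 1 (fun s => expR (s * c)) (c * expR (t * c)).
Proof.
rewrite mulrC; apply: (@is_derive1_comp R expR (fun s => s * c) t _ c).
exact: is_derive_mulr.
Qed.

(** Integration of a bound of exponential type, without integrals: the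
    derivatives of $Ce^{L|t|}\mp D(t)$ have a sign. *)
Lemma exp_growth (D dD : R -> R) (L C t : R) : 0 <= C ->
  (forall s : R, `|s| <= `|t| ->
    is_derive s 1 D (dD s) /\ `|dD s| <= C * L * expR (L * `|s|)) ->
  `|D t - D 0| <= C * expR (L * `|t|).
Proof.
move=> C0; wlog t0 : D dD t / 0 <= t => [W|].
  have [/W//|/ltW t0] := leP 0 t; first exact.
  move=> H; have := W (fun s => D (- s)) (fun s => - dD (- s)) (- t).
  rewrite oppr_ge0 opprK oppr0 normrN; apply => // s st.
  have [|D1 D2] := H (- s); first by rewrite normrN.
  by split; [exact: is_derive_rev|rewrite normrN -[`|s|]normrN].
move=> H; rewrite (ger0_norm t0).
have G (e : R) : `|e| = 1 -> C * expR (0 * L) - e * D 0 <= C * expR (t * L) - e * D t.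
  move=> e1; apply: (@is_derive_ndecr (fun s => C * expR (s * L) - e * D s)
    (fun s => C * (L * expR (s * L)) - e * dD s) t t0) => s /andP[s0 st].
  have [|D1 D2] := H s; first by rewrite !ger0_norm.
  split.
    have E := is_derive_expRM L s.
    exact: (@is_deriveB R R R (fun s => C * expR (s * L)) (fun s => e * D s)).
  rewrite subr_ge0 (le_trans (ler_norm _))// normrM e1 mul1r (le_trans D2)//.
  by rewrite ger0_norm// mulrA [s * L]mulrC.
have G1 := G 1 (normr1 _); have G2 := G (-1) (normrN1 _).
move: G1 G2; rewrite mul0r expR0 [L * t]mulrC ler_norml => G1 G2.
by apply/andP; split; lra.
Qed.

Lemma is_derive0_cst (D : R -> R) t :
  (forall s : R, `|s| <= `|t| -> is_derive s 1 D 0) -> D t = D 0.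
Proof.
move=> H; have E : `|D t - D 0| <= 0 * expR (1 * `|t|).
  apply: (@exp_growth D (fun=> 0)) => // s /H Ds.
  by split => //; rewrite normr0 !mul0r.
by apply/eqP; rewrite -subr_eq0 -normr_le0 (le_trans E)// mul0r.
Qed.

Lemma antiderivative_near (f : R -> R) (T : R) : continuous f ->
  exists F, F 0 = 0 /\ forall t : R, `|t| < T -> is_derive t 1 F (f t).
Proof.
move=> fc; pose G x := (\int[lebesgue_measure]_(s in `[(- T)%R, x]) f s)%R.
exists (fun x => G x - G 0); split=> [|t]; first by rewrite subrr.
rewrite ltr_norml => /andP[Tt tT].
have [|D1 D2] := @continuous_FTC1_closed R f (- T) t T tT _ Tt (fc t).
  apply: continuous_compact_integrable; first exact: segment_compact.
  exact: continuous_subspaceT.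
have DG : is_derive t 1 G (f t) by split; [exact: D1|rewrite -derive1E].
rewrite -[X in is_derive _ _ _ X]subr0.
exact: (@is_deriveB R R R G (cst (G 0)) t 1 (f t) 0).
Qed.

(** Primitives on larger and larger intervals agree where both are defined. *)
Lemma antiderivative (f : R -> R) : continuous f ->
  exists F, F 0 = 0 /\ forall t : R, is_derive t 1 F (f t).
Proof.
move=> fc; have [G GP] := choice (fun n : nat => antiderivative_near n%:R fc).
have GG n p t : `|t| < n%:R -> `|t| < p%:R -> G n t = G p t.
  move=> tn tp; have [[Gn0 Gn] [Gp0 Gp]] := (GP n, GP p).
  apply/subr0_eq; have <- : G n 0 - G p 0 = 0 by rewrite Gn0 Gp0 subrr.
  apply: (@is_derive0_cst (fun s => G n s - G p s)) => s st.
  have Dn := Gn s (le_lt_trans st tn); have Dp := Gp s (le_lt_trans st tp).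
  by rewrite -[X in is_derive _ _ _ X](subrr (f s)); apply: is_deriveB.
pose N (t : R) : nat := Num.bound `|t|.
have tN (t : R) : `|t| < (N t)%:R by rewrite archi_boundP.
exists (fun t => G (N t) t); split=> [|t]; first by have [] := GP (N 0).
have [_ /(_ t (tN t)) H] := GP (N t).
have Nt : nbhs `|t| [set x : R | x < (N t)%:R].
  by apply: open_nbhs_nbhs; split; [exact: open_lt|exact: tN].
have tc : {for t, continuous (fun s : R => `|s|)} by exact: norm_continuous.
apply: is_derive_near H; near=> s; apply: GG => //.
by near: s; exact: (tc _ Nt).
Unshelve. all: by end_near. Qed.

End OneVariable.

Section Curves.
Context {R : realType} {N : nat}.
Implicit Types (y : R -> 'rV[R]_N) (t s : R).

Definition velocity y (dy : R -> 'rV[R]_N) : Prop :=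
  forall t j, is_derive t 1 (fun s => y s 0 j) (dy t 0 j).

Lemma velocity_cont y dy : velocity y dy -> continuous y.
Proof.
move=> yd t; apply: (@cvg_mx R _ (nbhs t) _) => i j; rewrite ord1.
exact: is_derive_cont (yd t j).
Qed.

Lemma velocity_sub y dy z dz : velocity y dy -> velocity z dz ->
  velocity (fun t => y t - z t) (fun t => dy t - dz t).
Proof.
move=> yd zd t j; have D1 := yd t j; have D2 := zd t j; rewrite !mxE.
have -> : (fun s => (y s - z s) 0 j) = (fun s => y s 0 j - z s 0 j).
  by apply/funext => s; rewrite !mxE.
exact: is_deriveB.
Qed.

(** Grönwall's inequality for the squared Euclidean norm, which is
    differentiable while the sup norm is not. *)
Lemma gronwall (d dd : R -> 'rV[R]_N) (L e t : R) : velocity d dd -> 0 <= L ->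
  (forall s, `|s| <= `|t| -> `|dd s| <= L * `|d s| + e) -> 0 <= e ->
  `|d t| ^+ 2 <= N%:R * (`|d 0| ^+ 2 + e ^+ 2) * expR ((L * (N%:R + 1) + 1) * `|t|).
Proof.
move=> D L0 H e0; set K := L * (N%:R + 1) + 1.
have K0 : 0 < K by rewrite ltr_wpDl// mulr_ge0// addr_ge0.
pose Q s := \sum_j d s 0 j ^+ 2; pose S s := Q s + N%:R * e ^+ 2.
have Q0 s : 0 <= Q s by apply: sumr_ge0 => j _; exact: sqr_ge0.
have dQ s : `|d s| ^+ 2 <= Q s.
  have Qs : `|d s| <= Num.sqrt (Q s).
    apply: mx_norm_le => [|i j]; first exact: sqrtr_ge0.
    rewrite ord1 -sqrtr_sqr ler_wsqrtr// /Q (bigD1 j)//= lerDl.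
    by apply: sumr_ge0 => k _; exact: sqr_ge0.
  by rewrite -(sqr_sqrtr (Q0 s)) ler_sqr ?nnegrE// sqrtr_ge0.
pose dS s := \sum_j 2 * d s 0 j * dd s 0 j.
have DS s : is_derive s 1 S (dS s).
  rewrite -[dS s]addr0; apply: (@is_deriveD R R R Q (cst (N%:R * e ^+ 2))).
  have -> : Q = \sum_j (fun s => d s 0 j ^+ 2).
    by apply/funext => x; rewrite fct_sumE.
  apply: is_derive_sum => j; have Dj := D s j.
  have -> : (fun s => d s 0 j ^+ 2) = (fun s => d s 0 j) * (fun s => d s 0 j).
    by apply/funext => x; rewrite expr2.
  have -> : 2 * d s 0 j * dd s 0 j = d s 0 j *: dd s 0 j + d s 0 j *: dd s 0 j.
    by rewrite /GRing.scale/=; ring.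
  exact: is_deriveM.
have dSK s : `|s| <= `|t| -> `|dS s| <= K * S s.
  move=> /H Hs; rewrite /dS /S.
  have B j : `|2 * d s 0 j * dd s 0 j| <=
      L * (d s 0 j ^+ 2 + Q s) + d s 0 j ^+ 2 + e ^+ 2.
    rewrite !normrM ger0_norm//.
    have H1 : `|d s 0 j| * `|dd s 0 j| <= `|d s 0 j| * (L * `|d s| + e).
      by rewrite ler_wpM2l// (le_trans (mx_entry_le _ _ _)).
    have H3 : L * (2 * (`|d s 0 j| * `|d s|)) <= L * (d s 0 j ^+ 2 + Q s).
      rewrite ler_wpM2l// (le_trans _ (lerD (lexx _) (dQ s)))// -(real_normK (num_real (d s 0 j))).
      by have := sqr_ge0 (`|d s 0 j| - `|d s|); rewrite sqrrB; lra.
    have H4 : 2 * (`|d s 0 j| * e) <= d s 0 j ^+ 2 + e ^+ 2.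
      rewrite -(real_normK (num_real (d s 0 j))).
      by have := sqr_ge0 (`|d s 0 j| - e); rewrite sqrrB; lra.
    by lra.
  rewrite (le_trans (ler_norm_sum _ _ _))// (le_trans (ler_sum _ (fun j _ => B j)))//.
  rewrite !big_split/= -mulr_sumr big_split/= -/(Q s) !sumr_const card_ord.
  rewrite -[Q s *+ N]mulr_natl -[e ^+ 2 *+ N]mulr_natl.
  have HK : 1 <= K by rewrite lerDr mulr_ge0// addr_ge0.
  have He : N%:R * e ^+ 2 <= K * (N%:R * e ^+ 2) by rewrite ler_peMl// mulr_ge0// sqr_ge0.
  have -> : L * (Q s + N%:R * Q s) + Q s + N%:R * e ^+ 2 = K * Q s + N%:R * e ^+ 2.
    by rewrite /K; ring.
  by move: He; lra.
have main (S' dS' : R -> R) x : 0 <= x -> (forall s, is_derive s 1 S' (dS' s)) ->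
    (forall s, 0 <= s <= x -> dS' s <= K * S' s) -> S' x <= S' 0 * expR (K * x).
  move=> x0 DS' HS'.
  have G : - (S' 0 * expR (0 * - K)) <= - (S' x * expR (x * - K)).
    apply: (@is_derive_ndecr R (fun s => - (S' s * expR (s * - K)))
      (fun s => - (S' s * (- K * expR (s * - K)) + expR (s * - K) * dS' s)) x x0) => s sx.
    have D1 := DS' s; have D2 := is_derive_expRM (- K) s.
    split; first by apply: is_deriveN; exact: (@is_deriveM R R S' (fun s => expR (s * - K))).
    rewrite oppr_ge0 [_ * dS' s]mulrC mulrA -mulrDl mulr_le0_ge0 ?expR_ge0//.
    by have := HS' s sx; lra.
  move: G; rewrite lerN2 mul0r expR0 mulr1 mulrN expRN ler_pdivrMr ?expR_gt0//.
  by rewrite [K * x]mulrC.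
have St : S t <= S 0 * expR (K * `|t|).
  have [t0|t0] := leP 0 t.
    rewrite ger0_norm//; apply: (main S dS) => // s /andP[s0 st].
    by rewrite (le_trans (ler_norm _))// dSK// !ger0_norm.
  have tN : 0 <= - t by rewrite oppr_ge0 ltW.
  have := main (fun s => S (- s)) (fun s => - dS (- s)) (- t) tN.
  rewrite opprK oppr0 ltr0_norm//; apply=> [s|s /andP[s0 st]]; first exact: is_derive_rev.
  rewrite (le_trans (ler_norm _))// normrN dSK//.
  by rewrite normrN ger0_norm// ltr0_norm.
apply: le_trans (dQ t) _.
have QS : Q t <= S t by rewrite lerDl mulr_ge0// sqr_ge0.
rewrite (le_trans QS)// (le_trans St)// ler_wpM2r ?expR_ge0//.
rewrite /S mulrDr lerD2r /Q.
rewrite (le_trans (ler_sum (G := fun=> `|d 0| ^+ 2) _ _))//.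
  move=> j _; rewrite -(real_normK (num_real (d 0 0 j))) ler_sqr ?nnegrE//.
  exact: mx_entry_le.
by rewrite sumr_const card_ord mulr_natl.
Qed.

End Curves.

Section CurvePairs.
Context {R : realType} {N1 N2 : nat}.

Lemma velocity_row (y dy : R -> 'rV[R]_N1) (z dz : R -> 'rV[R]_N2) :
  velocity y dy -> velocity z dz ->
  velocity (fun t => row_mx (y t) (z t)) (fun t => row_mx (dy t) (dz t)).
Proof.
move=> yV zV t j; case: (split_ordP j) => j1 ->.
  rewrite row_mxEl [X in is_derive _ _ X _](_ : _ = fun s => y s 0 j1); first exact: yV.
  by apply/funext => r; rewrite row_mxEl.
rewrite row_mxEr [X in is_derive _ _ X _](_ : _ = fun s => z s 0 j1); first exact: zV.
by apply/funext => r; rewrite row_mxEr.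
Qed.

Lemma cvg_row_mx (T : Type) (F : set_system T) {FF : Filter F} m
    (f : T -> 'M[R]_(m, N1)) (g : T -> 'M[R]_(m, N2)) (a : 'M[R]_(m, N1)) (b : 'M[R]_(m, N2)) :
  f x @[x --> F] --> a -> g x @[x --> F] --> b ->
  row_mx (f x) (g x) @[x --> F] --> row_mx a b.
Proof.
move=> fa gb; apply: cvg_mx => i j; case: (split_ordP j) => j1 ->.
  rewrite row_mxEl (_ : (fun x => _) = fun x => f x i j1); first exact: cvg_entry.
  by apply/funext => x; rewrite row_mxEl.
rewrite row_mxEr (_ : (fun x => _) = fun x => g x i j1); first exact: cvg_entry.
by apply/funext => x; rewrite row_mxEr.
Qed.

End CurvePairs.

(** * Ordinary differential equations *)

Section Existence.
Context {R : realType} {N : nat}.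
Implicit Types (y : R -> 'rV[R]_N) (t s : R).

Lemma velocity_zero (d dd : R -> 'rV[R]_N) (L t : R) : velocity d dd -> 0 <= L ->
  (forall s, `|s| <= `|t| -> `|dd s| <= L * `|d s|) -> d 0 = 0 -> d t = 0.
Proof.
move=> D L0 H d0; have := @gronwall R N d dd L 0 t D L0 _ (lexx _).
rewrite d0 normr0 expr0n/= add0r mulr0 mul0r => G.
have {}G : `|d t| ^+ 2 <= 0 by apply: G => s st; rewrite addr0; exact: H.
apply/eqP; rewrite -normr_eq0 -sqrf_eq0; apply/eqP/le_anti.
by rewrite G sqr_ge0.
Qed.

Lemma segment_bounded (f : R -> R) T : continuous f ->
  exists M, forall t, `|t| <= T -> `|f t| <= M.
Proof.
move=> fc; have [T0|T0] := leP 0 T; last first.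
  by exists 0 => t tT; have := le_lt_trans tT T0; rewrite ltNge normr_ge0.
have [||c _ cP] := @EVT_max R (fun t => `|f t|) (- T) T.
- by rewrite ge0_cp.
- by apply: continuous_subspaceT => t; apply: cvg_norm; exact: fc.
- exists `|f c| => t; rewrite ler_norml => tT; exact: cP.
Qed.

(** Picard iteration. The increments of the iterates are measured with the
    weight $e^{2L|t|}$, for which one integration gains a factor $1/2$ whatever
    the Lipschitz constant; so solutions live on the whole line. *)
Theorem ode_exists (g : R -> 'rV[R]_N -> 'rV[R]_N) (v : 'rV[R]_N) :
  (forall T, exists L, forall t, `|t| <= T ->
    forall a b, `|g t a - g t b| <= L * `|a - b|) ->
  (forall y, continuous y -> continuous (fun t => g t (y t))) ->
  exists y, y 0 = v /\ velocity y (fun t => g t (y t)).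
Proof.
move=> Hlip Hc.
have coordc (y : R -> 'rV[R]_N) j : continuous y -> continuous (fun t => y t 0 j).
  move=> yc t; apply: (@cvg_entry R _ (nbhs t) _); exact: yc.
have prim (f : R -> R) : exists F, continuous f ->
    F 0 = 0 /\ forall t : R, is_derive t 1 F (f t).
  have [fc|nfc] := pselect (continuous f); last by exists (fun=> 0).
  by have [F FP] := antiderivative fc; exists F.
have [I IP] := choice prim.
pose P y t : 'rV[R]_N := v + \row_j I (fun s => g s (y s) 0 j) t.
have PE y t j : P y t 0 j = v 0 j + I (fun s => g s (y s) 0 j) t.
  by rewrite !mxE.
have P0 y : continuous y -> P y 0 = v.
  move=> yc; apply/rowP => j; rewrite PE.
  by have [->] := IP _ (coordc _ j (Hc y yc)); rewrite addr0.
have PD y : continuous y -> velocity (P y) (fun t => g t (y t)).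
  move=> yc t j; have [_ /(_ t) D] := IP _ (coordc _ j (Hc y yc)).
  have -> : (fun s => P y s 0 j) = cst (v 0 j) + I (fun s => g s (y s) 0 j).
    by apply/funext => s; rewrite PE.
  rewrite -[X in is_derive _ _ _ X]add0r; exact: is_deriveD.
have Pc y : continuous y -> continuous (P y) by move=> /PD/velocity_cont.
pose Y k := iter k P (fun=> v).
have Yc k : continuous (Y k) by elim: k => [|k IH]; [move=> t; exact: cvg_cst|exact: Pc].
have Ybound T : exists C, forall k t, `|t| <= T -> `|Y k.+1 t - Y k t| <= C * 2^-1 ^+ k.
  have [L' L'P] := Hlip T; pose L := Num.max L' 1.
  have L1 : 1 <= L by rewrite le_max lexx orbT.
  have L0 : 0 < L by exact: lt_le_trans L1.
  have LP t : `|t| <= T -> forall a b, `|g t a - g t b| <= L * `|a - b|.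
    by move=> tT a b; rewrite (le_trans (L'P t tT a b))// ler_wpM2r// le_max lexx.
  have [M' M'P] : exists M, forall t, `|t| <= T -> `| `|Y 1%N t - Y 0%N t| | <= M.
    apply: (@segment_bounded (fun t => `|Y 1%N t - Y 0%N t|)) => t.
    by apply: cvg_norm; apply: cvgB; [exact: (Yc 1%N)|exact: (Yc 0%N)].
  pose M := Num.max M' 0; have M0 : 0 <= M by rewrite le_max lexx orbT.
  exists (M * expR (2 * L * T)).
  suff W k t : `|t| <= T -> `|Y k.+1 t - Y k t| <= M * 2^-1 ^+ k * expR (2 * L * `|t|).
    move=> k t tT; rewrite (le_trans (W k t tT))// [leRHS]mulrAC ler_wpM2l//.
      by rewrite mulr_ge0// exprn_ge0.
    by rewrite ler_expR ler_wpM2l// mulr_ge0// ltW.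
  elim: k t => [|k IH] t tT.
    rewrite expr0 mulr1 (le_trans (y := M))//.
      by have := M'P t tT; rewrite normr_id => H; rewrite le_max H.
    by rewrite ler_peMr// -expR0 ler_expR !mulr_ge0// ltW.
  apply: mx_norm_le => [|i j]; first by rewrite !mulr_ge0// ?exprn_ge0// expR_ge0.
  have VD := velocity_sub (PD _ (Yc k.+1)) (PD _ (Yc k)).
  have := @exp_growth R (fun s => (P (Y k.+1) s - P (Y k) s) 0 j)
    (fun s => (g s (Y k.+1 s) - g s (Y k s)) 0 j) (2 * L) (M * 2^-1 ^+ k.+1) t.
  rewrite (P0 _ (Yc _)) (P0 _ (Yc _)) subrr [(0 : 'rV[R]_N) _ _]mxE subr0 ord1; apply.
    by rewrite mulr_ge0// exprn_ge0.
  move=> s st; split; first exact: VD.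
  have sT : `|s| <= T by exact: le_trans tT.
  rewrite (le_trans (mx_entry_le _ _ _))// (le_trans (LP s sT _ _))//.
  rewrite (le_trans (ler_wpM2l (ltW L0) (IH s sT)))//.
  by rewrite exprS le_eqVlt; apply/orP; left; apply/eqP; field.
have limY t : exists w : 'rV[R]_N, forall C,
    (forall k, `|Y k.+1 t - Y k t| <= C * 2^-1 ^+ k) ->
    forall k, `|Y k t - w| <= 2 * C * 2^-1 ^+ k.
  have [C0 C0P] := Ybound `|t|.
  have Yj C j : (forall k, `|Y k.+1 t - Y k t| <= C * 2^-1 ^+ k) ->
      forall k, `|Y k.+1 t 0 j - Y k t 0 j| <= C * 2^-1 ^+ k.
    move=> H k; rewrite (le_trans _ (H k))//.
    by have := mx_entry_le (Y k.+1 t - Y k t) 0 j; rewrite !mxE.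
  have [w wP] := choice (fun j => geometric_limit (Yj C0 j (fun k => C0P k t (lexx _)))).
  exists (\row_j w j) => C CP k.
  have C0' : 0 <= C by have := CP 0%N; rewrite expr0 mulr1; exact: le_trans.
  apply: mx_norm_le => [|i j]; first by rewrite !mulr_ge0// exprn_ge0.
  rewrite !mxE ord1; have [l lP] := geometric_limit (Yj C j CP).
  suff -> : w j = l by exact: lP.
  apply/subr0_eq/eqP; rewrite -normr_le0; apply: (@le0_geometric R _ (2 * C0 + 2 * C)) => n.
  rewrite -(subrKA (Y n t 0 j)) (le_trans (ler_normD _ _))// mulrDl distrC.
  by apply: lerD; [exact: wP|exact: lP].
have [y yP] := choice limY.
have small (C e : R) : 0 < e -> exists k, C * 2^-1 ^+ k < e.
  move=> e0; apply: contrapT => H; suff : e <= 0 by move=> /(lt_le_trans e0); rewrite ltxx.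
  by apply: (@le0_geometric R e C) => k; rewrite leNgt; apply/negP => Ck; apply: H; exists k.
have yC T : exists2 C, 0 <= C & forall k t, `|t| <= T -> `|Y k t - y t| <= C * 2^-1 ^+ k.
  have [C CP] := Ybound T; have [T0|T0] := leP 0 T; last first.
    by exists 0 => // k t tT; have := le_lt_trans tT T0; rewrite ltNge normr_ge0.
  exists (2 * C) => [|k t tT]; last by apply: yP => k'; exact: CP.
  by rewrite mulr_ge0//; have := CP 0%N 0; rewrite normr0 expr0 mulr1 => /(_ T0); exact: le_trans.
have yc : continuous y.
  move=> t; apply/(@cvgrPdist_le _ _ _ (nbhs t) _) => e e0.
  have [C C0 CP] := yC (`|t| + 1).
  have [k Ck] := small C (e / 3) (divr_gt0 e0 (ltr0n _ 3)).
  have /(@cvgrPdist_le _ _ _ (nbhs t) _)/(_ (e / 3) (divr_gt0 e0 (ltr0n _ 3))) Ykc := Yc k t.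
  have Nt := near0_lt (@ltr01 R); near=> s.
  have st : `|t - s| <= 1.
    suff : ball t 1 s by rewrite -ball_normE/= => /ltW.
    by near: s; exact: nbhsx_ballx.
  have sT : `|s| <= `|t| + 1.
    by rewrite -[s](subKr t) (le_trans (ler_normB _ _))// lerD2l.
  have H1 := CP k t; rewrite lerDl ler01 in H1; have {}H1 := H1 isT.
  have H2 := CP k s sT.
  have H3 : `|Y k t - Y k s| <= e / 3 by near: s.
  have -> : y t - y s = (Y k t - Y k s) + (Y k s - y s) - (Y k t - y t).
    by apply/rowP => j; rewrite !mxE; ring.
  rewrite (le_trans (ler_normB _ _))// (le_trans (lerD (ler_normD _ _) (lexx _)))//.
  by move: H1 H2 H3 Ck; lra.
(* The iterates Y k.+1 = P (Y k) converge to y and to P y alike. *)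
have yPy : y = P y.
  apply/funext => t; apply/rowP => j.
  have [C C0 CP] := yC `|t|; have [L' L'P] := Hlip `|t|; pose L := Num.max L' 0.
  have L0 : 0 <= L by rewrite le_max lexx orbT.
  apply/subr0_eq/eqP; rewrite -normr_le0.
  apply: (@le0_geometric R _ (C + C * expR (L * `|t|))) => k.
  have H1 : `|Y k.+1 t 0 j - y t 0 j| <= C * 2^-1 ^+ k.
    rewrite (le_trans (y := C * 2^-1 ^+ k.+1))//; last first.
      by rewrite ler_wpM2l// exprS ler_piMl// ?exprn_ge0//; lra.
    have := mx_entry_le (Y k.+1 t - y t) 0 j; rewrite !mxE => /le_trans; apply.
    exact: CP.
  have VD := velocity_sub (PD _ (Yc k)) (PD _ yc).
  have H2 : `|(P (Y k) t - P y t) 0 j - (P (Y k) 0 - P y 0) 0 j| <=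
      C * 2^-1 ^+ k * expR (L * `|t|).
    apply: (@exp_growth R (fun s => (P (Y k) s - P y s) 0 j)
      (fun s => (g s (Y k s) - g s (y s)) 0 j)) => [|s st].
      by rewrite mulr_ge0// exprn_ge0.
    split; first exact: VD.
    rewrite (le_trans (mx_entry_le _ _ _))// (le_trans (L'P s st _ _))//.
    rewrite (le_trans (y := L * (C * 2^-1 ^+ k)))//.
      rewrite (le_trans (y := L * `|Y k s - y s|))//.
        by rewrite ler_wpM2r// le_max lexx.
      by rewrite ler_wpM2l//; exact: CP.
    rewrite mulrC ler_peMr ?mulr_ge0// ?exprn_ge0//.
    by rewrite -expR0 ler_expR mulr_ge0.
  rewrite (P0 _ (Yc _)) (P0 _ yc) subrr [(0 : 'rV[R]_N) _ _]mxE subr0 in H2.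
  have -> : y t 0 j - P y t 0 j = (P (Y k) t - P y t) 0 j - (Y k.+1 t 0 j - y t 0 j).
    by rewrite [Y k.+1]/(P (Y k)) !mxE; ring.
  rewrite (le_trans (ler_normB _ _))// addrC mulrDl lerD//.
  by rewrite mulrAC.
exists y; split; first by rewrite yPy P0.
by rewrite {1}yPy; exact: PD.
Unshelve. all: by end_near. Qed.

(** Compactness of the time interval turns joint continuity along it into
    uniform convergence. *)
Lemma tube_near (La : topologicalType) p q (f : R -> La -> 'M[R]_(p, q)) (la0 : La) :
  (forall t, f x.1 x.2 @[x --> (t, la0)] --> f t la0) ->
  forall T e, 0 < e -> \forall la \near la0, forall t, `|t| <= T ->
    `|f t la - f t la0| <= e.
Proof.
move=> Hc T e e0.
have /compact_near_coveringP K : compact `[- T, T]%classic by exact: segment_compact.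
suff : \forall la \near la0, `[- T, T]%classic `<=`
    (fun s => `|f s la - f s la0| <= e).
  by apply: filterS => la Hla s sT; apply: Hla; rewrite /= in_itv/= -ler_norml.
apply: K => s _.
have /cvgrPdist_le/(_ _ (divr_gt0 e0 (ltr0n _ 2))) H1 := Hc s.
have H2 : \forall s' \near s, `|f s la0 - f s' la0| <= e / 2.
  have [[A B] [/= As Bla] AB] := H1.
  apply: filterS As => s' As'; apply: (AB (s', la0)); split => //.
  exact: nbhs_singleton.
have H3 := near_fst la0 H2.
near=> x.
have Q1 : `|f s la0 - f x.1 x.2| <= e / 2 by near: x.
have Q2 : `|f s la0 - f x.1 la0| <= e / 2 by near: x.
rewrite -(subrKA (f s la0)) (le_trans (ler_normD _ _))//.
by rewrite [e]splitr lerD// distrC.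
Unshelve. all: by end_near. Qed.

(** The defect of the solution at [la0] as a solution at [la] is uniformly small
    on compact time intervals, by compactness, and Grönwall's inequality
    propagates it. *)
Theorem ode_param_cont (La : topologicalType) (g : R -> La -> 'rV[R]_N -> 'rV[R]_N)
    (y : R -> La -> 'rV[R]_N) (la0 : La) :
  (forall la, velocity (y^~ la) (fun t => g t la (y t la))) ->
  (forall T : R, exists L, \forall la \near la0, forall t : R, `|t| <= T ->
    forall a b, `|g t la a - g t la b| <= L * `|a - b|) ->
  (forall t, g q.1 q.2 (y q.1 la0) @[q --> (t, la0)] --> g t la0 (y t la0)) ->
  y 0 la @[la --> la0] --> y 0 la0 ->
  forall t, y q.1 q.2 @[q --> (t, la0)] --> y t la0.
Proof.
move=> yV Hlip Hc H0 t; pose T := `|t| + 1.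
have [L' LP'] := Hlip T; pose L := Num.max L' 0.
have L0 : 0 <= L by rewrite le_max lexx orbT.
have defect := @tube_near La 1 N (fun s la => g s la (y s la0)) la0 Hc T.
pose E := expR ((L * (N%:R + 1) + 1) * T).
apply/(@cvgrPdist_le _ _ _ (nbhs (t, la0)) _) => e e0.
have A0 : 0 < 2 * N%:R * E + 1 by rewrite ltr_wpDl// !mulr_ge0// expR_ge0.
pose d := e / 2 / (2 * N%:R * E + 1).
have d0 : 0 < d by rewrite !divr_gt0.
have N1 := near_snd t (defect d d0).
have N2' : \forall la \near la0, `|y 0 la0 - y 0 la| <= d.
  by move/cvgrPdist_le : H0 => /(_ d d0).
have N3' : \forall s \near t, `|y t la0 - y s la0| <= e / 2.
  have yct : {for t, continuous (y^~ la0)} by exact: (velocity_cont (yV la0)).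
  by apply: ((@cvgrPdist_le _ _ _ (nbhs t) _ _ _).1 yct); rewrite divr_gt0.
have N4' : \forall s \near t, `|s| <= T.
  near=> s.
  have st : `|t - s| <= 1.
    suff : ball t 1 s by rewrite -ball_normE/= => /ltW.
    by near: s; exact: nbhsx_ballx.
  by rewrite -[s](subKr t) (le_trans (ler_normB _ _))// lerD2l.
have N2 := near_snd t N2'; have N3 := near_fst la0 N3'; have N4 := near_fst la0 N4'.
have N5 := near_snd t LP'.
near=> q; have qT : `|q.1| <= T by near: q.
have Hd : forall s, `|s| <= T -> `|g s q.2 (y s la0) - g s la0 (y s la0)| <= d by near: q.
have Hl : forall s, `|s| <= T -> forall a b, `|g s q.2 a - g s q.2 b| <= L' * `|a - b|.
  by near: q.
have Hi : `|y 0 la0 - y 0 q.2| <= d by near: q.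
have Ht : `|y t la0 - y q.1 la0| <= e / 2 by near: q.
have V := velocity_sub (yV q.2) (yV la0).
have G : `|y q.1 q.2 - y q.1 la0| ^+ 2 <= N%:R * (`|y 0 q.2 - y 0 la0| ^+ 2 + d ^+ 2) *
    expR ((L * (N%:R + 1) + 1) * `|q.1|).
  apply: (gronwall V L0) => [s sq|]; last exact: ltW.
  have sT : `|s| <= T by exact: le_trans qT.
  rewrite -(subrKA (g s q.2 (y s la0))) (le_trans (ler_normD _ _))// lerD//; last exact: Hd.
  by rewrite (le_trans (Hl s sT _ _))// ler_wpM2r// le_max lexx.
have {}G : `|y q.1 q.2 - y q.1 la0| ^+ 2 <= (e / 2) ^+ 2.
  rewrite (le_trans G)// (le_trans (y := N%:R * (d ^+ 2 + d ^+ 2) * E))//.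
    apply: ler_pM; rewrite ?expR_ge0 ?mulr_ge0 ?addr_ge0 ?sqr_ge0//.
      by rewrite ler_wpM2l// lerD2r ler_sqr ?nnegrE ?(ltW d0)// distrC.
    by rewrite ler_expR ler_wpM2l// addr_ge0// mulr_ge0// addr_ge0.
  rewrite (_ : _ * _ * _ = 2 * N%:R * E * d ^+ 2); last by ring.
  have -> : e / 2 = (2 * N%:R * E + 1) * d by rewrite /d [RHS]mulrC divfK// gt_eqF.
  have B0 : 0 <= 2 * N%:R * E by rewrite !mulr_ge0// expR_ge0.
  rewrite [leRHS]exprMn ler_wpM2r ?sqr_ge0// expr2.
  by have := mulr_ge0 B0 B0; move: B0; move: (2 * N%:R * E) => a; lra.
have {}G : `|y q.1 q.2 - y q.1 la0| <= e / 2.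
  by rewrite -ler_sqr ?nnegrE// divr_ge0// ltW.
rewrite -(subrKA (y q.1 la0)) (le_trans (ler_normD _ _))// [e]splitr lerD//.
by rewrite distrC.
Unshelve. all: by end_near. Qed.

End Existence.

(** * Smooth dependence on parameters *)

Section SmoothDependence.
Context {R : realType}.

Lemma cvg_mulmx (T : Type) (F : set_system T) {FF : Filter F} m n p
    (A : T -> 'M[R]_(m, n)) (B : T -> 'M[R]_(n, p)) (a : 'M[R]_(m, n)) (b : 'M[R]_(n, p)) :
  A x @[x --> F] --> a -> B x @[x --> F] --> b -> A x *m B x @[x --> F] --> a *m b.
Proof.
move=> Aa Bb; apply: cvg_mx => i j; rewrite mxE.
rewrite (_ : (fun x => _) = (fun x => \sum_k A x i k * B x k j)).
  by apply: cvg_sumr => k; apply: cvgM; exact: cvg_entry.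
by apply/funext => x; rewrite mxE.
Qed.

Lemma slope_mxE m N (g : 'rV[R]_m -> 'rV[R]_N) y y' : smooth_mx setT g ->
  g y' - g y = (y' - y) *m slope_mx g y y'.
Proof.
move=> gs; apply/rowP => j; rewrite !mxE /slope_mx.
transitivity (\sum_i slope (fun w => g w 0 j) y y' i * (y' 0 i - y 0 i)); last first.
  by apply: eq_bigr => i _; rewrite !mxE mulrC.
rewrite /slope; case: cid => A /= []// xi _ i.
exact: (smooth_derivable (gs 0 j)).
Qed.

Lemma slope_mx_diag m N (g : 'rV[R]_m -> 'rV[R]_N) y : smooth_mx setT g ->
  slope_mx g y y = jac g y.
Proof.
move=> gs; apply/subr0_eq/eqP; rewrite -normr_le0; apply/ler_addgt0Pr => e e0.
have [d d0 dP] := slope_mx_near openT gs (I : setT y) e0.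
by rewrite add0r; have [||//] := dP y y; rewrite subrr normr0.
Qed.

Lemma is_derive_quotient (V : normedModType R) (f : V -> R) (u v : V) l :
  h^-1 * (f (h *: v + u) - f u) @[h --> (0 : R)^'] --> l -> is_derive u v f l.
Proof. by move=> H; split; [apply/cvg_ex; exists l|exact/cvg_lim]. Qed.

(** Difference quotients of a family of solutions in a parameter satisfy the
    linear equation $\dot q = q\,A$, with $A$ the slope of the field between the
    two solutions. This equation still makes sense when the increment is zero,
    where it is the variational equation; continuous dependence of its solutions
    on the parameter and on the increment gives the differentiability. *)
Theorem variational N d (b : 'rV[R]_N -> 'rV[R]_N) (Y : R -> 'rV[R]_d -> 'rV[R]_N)
    (i : 'I_d) :
  smooth_mx setT b -> (forall p, velocity (Y^~ p) (fun t => b (Y t p))) ->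
  (forall t p, Y q.1 q.2 @[q --> (t, p)] --> Y t p) ->
  smooth_mx setT (Y 0) ->
  exists Z : R -> 'rV[R]_d -> 'rV[R]_N,
    [/\ forall t p j, is_derive p (delta_mx 0 i) (fun p => Y t p 0 j) (Z t p 0 j),
        forall p, velocity (Z^~ p) (fun t => Z t p *m jac b (Y t p)),
        forall t p, Z q.1 q.2 @[q --> (t, p)] --> Z t p &
        forall p, Z 0 p = row i (jac (Y 0) p)].
Proof.
move=> bs YV Yc Y0s; pose e : 'rV[R]_d := delta_mx 0 i.
have Jc (y : 'rV[R]_N) : {for y, continuous (jac b)}.
  exact: smooth_mx_cont (smooth_jac openT bs) I.
have Ypc p t : {for t, continuous (Y^~ p)} by exact: velocity_cont (YV p) t.
have Jpc p : continuous (fun t => jac b (Y t p)).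
  by move=> t; exact: (cvg_comp _ _ (Ypc p t) (Jc _)).
have lin n (J : 'M[R]_n) (c : R) (x x' : 'rV[R]_n) : `|J| <= c ->
    `|x *m J - x' *m J| <= n%:R * c * `|x - x'|.
  move=> Jle; rewrite -mulmxBl (le_trans (mulmx_norm_le _ _))// mulrAC.
  by rewrite ler_wpM2r// ler_wpM2l.
have exZ p : exists z, z 0 = row i (jac (Y 0) p) /\
    velocity z (fun t => z t *m jac b (Y t p)).
  apply: (@ode_exists R N (fun t z => z *m jac b (Y t p))) => [T|y yc t].
    have [M MP] := @segment_bounded R (fun t => `|jac b (Y t p)|) T
      (fun t => cvg_norm (Jpc p t)).
    exists (N%:R * M) => t tT x x'; apply: lin => //.
    by have := MP t tT; rewrite normr_id.
  by apply: cvg_mulmx; [exact: yc|exact: Jpc].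
have [Z' ZP] := choice exZ; pose Z t p := Z' p t.
have Z0 p : Z 0 p = row i (jac (Y 0) p) by have [] := ZP p.
have ZV p : velocity (Z^~ p) (fun t => Z t p *m jac b (Y t p)) by have [] := ZP p.
pose A t (la : 'rV[R]_d * R) := slope_mx b (Y t la.1) (Y t (la.2 *: e + la.1)).
pose Q t (la : 'rV[R]_d * R) : 'rV[R]_N :=
  if la.2 == 0 then Z t la.1 else la.2^-1 *: (Y t (la.2 *: e + la.1) - Y t la.1).
have A0 t p : A t (p, 0) = jac b (Y t p).
  by rewrite /A/= scale0r add0r slope_mx_diag.
have QV la : velocity (Q^~ la) (fun t => Q t la *m A t la).
  case: la => p h; rewrite /Q/=; case: eqVneq => [->|h0].
    by move=> t; rewrite A0; exact: ZV.
  move=> t j; rewrite /A/= -scalemxAl -slope_mxE//.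
  have V := velocity_sub (YV (h *: e + p)) (YV p) t j.
  have -> : (fun s => (h^-1 *: (Y s (h *: e + p) - Y s p)) 0 j) =
      h^-1 *: (fun s => (Y s (h *: e + p) - Y s p) 0 j).
    by apply/funext => s; rewrite [LHS]mxE.
  by rewrite [X in is_derive _ _ _ X]mxE; exact: is_deriveZ.
have inc (p0 : 'rV[R]_d) : la.2 *: e + la.1 @[la --> (p0, (0 : R))] --> p0.
  suff : la.2 *: e + la.1 @[la --> (p0, (0 : R))] --> (0 : R) *: e + p0.
    by rewrite scale0r add0r.
  apply: cvgD; last exact: cvg_fst.
  by apply: cvgZr_tmp; exact: cvg_snd.
have Ac (p0 : 'rV[R]_d) (t : R) : A q.1 q.2 @[q --> (t, (p0, (0 : R)))] --> A t (p0, 0).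
  rewrite A0; apply/cvgrPdist_le => eps eps0.
  have [del del0 delP] := slope_mx_near openT bs (I : setT (Y t p0)) eps0.
  have C1 : (q.1, q.2.1) @[q --> (t, (p0, (0 : R)))] --> (t, p0).
    apply: cvg_to_pair; first exact: cvg_fst.
    apply: (cvg_comp snd fst (G := nbhs (p0, (0 : R)))); first exact: cvg_snd.
    exact: cvg_fst.
  have C2 : (q.1, q.2.2 *: e + q.2.1) @[q --> (t, (p0, (0 : R)))] --> (t, p0).
    apply: cvg_to_pair; first exact: cvg_fst.
    apply: (cvg_comp snd (fun la => la.2 *: e + la.1) (G := nbhs (p0, (0 : R)))).
      exact: cvg_snd.
    exact: inc.
  have /cvgrPdist_lt/(_ _ del0) N1 := cvg_comp _ _ C1 (Yc t p0).
  have /cvgrPdist_lt/(_ _ del0) N2 := cvg_comp _ _ C2 (Yc t p0).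
  near=> q; rewrite distrC; apply: (delP _ _ _ _).2; rewrite distrC; near: q.
    exact: N1.
  exact: N2.
have Q0 la : Q 0 la = e *m slope_mx (Y 0) la.1 (la.2 *: e + la.1).
  case: la => p h; rewrite /Q/=; case: eqVneq => [->|h0].
    by rewrite scale0r add0r slope_mx_diag// Z0 -rowE.
  by rewrite slope_mxE// addrK -scalemxAl scalerA mulVf// scale1r.
have Qc (t : R) (p0 : 'rV[R]_d) : Q q.1 q.2 @[q --> (t, (p0, (0 : R)))] --> Q t (p0, 0).
  apply: (ode_param_cont (g := fun t la z => z *m A t la)) => //.
  - move=> T; have [M MP] := @segment_bounded R (fun t => `|jac b (Y t p0)|) T
      (fun t => cvg_norm (Jpc p0 t)).
    exists (N%:R * (M + 1)).
    have := tube_near (Ac p0) T (@ltr01 R); apply: filterS => la Hla s sT x x'.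
    apply: lin => //; have H1 := Hla s sT; have := MP s sT; rewrite normr_id => H2.
    rewrite A0 in H1; rewrite -(subrK (jac b (Y s p0)) (A s la)).
    by rewrite (le_trans (ler_normD _ _))// addrC lerD.
  - move=> s; apply: cvg_mulmx; last exact: Ac.
    apply: (cvg_comp fst (fun r => Q r (p0, 0)) (G := nbhs s)); first exact: cvg_fst.
    exact: velocity_cont (QV (p0, 0)) s.
  - rewrite Q0/= scale0r add0r slope_mx_diag//.
    rewrite (_ : Q 0 = fun la => e *m slope_mx (Y 0) la.1 (la.2 *: e + la.1)); last first.
      exact/funext.
    apply: cvg_mulmx; first exact: cvg_cst.
    apply/cvgrPdist_le => eps eps0.
    have [del del0 delP] := slope_mx_near openT Y0s (I : setT p0) eps0.
    have N1 : la.1 @[la --> (p0, (0 : R))] --> p0 by exact: cvg_fst.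
    have N2 := inc p0.
    move/cvgrPdist_lt : N1 => /(_ _ del0) N1; move/cvgrPdist_lt : N2 => /(_ _ del0) N2.
    near=> la; rewrite distrC; apply: (delP _ _ _ _).2; rewrite distrC; near: la.
      exact: N1.
    exact: N2.
exists Z; split => //.
- move=> t p j; apply: is_derive_quotient.
  have C : Q t (p, h) @[h --> (0 : R)^'] --> Z t p.
    have -> : Z t p = Q t (p, 0) by rewrite /Q/= eqxx.
    apply: cvg_within_filter.
    apply: (cvg_comp (fun h => (t, (p, h))) (fun q => Q q.1 q.2)
      (G := nbhs (t, (p, (0 : R))))); last exact: Qc.
    apply: cvg_to_pair; first exact: cvg_cst.
    by apply: cvg_to_pair; [exact: cvg_cst|exact: cvg_id].
  apply: cvg_trans (cvg_entry (i := 0) (j := j) C).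
  apply: near_eq_cvg; rewrite near_withinE; near=> h => h0.
  by rewrite /Q/= (negbTE h0) !mxE.
- move=> t p.
  have -> : Z t p = Q t (p, 0) by rewrite /Q/= eqxx.
  have -> : (fun q : R * 'rV[R]_d => Z q.1 q.2) =
      (fun q => Q q.1 (q.2, 0)) by apply/funext => q; rewrite /Q/= eqxx.
  apply: (cvg_comp (fun q => (q.1, (q.2, 0))) (fun q => Q q.1 q.2)
    (G := nbhs (t, (p, (0 : R))))); last exact: Qc.
  apply: cvg_to_pair; first exact: cvg_fst.
  by apply: cvg_to_pair; [exact: cvg_snd|exact: cvg_cst].
Unshelve. all: by end_near. Qed.

(** Induction on the order, through the tangent system $\dot y = b(y)$,
    $\dot z = z\,Db(y)$, whose solutions are the solutions of the original
    system together with one of their partial derivatives. No time is lost at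
    each order, since the family of solutions is given beforehand. *)
Theorem ode_smooth N d (b : 'rV[R]_N -> 'rV[R]_N) (Y : R -> 'rV[R]_d -> 'rV[R]_N) :
  smooth_mx setT b -> (forall p, velocity (Y^~ p) (fun t => b (Y t p))) ->
  (forall t p, Y q.1 q.2 @[q --> (t, p)] --> Y t p) ->
  smooth_mx setT (Y 0) -> forall t, smooth_mx setT (Y t).
Proof.
move=> bs YV Yc Y0s t i' j k; rewrite ord1 {i'}.
elim: k N b Y bs YV Yc Y0s t j => [|k IH] N b Y bs YV Yc Y0s t j.
all: have cc u : setT u -> {for u, continuous (fun p => Y t p 0 j)}.
  1,3: move=> _; apply: (@cvg_entry R _ (nbhs u) _ _ _ (fun p => Y t p)).
  1,2: apply: (cvg_comp (fun p => (t, p)) (fun q => Y q.1 q.2) (G := nbhs (t, u)));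
    last exact: Yc.
  1,2: by apply: cvg_to_pair; [exact: cvg_cst|exact: cvg_id].
  by split.
split=> // i; have [Z [DZ ZV Zc Z0]] := variational i bs YV Yc Y0s.
split=> [u _|]; first by have [] := DZ t u j.
apply: (Ck_ext (f := fun p => Z t p 0 j)) => [|u _|]; first exact: openT.
  by have [_ <-] := DZ t u j.
pose Tb (w : 'rV[R]_(N + N)) := row_mx (b (lsubmx w)) (rsubmx w *m jac b (lsubmx w)).
have ls : smooth_mx setT (fun w : 'rV[R]_(N + N) => lsubmx w).
  exact: smooth_lsubmx openT.
have Tbs : smooth_mx setT Tb.
  apply: smooth_row_mx; first exact: openT.
    exact: (smooth_mx_comp openT openT (U' := setT)).
  apply: smooth_mulmx; [exact: openT|exact: smooth_rsubmx openT|].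
  by apply: (smooth_mx_comp openT openT (U' := setT)) => //; exact: smooth_jac openT bs.
apply: (Ck_ext (f := fun p => row_mx (Y t p) (Z t p) 0 (rshift N j))) => [|u _|].
- exact: openT.
- by rewrite row_mxEr.
apply: (IH (N + N)%N Tb (fun t p => row_mx (Y t p) (Z t p)) Tbs).
- move=> p; have := velocity_row (YV p) (ZV p).
  by rewrite /Tb; under [X in _ -> velocity _ X]eq_fun do rewrite row_mxKl row_mxKr.
- move=> s p; apply: (@cvg_row_mx R N N _ (nbhs (s, p)) _ _ _ _ _ _ (Yc s p) (Zc s p)).
- apply: smooth_row_mx; [exact: openT|exact: Y0s|].
  rewrite (_ : Z 0 = fun p => row i (jac (Y 0) p)); last exact/funext.
  move=> i0 j0; apply: (smooth_ext openT _ (smooth_jac openT Y0s i j0)) => w _.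
  by rewrite ord1 [RHS]mxE.
Qed.

End SmoothDependence.

(** * Bump functions *)

Section Bump.
Context {R : realType}.
Implicit Types x h : R.

(** The functions $x^{-n}e^{-1/x}$, extended by $0$: differentiation stays
    within their linear span, so that all of them are smooth. *)
Definition flat n x : R := if 0 < x then expR (- x^-1) * x^-1 ^+ n else 0.

Lemma flat_ge0 n x : 0 <= flat n x.
Proof.
by rewrite /flat; case: ifP => // x0; rewrite mulr_ge0 ?expR_ge0// exprn_ge0// invr_ge0 ltW.
Qed.

Lemma flat_eq0 n x : x <= 0 -> flat n x = 0.
Proof. by rewrite /flat leNgt => /negbTE->. Qed.

Lemma flat_gt0 x : 0 < x -> 0 < flat 0 x.
Proof. by rewrite /flat => ->; rewrite mulr1 expR_gt0. Qed.

Lemma flat_small n h : flat n h <= n.+1`!%:R * `|h|.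
Proof.
rewrite /flat; case: ifP => h0; last by rewrite mulr_ge0.
rewrite gtr0_norm// expRN; set s := h^-1.
have s0 : 0 < s by rewrite invr_gt0.
have F0 : 0 < (n.+1)`!%:R :> R by rewrite ltr0n fact_gt0.
have E : s ^+ n.+1 / n.+1`!%:R <= expR s.
  by rewrite (le_trans _ (expR_ge1Dxn n (ltW s0)))// lerDr.
rewrite mulrC ler_pdivrMr ?expR_gt0// -(invrK h) -/s mulrAC ler_pdivlMr//.
by move: E; rewrite ler_pdivrMr// -exprSr mulrC.
Qed.

Lemma is_derive_flat n x : is_derive x 1 (flat n) (flat n.+2 x - n%:R * flat n.+1 x).
Proof.
have [x0|x0|->] := ltgtP x 0.
- rewrite !flat_eq0 ?ltW// mulr0 subrr.
  apply: is_derive_near (is_derive_cst (0 : R) x 1).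
  near=> y; rewrite flat_eq0//; apply: ltW; near: y.
  by apply: open_nbhs_nbhs; split; [exact: open_lt|exact: x0].
- pose g y : R := expR (- y^-1) * y^-1 ^+ n.
  have xN : x != 0 by rewrite gt_eqF.
  have D1 : is_derive x 1 (fun y : R => y^-1) (- x ^- 2).
    split; first by apply: derivableV => //; exact: derivable_id.
    by rewrite deriveV// derive_id /GRing.scale/= mulr1.
  have D2 : is_derive x 1 (fun y : R => expR (- y^-1)) (expR (- x^-1) * x ^- 2).
    apply: (@is_derive1_comp R expR (fun y => - y^-1)).
    by rewrite -[X in is_derive _ _ _ X]opprK; apply: is_deriveN.
  have D3 : is_derive x 1 (fun y : R => y^-1 ^+ n) (n%:R * x^-1 ^+ n.-1 * - x ^- 2).
    case: n {g} => [|n]; first by rewrite !mul0r; exact: is_derive_cst.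
    rewrite [X in is_derive _ _ X _](_ : _ = (fun y : R => y^-1) ^+ n.+1); last first.
      by rewrite exprfctE.
    exact: (@is_deriveX R R (fun y : R => y^-1) n.+1 x 1 _ D1).
  apply: (@is_derive_near R R g).
    near=> y; have y0 : 0 < y.
      by near: y; apply: open_nbhs_nbhs; split; [exact: open_gt|exact: x0].
    by rewrite /flat y0.
  have := @is_deriveM R R _ _ x 1 _ _ D2 D3.
  rewrite /GRing.scale/= /flat x0 => /is_derive_eq; apply.
  case: n {g D3} => [|n]; first by rewrite !mul0r !mulr0 add0r subr0 expr0 mul1r exprVn.
  by rewrite /= -exprVn; move: (x^-1) => z; move: (expR _) => w; rewrite !exprS; ring.
rewrite !(flat_eq0 _ (lexx 0)) mulr0 subrr.
apply/is_derive_epsP => e e0; near=> h.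
rewrite [h *: 1]mulr1 addr0 (flat_eq0 _ (lexx 0)) mulr0 !subr0 ger0_norm ?flat_ge0//.
have -> : flat n h = flat n.+1 h * h.
  rewrite /flat; case: ifP => h0; last by rewrite mul0r.
  by rewrite exprSr mulrA divfK// gt_eqF.
rewrite (le_trans (y := flat n.+1 h * `|h|))//.
  by rewrite ler_wpM2l ?flat_ge0// ler_norm.
rewrite ler_wpM2r// (le_trans (flat_small _ _))// mulrC -ler_pdivlMr ?ltr0n ?fact_gt0//.
apply: ltW; near: h; apply: near0_lt; by rewrite divr_gt0// ltr0n fact_gt0.
Unshelve. all: by end_near. Qed.

Lemma smooth_flat m (U : set 'rV[R]_m) n g : open U -> Cinfty U g ->
  Cinfty U (fun u => flat n (g u)).
Proof.
move=> oU gs k; elim: k n => [|k IH] n.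
all: have D u v l : is_derive u v g l ->
  is_derive u v (fun u => flat n (g u)) ((flat n.+2 (g u) - n%:R * flat n.+1 (g u)) * l).
  1,3: move=> Dg; have := is_derive_line (fun u => flat n (g u)) u v 0
    ((flat n.+2 (g u) - n%:R * flat n.+1 (g u)) * l); rewrite scale0r add0r => E.
  1,2: apply/E; apply: (@is_derive1_comp R (flat n) (fun s => g (s *: v + u)));
    rewrite ?scale0r ?add0r; first exact: is_derive_flat.
  1,2: by apply/(is_derive_line g u v 0 l); rewrite scale0r add0r.
all: have cc u : U u -> {for u, continuous (fun u => flat n (g u))}.
  1,3: move=> Uu; apply: (cvg_comp g (flat n) (G := nbhs (g u))).
  1,3: exact: smooth_cont gs Uu.
  1,2: exact: is_derive_cont (is_derive_flat n (g u)).
  by split.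
split=> // i.
have Dg u : U u -> is_derive u (delta_mx 0 i) g (partial i g u).
  by move=> Uu; apply: derivableP; exact: smooth_derivable gs Uu.
split=> [u /Dg/D[]//|].
apply: (Ck_ext (f := fun u => (flat n.+2 (g u) - n%:R * flat n.+1 (g u)) * partial i g u)) => //.
  by move=> u /Dg/D[_ <-].
apply: CkM => //; last exact: smooth_partial.
apply: (Ck_ext (f := fun u => flat n.+2 (g u) + (- n%:R) * flat n.+1 (g u))) => //.
  by move=> u _; rewrite mulNr.
apply: CkD => //; apply: CkM => //; exact: Ck_cst.
Qed.

Definition smooth_step x : R := flat 0 x / (flat 0 x + flat 0 (1 - x)).

Lemma smooth_step_den x : flat 0 x + flat 0 (1 - x) != 0.
Proof.
rewrite gt_eqF//; have [x0|x0] := ltP 0 x.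
  by rewrite ltr_pwDl ?flat_gt0// flat_ge0.
by rewrite ltr_wpDl ?flat_ge0// flat_gt0//; lra.
Qed.

Lemma smooth_step0 x : x <= 0 -> smooth_step x = 0.
Proof. by move=> x0; rewrite /smooth_step flat_eq0// mul0r. Qed.

Lemma smooth_step1 x : 1 <= x -> smooth_step x = 1.
Proof.
move=> x1; have := smooth_step_den x.
by rewrite /smooth_step [flat 0 (1 - x)]flat_eq0 ?subr_le0// addr0 => /divff.
Qed.

Lemma smooth_smooth_step m (U : set 'rV[R]_m) g : open U -> Cinfty U g ->
  Cinfty U (fun u => smooth_step (g u)).
Proof.
move=> oU gs; apply: smoothM => //; first exact: smooth_flat.
apply: smoothV => //; first by move=> u _; exact: smooth_step_den.
apply: smoothD => //; first exact: smooth_flat.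
by apply: smooth_flat => //; apply: smoothB => //; exact: smooth_cst.
Qed.

Lemma bump_exists m (c : 'rV[R]_m) (r : R) : 0 < r ->
  exists chi, [/\ Cinfty setT chi, forall u, `|u - c| <= r -> chi u = 1 &
    forall u, 2 * r <= `|u - c| -> chi u = 0].
Proof.
move=> r0.
pose chi (u : 'rV[R]_m) := \prod_(j < m) (smooth_step (2 - (u 0 j - c 0 j) / r) *
  smooth_step (2 + (u 0 j - c 0 j) / r)).
exists chi; split.
- apply: smooth_prod => [|j]; first exact: openT.
  have S : Cinfty setT (fun u : 'rV[R]_m => (u 0 j - c 0 j) / r).
    apply: smoothM; [exact: openT| |exact: (smooth_cst _ openT)].
    by apply: smoothB; [exact: openT|exact: smooth_coord openT|exact: smooth_cst openT].
  apply: smoothM; first exact: openT.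
    by apply: smooth_smooth_step; [exact: openT|apply: smoothB => //; [exact: openT|exact: smooth_cst openT]].
  by apply: smooth_smooth_step; [exact: openT|apply: smoothD => //; [exact: openT|exact: smooth_cst openT]].
- move=> u uc; rewrite /chi big1// => j _.
  have : `|(u 0 j - c 0 j) / r| <= 1.
    rewrite normrM normfV (gtr0_norm r0) ler_pdivrMr// mul1r (le_trans _ uc)//.
    by have := mx_entry_le (u - c) 0 j; rewrite !mxE.
  by rewrite ler_norml => /andP[H1 H2]; rewrite !smooth_step1 ?mulr1//; lra.
- move=> u uc.
  have [j Hj] : exists j, 2 * r <= `|u 0 j - c 0 j|.
    have [|[i j]/= E] := @mx_norm_neq0 R 1 m (u - c).
      by rewrite gt_eqF// (lt_le_trans _ uc)// mulr_gt0.
    exists j; rewrite (le_trans uc)// {1}/Num.Def.normr/= E ord1.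
    by rewrite !mxE.
  rewrite /chi (bigD1 j)//=.
  suff -> : smooth_step (2 - (u 0 j - c 0 j) / r) *
      smooth_step (2 + (u 0 j - c 0 j) / r) = 0 by rewrite mul0r.
  have : 2 <= `|(u 0 j - c 0 j) / r|.
    by rewrite normrM normfV (gtr0_norm r0) ler_pdivlMr.
  rewrite ler_normr => /orP[] H.
    by rewrite [X in X * _]smooth_step0 ?mul0r//; lra.
  by rewrite [X in _ * X]smooth_step0 ?mulr0//; lra.
Qed.

End Bump.

(** * Cutoff functions and the lemma of Hadamard *)

Section Cutoff.
Context {R : realType}.

Lemma open_dist_gt m (c : 'rV[R]_m) (r : R) : open [set u : 'rV[R]_m | r < `|u - c|].
Proof.
have C : continuous (fun u : 'rV[R]_m => `|u - c|).
  move=> u; apply: (@cvg_norm _ _ _ (nbhs u)).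
  by apply: (@cvgB _ _ _ (nbhs u)); [exact: cvg_id|exact: cvg_cst].
exact: (open_comp (D := [set x : R | r < x]) (fun u _ => C u) (@open_gt _ r)).
Qed.

Lemma open_dist_lt m (c : 'rV[R]_m) (r : R) : open [set u : 'rV[R]_m | `|u - c| < r].
Proof.
rewrite (_ : [set u | _] = ball c r); first exact: ball_open.
by apply/seteqP; split => w; rewrite -ball_normE/= distrC.
Qed.

Lemma open_dist_ball m (U : set 'rV[R]_m) u0 : open U -> U u0 ->
  exists2 r, 0 < r & forall u, `|u - u0| < r -> U u.
Proof.
move=> oU Uu0; have /nbhs_ballP[r /= r0 rP] : nbhs u0 U by exact: open_nbhs_nbhs.
by exists r => // u ur; apply: rP; rewrite -ball_normE/= distrC.
Qed.

(** The cutoff function turns a function on [U] into one on the whole space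
    with the same germ at [u0]. *)
Lemma cutoff_exists m (U : set 'rV[R]_m) u0 : open U -> U u0 ->
  exists (r : R) (chi : 'rV[R]_m -> R), [/\ 0 < r,
    forall u, `|u - u0| < 3 * r -> U u, Cinfty setT chi,
    (forall u, `|u - u0| <= r -> chi u = 1) /\
    (forall u, 2 * r <= `|u - u0| -> chi u = 0) &
    forall f, Cinfty U f -> Cinfty setT (fun u => chi u * f u)].
Proof.
move=> oU Uu0; have [d d0 dP] := open_dist_ball oU Uu0.
have r0 : 0 < d / 3 by rewrite divr_gt0.
have [chi [chis chi1 chi0]] := bump_exists u0 r0.
exists (d / 3), chi; split => //.
  by move=> u; rewrite mulrC divfK//; exact: dP.
move=> f fs; apply: smooth_local => u _.
have [ud|ud] := ltP `|u - u0| d.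
  exists U; first exact: dP.
  by apply: smoothM => //; exact: smooth_sub chis.
exists [set u : 'rV[R]_m | 2 * (d / 3) < `|u - u0|]; first by rewrite /=; lra.
apply: (smooth_ext (f := fun=> 0)); first exact: open_dist_gt.
  by move=> v /= /ltW/chi0 ->; rewrite mul0r.
by apply: smooth_cst; exact: open_dist_gt.
Qed.

(** Fields of compact support are Lipschitz, so that their trajectories are
    defined for all times. *)
Lemma bounded_of_support m (f : 'rV[R]_m -> R) u0 rho : continuous f ->
  (forall u, rho < `|u - u0| -> f u = 0) -> exists2 M, 0 <= M & forall u, `|f u| <= M.
Proof.
move=> fc f0; pose K := [set u : 'rV[R]_m | `|u - u0| <= Num.max rho 0].
have Kc : compact K.
  apply: bounded_closed_compact.
    exists (`|u0| + Num.max rho 0); split; first exact: num_real.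
    move=> x xM u /= uK; rewrite (le_trans _ (ltW xM))//.
    by rewrite -[u](subrK u0) (le_trans (ler_normD _ _))// addrC lerD2l.
  rewrite -[K]setCK; apply: open_closedC.
  rewrite (_ : ~` K = [set u : 'rV[R]_m | Num.max rho 0 < `|u - u0|]).
    exact: open_dist_gt.
  by apply/seteqP; split => u /=; rewrite ltNge => /negP.
have [||c _ cP] := @EVT_max_rV R m (fun u => `|f u|) K _ Kc.
- by exists u0; rewrite /K/= subrr normr0 le_max lexx orbT.
- by apply: continuous_subspaceT => u; apply: (@cvg_norm _ _ _ (nbhs u)); exact: fc.
exists `|f c| => // u; have [uK|uK] := leP `|u - u0| (Num.max rho 0).
  by apply: cP; rewrite inE.
by rewrite f0 ?normr0//; apply: le_lt_trans uK; rewrite le_max lexx.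
Qed.

Lemma lipschitz_of_support m (f : 'rV[R]_m -> R) u0 rho : Cinfty setT f ->
  (forall u, rho < `|u - u0| -> f u = 0) ->
  exists2 L, 0 <= L & (forall u, `|f u| <= L) /\
    forall y y', `|f y' - f y| <= L * `|y' - y|.
Proof.
move=> fs f0.
have [M M0 MP] := bounded_of_support (fun u => smooth_cont fs I) f0.
have df0 j u : rho < `|u - u0| -> partial j f u = 0.
  move=> ur; have [_ <-//] : is_derive u (delta_mx 0 j) f 0.
  apply: is_derive_near (is_derive_cst (0 : R) u _).
  near=> v; rewrite f0//; near: v.
  by apply: open_nbhs_nbhs; split; [exact: open_dist_gt|].
have B j := bounded_of_support (fun u => smooth_cont (smooth_partial j fs) I) (df0 j).
have B' j : exists x, 0 <= x /\ forall u, `|partial j f u| <= x.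
  by have [x] := B j; exists x.
have [L LP] := choice B'.
have S0 : 0 <= \sum_j L j by apply: sumr_ge0 => j _; have [] := LP j.
exists (M + \sum_j L j); first by rewrite addr_ge0.
split=> [u|y y']; first by rewrite (le_trans (MP u))// lerDl.
have [|A [-> AP]] := @coordinate_mean_value R m f y y'.
  by move=> xi _ j; exact: smooth_derivable fs I.
rewrite (le_trans (ler_norm_sum _ _ _))// mulrDl ler_wpDl ?mulr_ge0// mulr_suml.
apply: ler_sum => j _; rewrite normrM ler_pM//.
  by have [xi _ ->] := AP j; have [_] := LP j.
by have := mx_entry_le (y' - y) 0 j; rewrite !mxE.
Unshelve. all: by end_near. Qed.

Lemma lipschitz_mx_of_support m p q (A : 'rV[R]_m -> 'M[R]_(p, q)) u0 rho :
  smooth_mx setT A -> (forall u, rho < `|u - u0| -> A u = 0) ->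
  exists2 L, 0 <= L & (forall u, `|A u| <= L) /\
    forall y y', `|A y' - A y| <= L * `|y' - y|.
Proof.
move=> As A0.
have B (ij : 'I_p * 'I_q) : exists L, 0 <= L /\ (forall u, `|A u ij.1 ij.2| <= L) /\
    forall y y', `|A y' ij.1 ij.2 - A y ij.1 ij.2| <= L * `|y' - y|.
  have A0' u : rho < `|u - u0| -> A u ij.1 ij.2 = 0 by move=> /A0 ->; rewrite mxE.
  by have [L L0 LP] := lipschitz_of_support (As ij.1 ij.2) A0'; exists L.
have [L LP] := choice B.
have LS ij : L ij <= \sum_k L k.
  by rewrite (bigD1 ij)//= lerDl; apply: sumr_ge0 => k _; have [] := LP k.
have S0 : 0 <= \sum_k L k by apply: sumr_ge0 => ij _; have [] := LP ij.
exists (\sum_k L k) => //; split=> [u|y y'].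
  apply: mx_norm_le => // i j; rewrite (le_trans _ (LS (i, j)))//.
  by have [_ [->]] := LP (i, j).
apply: mx_norm_le => [|i j]; first by rewrite mulr_ge0.
rewrite !mxE (le_trans ((LP (i, j)).2.2 y y'))//.
by rewrite ler_wpM2r.
Qed.

End Cutoff.

Section Hadamard.
Context {R : realType}.

(** Integrals $\int_0^1 h(tp)\,dt$ depend smoothly on $p$, as a case of
    the smooth dependence of solutions of differential equations: the state is
    $(tp, p, \int_0^t h(sp)\,ds)$. *)
Lemma smooth_ray_integral m (h : 'rV[R]_m -> 'rV[R]_m) : smooth_mx setT h ->
  exists I : R -> 'rV[R]_m -> 'rV[R]_m,
    [/\ forall p, I 0 p = 0, forall p, velocity (I^~ p) (fun t => h (t *: p)) &
        smooth_mx setT (I 1)].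
Proof.
move=> hs.
have hc (u : 'rV[R]_m) : {for u, continuous h} by exact: smooth_mx_cont hs I.
have tpc (t : R) (p : 'rV[R]_m) : q.1 *: q.2 @[q --> (t, p)] --> t *: p.
  by apply: cvgZ; [exact: cvg_fst|exact: cvg_snd].
have lc (p : 'rV[R]_m) : continuous (fun t : R => h (t *: p)).
  move=> t; apply: (cvg_comp (fun t : R => t *: p) h (G := nbhs (t *: p))); last exact: hc.
  by apply: (@cvgZr_tmp _ _ _ (nbhs t)); exact: cvg_id.
have exI p : exists y : R -> 'rV[R]_m, y 0 = 0 /\ velocity y (fun t => h (t *: p)).
  apply: (@ode_exists R m (fun t _ => h (t *: p)) 0) => [T|y _]; last exact: lc.
  by exists 0 => t _ a b; rewrite subrr normr0 mul0r.
have [J JP] := choice exI; pose I t p := J p t.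
have I0 p : I 0 p = 0 by have [] := JP p.
have IV p : velocity (I^~ p) (fun t => h (t *: p)) by have [] := JP p.
have Ic t p : I q.1 q.2 @[q --> (t, p)] --> I t p.
  apply: (@ode_param_cont R m 'rV[R]_m (fun t p _ => h (t *: p)) I p IV) => [T|s|].
  - exists 0; apply: (@nearW _ (nbhs p)) => p' s _ a b.
    by rewrite subrr normr0 mul0r.
  - apply: (cvg_comp (fun q : R * 'rV[R]_m => q.1 *: q.2) h (G := nbhs (s *: p))).
      exact: tpc.
    exact: hc.
  - have -> : I 0 = fun=> 0 by apply/funext => p'; rewrite I0.
    exact: (@cvg_cst _ _ _ (nbhs p)).
exists I; split => //.
pose b (w : 'rV[R]_(m + m + m)) :=
  row_mx (row_mx (rsubmx (lsubmx w)) (0 : 'rV[R]_m)) (h (lsubmx (lsubmx w))).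
pose Y (t : R) (p : 'rV[R]_m) := row_mx (row_mx (t *: p) p) (I t p).
have ll : smooth_mx setT (fun w : 'rV[R]_(m + m + m) => lsubmx w).
  exact: smooth_lsubmx openT.
have bs : smooth_mx setT b.
  apply: smooth_row_mx; first exact: openT.
    apply: smooth_row_mx; [exact: openT| |exact: smooth_mx_cst openT].
    exact: (smooth_mx_comp openT openT (U' := setT) _ ll (smooth_rsubmx openT)).
  apply: (smooth_mx_comp openT openT (U' := setT) _ _ hs) => //.
  exact: (smooth_mx_comp openT openT (U' := setT) _ ll (smooth_lsubmx openT)).
have YV p : velocity (Y^~ p) (fun t => b (Y t p)).
  have -> : (fun t => b (Y t p)) = fun t => row_mx (row_mx p 0) (h (t *: p)).
    by apply/funext => t; rewrite /b /Y !row_mxKl row_mxKr.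
  apply: velocity_row; last exact: IV.
  apply: velocity_row => t j.
    rewrite (_ : (fun s => _) = fun s => s * p 0 j); first exact: is_derive_mulr.
    by apply/funext => s; rewrite mxE.
  by rewrite mxE; exact: is_derive_cst.
have Yc t p : Y q.1 q.2 @[q --> (t, p)] --> Y t p.
  apply: cvg_row_mx; last exact: Ic.
  by apply: cvg_row_mx; [exact: tpc|exact: cvg_snd].
have Y0s : smooth_mx setT (Y 0).
  apply: smooth_row_mx; first exact: openT.
    apply: smooth_row_mx; [exact: openT| |exact: smooth_mx_id openT].
    apply: (smooth_mx_ext openT _ (smooth_mx_cst 0 openT)) => p _.
    by rewrite scale0r.
  by apply: (smooth_mx_ext openT _ (smooth_mx_cst 0 openT)) => p _; rewrite I0.
have := ode_smooth bs YV Yc Y0s (1 : R) => Y1s i j.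
apply: (smooth_ext openT _ (Y1s i (rshift (m + m) j))) => p _.
by rewrite row_mxEr.
Qed.

(** Integrate the derivative of $f$ along the ray from the origin to [u]. *)
Lemma hadamard m (f : 'rV[R]_m -> R) : Cinfty setT f ->
  exists g : 'rV[R]_m -> 'rV[R]_m,
    [/\ smooth_mx setT g, forall j, g 0 0 j = partial j f 0 &
        forall u, f u = f 0 + \sum_j u 0 j * g u 0 j].
Proof.
move=> fs; pose h u : 'rV[R]_m := \row_j partial j f u.
have hs : smooth_mx setT h.
  move=> i j; apply: (smooth_ext openT _ (smooth_partial j fs)) => u _.
  by rewrite mxE.
have [J [J0 JV Js]] := smooth_ray_integral hs.
exists (J 1); split => // [j|u].
  have D (t : R) : is_derive t 1 (fun s => J s 0 0 j - s * h 0 0 j) 0.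
    rewrite -[X in is_derive _ _ _ X](subrr (h 0 0 j)).
    have D1 := JV 0 t j; have D2 := is_derive_mulr t (h 0 0 j).
    rewrite scaler0 in D1; exact: is_deriveB.
  have := @is_derive0_cst R _ 1 (fun s _ => D s).
  by rewrite J0 mul0r mul1r !mxE subr0 => /eqP; rewrite subr_eq0 => /eqP.
pose G (t : R) := f (t *: u + 0) - \sum_j u 0 j * J t u 0 j.
have D (t : R) : is_derive t 1 G 0.
  have D1 : is_derive t 1 (fun s => f (s *: u + 0)) (\sum_j partial j f (t *: u + 0) * u 0 j).
    by apply: (is_derive_line f 0 u t _).1; exact: smooth_is_derive openT fs I.
  have D2 : is_derive t 1 (fun s => \sum_j u 0 j * J s u 0 j)
      (\sum_j u 0 j * h (t *: u) 0 j).
    rewrite (_ : (fun s => _) = \sum_j (fun s => u 0 j * J s u 0 j)); last first.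
      by apply/funext => s; rewrite fct_sumE.
    apply: is_derive_sum => j; have Dj := JV u t j.
    exact: (@is_deriveZ R R R (fun s => J s u 0 j) (u 0 j)).
  rewrite -[X in is_derive _ _ _ X](subrr (\sum_j u 0 j * h (t *: u) 0 j)).
  apply: (@is_deriveB R R R (fun s => f (s *: u + 0))).
  rewrite (_ : \sum_j u 0 j * _ = \sum_j partial j f (t *: u + 0) * u 0 j)//.
  by apply: eq_bigr => j _; rewrite mxE mulrC addr0.
have := @is_derive0_cst R _ 1 (fun s _ => D s).
rewrite /G scale1r scale0r !addr0 [X in f 0 - X]big1 ?subr0; last first.
  by move=> j _; rewrite J0 mxE mulr0.
by move=> <-; rewrite subrK.
Qed.

End Hadamard.

(** * Brackets of vector fields in coordinates *)

Section Brackets.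
Context {R : realType}.

Definition bracket m (X Y : 'rV[R]_m -> 'rV[R]_m) (u : 'rV[R]_m) : 'rV[R]_m :=
  X u *m jac Y u - Y u *m jac X u.

Lemma is_derive_linear_comp m N (phi : {linear 'rV[R]_m -> 'rV[R]_N}) (f : 'rV[R]_N -> R)
    (w v : 'rV[R]_m) l :
  is_derive (phi w) (phi v) f l -> is_derive w v (fun x => f (phi x)) l.
Proof.
move=> /is_derive_epsP H; apply/is_derive_epsP => e e0.
by apply: filterS (H e e0) => h; rewrite linearP.
Qed.

Lemma is_derive_jac m N (U : set 'rV[R]_m) (g : 'rV[R]_m -> 'rV[R]_N) u v (dg : 'rV[R]_N) :
  open U -> smooth_mx U g -> U u ->
  (forall j, is_derive u v (fun w => g w 0 j) (dg 0 j)) -> v *m jac g u = dg.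
Proof.
move=> oU gs Uu D; apply/rowP => j.
have [_ <-] := jac_is_derive v j oU gs Uu.
by have [_ <-] := D j.
Qed.

Lemma jac_ext m N (U : set 'rV[R]_m) (f g : 'rV[R]_m -> 'rV[R]_N) u :
  open U -> (forall w, U w -> f w = g w) -> U u -> jac f u = jac g u.
Proof.
move=> oU fg Uu; apply/matrixP => i j; rewrite !mxE; apply: near_eq_derive.
near=> w; rewrite fg//; near: w; exact: open_nbhs_nbhs.
Unshelve. all: by end_near. Qed.

Lemma jac_lincomb m N r (U : set 'rV[R]_m) (X : 'rV[R]_m -> 'M[R]_(r, N)) (c : 'rV[R]_r) u :
  open U -> smooth_mx U X -> U u ->
  jac (fun w => c *m X w) u = \sum_i c 0 i *: jac (fun w => row i (X w)) u.
Proof.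
move=> oU Xs Uu; apply/row_matrixP => k; rewrite rowE.
apply: (is_derive_jac oU) => //.
  by apply: smooth_mulmx => //; exact: smooth_mx_cst.
move=> j; rewrite [X in is_derive _ _ _ X](_ : _ =
    \sum_i c 0 i * partial k (fun w => X w i j) u).
  rewrite (_ : (fun w => _) = \sum_i (fun w => c 0 i * X w i j)); last first.
    by apply/funext => w; rewrite fct_sumE mxE.
  apply: is_derive_sum => i.
  have D : is_derive u (delta_mx 0 k) (fun w => X w i j) (partial k (fun w => X w i j) u).
    by apply: derivableP; exact: smooth_derivable (Xs i j) Uu.
  exact: is_deriveZ.
rewrite mxE summxE.
apply: eq_bigr => i _.
rewrite [LHS]mxE [X in _ * X = _]mxE.
rewrite (_ : (fun w => row i (X w) 0 j) = (fun w => X w i j))//.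
by apply/funext => w; rewrite mxE.
Qed.

Lemma bracket_lincomb m r (U : set 'rV[R]_m) (X : 'rV[R]_m -> 'M[R]_(r, m))
    (c c' : 'rV[R]_r) u : open U -> smooth_mx U X -> U u ->
  c *m X u *m jac (fun w => c' *m X w) u - c' *m X u *m jac (fun w => c *m X w) u =
  \sum_i \sum_i' (c 0 i * c' 0 i') *: bracket (fun w => row i (X w)) (fun w => row i' (X w)) u.
Proof.
move=> oU Xs Uu; rewrite !(jac_lincomb _ oU Xs Uu).
rewrite [c *m X u]mulmx_sum_row [c' *m X u]mulmx_sum_row !mulmx_suml.
under eq_bigr do rewrite mulmx_sumr.
under [X in _ - X]eq_bigr do rewrite mulmx_sumr.
rewrite [X in _ - X]exchange_big/= -sumrB; apply: eq_bigr => i _.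
rewrite -sumrB; apply: eq_bigr => i' _.
by rewrite -!scalemxAl -!scalemxAr !scalerA [c' 0 i' * _]mulrC -scalerBr.
Qed.

Lemma commuting_lincomb m r (U : set 'rV[R]_m) (X : 'rV[R]_m -> 'M[R]_(r, m))
    (c c' : 'rV[R]_r) u : open U -> smooth_mx U X -> U u ->
  (forall i i', bracket (fun w => row i (X w)) (fun w => row i' (X w)) u = 0) ->
  c *m X u *m jac (fun w => c' *m X w) u = c' *m X u *m jac (fun w => c *m X w) u.
Proof.
move=> oU Xs Uu XX; apply/subr0_eq; rewrite (bracket_lincomb _ _ oU Xs Uu).
by rewrite big1// => i _; rewrite big1// => i' _; rewrite XX scaler0.
Qed.

Lemma smooth_row m r N (U : set 'rV[R]_m) (X : 'rV[R]_m -> 'M[R]_(r, N)) i :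
  open U -> smooth_mx U X -> smooth_mx U (fun w => row i (X w)).
Proof.
move=> oU Xs i0 j; apply: (smooth_ext (f := fun w => X w i j)) => // w _.
by rewrite mxE.
Qed.

Lemma jac_mulmxr m N N' (U : set 'rV[R]_m) (f : 'rV[R]_m -> 'rV[R]_N) (A : 'M[R]_(N, N')) u :
  open U -> smooth_mx U f -> U u -> jac (fun w => f w *m A) u = jac f u *m A.
Proof.
move=> oU fs Uu; apply/row_matrixP => k; rewrite row_mul !rowE.
have fAs : smooth_mx U (fun w => f w *m A).
  by apply: smooth_mulmx => //; exact: smooth_mx_cst.
apply: (is_derive_jac oU fAs Uu) => j.
have -> : ((delta_mx 0 k : 'rV[R]_m) *m jac f u *m A) 0 j =
    \sum_i A i j * ((delta_mx 0 k : 'rV[R]_m) *m jac f u) 0 i.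
  by rewrite mxE; apply: eq_bigr => i _; rewrite mulrC.
have -> : (fun w => (f w *m A) 0 j) = \sum_i (fun w => A i j * f w 0 i).
  by apply/funext => w; rewrite fct_sumE mxE; apply: eq_bigr => i _; rewrite mulrC.
apply: is_derive_sum => i; have D := jac_is_derive (delta_mx 0 k : 'rV[R]_m) i oU fs Uu.
exact: is_deriveZ.
Qed.

(** The Leibniz rule. Coefficients are frozen in the second term so that it is
    linear in them, which leaves no tensor of third order to be named. *)
Lemma jac_mulmx m r N (U : set 'rV[R]_m) (c : 'rV[R]_m -> 'rV[R]_r)
    (A : 'rV[R]_m -> 'M[R]_(r, N)) u :
  open U -> smooth_mx U c -> smooth_mx U A -> U u ->
  jac (fun w => c w *m A w) u = jac c u *m A u + jac (fun w => c u *m A w) u.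
Proof.
move=> oU cs As Uu; apply/row_matrixP => k; rewrite raddfD/= row_mul !rowE.
apply: (is_derive_jac oU (smooth_mulmx oU cs As) Uu) => j.
rewrite (jac_lincomb _ oU As Uu) mxE [X in is_derive _ _ _ (X + _)]mxE.
rewrite mulmx_sumr summxE -big_split/=.
rewrite (_ : (fun w => _) = \sum_i ((fun w => c w 0 i) * (fun w => A w i j))); last first.
  by apply/funext => w; rewrite fct_sumE mxE.
apply: is_derive_sum => i.
have D1 := jac_is_derive (delta_mx 0 k : 'rV[R]_m) i oU cs Uu.
have D2 := jac_is_derive (delta_mx 0 k : 'rV[R]_m) j oU (smooth_row i oU As) Uu.
rewrite (_ : (fun w => row i (A w) 0 j) = (fun w => A w i j)) in D2; last first.
  by apply/funext => w; rewrite mxE.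
rewrite -scalemxAr [X in _ + X]mxE addrC [X in _ + X]mulrC.
exact: is_deriveM.
Qed.

Lemma jacD m N (U : set 'rV[R]_m) (f g : 'rV[R]_m -> 'rV[R]_N) u :
  open U -> smooth_mx U f -> smooth_mx U g -> U u ->
  jac (fun w => f w + g w) u = jac f u + jac g u.
Proof.
move=> oU fs gs Uu; apply/row_matrixP => k; rewrite raddfD/= !rowE.
apply: (is_derive_jac oU (smooth_mxD oU fs gs) Uu) => j.
rewrite mxE (_ : (fun w => _) = (fun w => f w 0 j) + (fun w => g w 0 j)); last first.
  by apply/funext => w; rewrite mxE.
have D1 := jac_is_derive (delta_mx 0 k : 'rV[R]_m) j oU fs Uu.
have D2 := jac_is_derive (delta_mx 0 k : 'rV[R]_m) j oU gs Uu.
exact: is_deriveD.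
Qed.

Lemma jac_cst m N (c : 'rV[R]_N) (u : 'rV[R]_m) : jac (fun=> c) u = 0.
Proof. by apply/matrixP => i j; rewrite !mxE; exact: derive_cst. Qed.

End Brackets.

Section CurveAlgebra.
Context {R : realType}.

Lemma velocity_lincomb N r (c : 'I_r -> R) (y dy : 'I_r -> R -> 'rV[R]_N) :
  (forall i, velocity (y i) (dy i)) ->
  velocity (fun t => \sum_i c i *: y i t) (fun t => \sum_i c i *: dy i t).
Proof.
move=> yV t j; rewrite summxE (_ : (fun s => _) = \sum_i (fun s => c i * y i s 0 j)).
  rewrite (_ : \sum_i _ = \sum_i c i * dy i t 0 j).
    by apply: is_derive_sum => i; have D := yV i t j; exact: is_deriveZ.
  by apply: eq_bigr => i _; rewrite mxE.
apply/funext => s; rewrite fct_sumE summxE; apply: eq_bigr => i _.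
by rewrite mxE.
Qed.

Lemma velocity_lsubmx N1 N2 (y dy : R -> 'rV[R]_(N1 + N2)) : velocity y dy ->
  velocity (fun t => lsubmx (y t)) (fun t => lsubmx (dy t)).
Proof.
move=> yV t j; rewrite mxE (_ : (fun s => _) = fun s => y s 0 (lshift N2 j)); first exact: yV.
by apply/funext => s; rewrite mxE.
Qed.

Lemma velocity_cst0 N (y : R -> 'rV[R]_N) (t : R) :
  (forall j, forall s : R, `|s| <= `|t| -> is_derive s 1 (fun s => y s 0 j) 0) -> y t = y 0.
Proof.
move=> D; apply/rowP => j.
exact: (@is_derive0_cst R (fun s => y s 0 j) t (D j)).
Qed.

Lemma velocity_comp N N' (g : 'rV[R]_N -> 'rV[R]_N') (y dy : R -> 'rV[R]_N) :
  smooth_mx setT g -> velocity y dy ->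
  velocity (fun t => g (y t)) (fun t => dy t *m jac g (y t)).
Proof.
move=> gs yV t j; rewrite mxE.
have := @chain_rule R _ _ (fun w => g w 0 j) y t 1 (dy t) (yV t).
rewrite (_ : \sum_k dy t 0 k * _ =
  \sum_k partial k (fun w => g w 0 j) (y t) * dy t 0 k); last first.
  by apply: eq_bigr => k _; rewrite mxE mulrC.
apply=> [|k]; last exact: smooth_cont (smooth_partial k (gs 0 j)) I.
by apply: (@nearW _ (nbhs (y t))) => xi k; exact: smooth_derivable (gs 0 j) I.
Qed.

End CurveAlgebra.

(** * Straightening commuting fields *)

Section FlowFamily.
Context {R : realType} {m r : nat}.
Variables (X : 'rV[R]_m -> 'M[R]_(r, m)) (P : 'M[R]_(m, r)) (y0 : 'rV[R]_m -> 'rV[R]_m).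
Hypotheses (Xs : smooth_mx setT X) (y0s : smooth_mx setT y0).
Variable L : R.
Hypothesis (Xlip : forall u u', `|X u' - X u| <= L * `|u' - u|).

Let b (w : 'rV[R]_(m + m)) : 'rV[R]_(m + m) :=
  row_mx (rsubmx w *m P *m X (lsubmx w)) 0.

Let bs : smooth_mx setT b.
Proof.
apply: smooth_row_mx; [exact: openT| |exact: smooth_mx_cst openT].
apply: smooth_mulmx; first exact: openT.
  apply: smooth_mulmx; [exact: openT|exact: smooth_rsubmx openT|].
  exact: smooth_mx_cst openT.
apply: (smooth_mx_comp openT openT (U' := setT) _ _ Xs) => //.
exact: smooth_lsubmx openT.
Qed.

Let jac_b (w v : 'rV[R]_(m + m)) : v *m jac b w =
  row_mx (rsubmx v *m P *m X (lsubmx w) +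
          lsubmx v *m jac (fun y => rsubmx w *m P *m X y) (lsubmx w)) 0.
Proof.
apply: (is_derive_jac openT bs I) => j; case: (split_ordP j) => j1 ->; last first.
  rewrite row_mxEr mxE (_ : (fun w0 => _) = cst 0); first exact: is_derive_cst.
  by apply/funext => w0; rewrite row_mxEr mxE.
rewrite row_mxEl (_ : (fun w0 => _) =
    \sum_i (fun w0 : 'rV[R]_(m + m) => (rsubmx w0 *m P) 0 i) * (fun w0 => X (lsubmx w0) i j1)); last first.
  by apply/funext => w0; rewrite fct_sumE row_mxEl mxE.
rewrite (jac_lincomb _ openT Xs I) mulmx_sumr mxE.
rewrite [(rsubmx v *m P *m X (lsubmx w)) 0 j1]mxE summxE -big_split/=.
apply: is_derive_sum => i.
have D1 : is_derive w v (fun w0 : 'rV[R]_(m + m) => (rsubmx w0 *m P) 0 i) ((rsubmx v *m P) 0 i).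
  apply: (@is_derive_linear_comp R _ _ (mulmxr P \o rsubmx) (fun x => x 0 i)).
  exact: is_derive_coord.
have D2 : is_derive w v (fun w0 : 'rV[R]_(m + m) => X (lsubmx w0) i j1)
    ((lsubmx v *m jac (fun y => row i (X y)) (lsubmx w)) 0 j1).
  apply: (@is_derive_linear_comp R _ _ lsubmx (fun x => X x i j1)).
  have Xis : smooth_mx setT (fun y => row i (X y)).
    move=> i0 j0; apply: (smooth_ext openT _ (Xs i j0)) => u _; by rewrite mxE.
  have := jac_is_derive (lsubmx v) j1 openT Xis (I : setT (lsubmx w)).
  by under eq_fun do rewrite mxE.
rewrite -scalemxAr [X in _ + X]mxE addrC [X in _ + X]mulrC.
exact: is_deriveM.
Qed.

(** The parameter is made a part of the state by the equation $\dot p=0$, so that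
    its derivatives are governed by the variational equation of a field that does
    not depend on parameters. *)
Lemma flow_family : exists Y : R -> 'rV[R]_m -> 'rV[R]_m,
  [/\ Y 0 = y0, forall p, velocity (Y^~ p) (fun t => p *m P *m X (Y t p)),
      forall t p, Y q.1 q.2 @[q --> (t, p)] --> Y t p,
      forall t, smooth_mx setT (Y t) &
      forall v p, velocity (fun t => v *m jac (Y t) p)
        (fun t => v *m P *m X (Y t p) +
           v *m jac (Y t) p *m jac (fun y => p *m P *m X y) (Y t p))].
Proof.
have lip (p a a' : 'rV[R]_m) C : `|p *m P| <= C ->
    `|p *m P *m X a - p *m P *m X a'| <= r%:R * C * L * `|a - a'|.
  move=> pC; rewrite -mulmxBr (le_trans (mulmx_norm_le _ _))// -[leRHS]mulrA.
  by rewrite ler_pM// ?mulr_ge0// ler_wpM2l.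
have Xc (u : 'rV[R]_m) : {for u, continuous X} by exact: smooth_mx_cont Xs I.
have exY p : exists y : R -> 'rV[R]_m, y 0 = y0 p /\ velocity y (fun t => p *m P *m X (y t)).
  apply: (@ode_exists R m (fun _ y => p *m P *m X y) (y0 p)) => [T|y yc t].
    by exists (r%:R * `|p *m P| * L) => t _ a a'; exact: lip.
  apply: (@cvg_mulmx R _ (nbhs t)); first exact: (@cvg_cst _ _ _ (nbhs t)).
  by apply: (cvg_comp y X (G := nbhs (y t))); [exact: yc|exact: Xc].
have [J JP] := choice exY; pose Y t p := J p t.
have Y0 : Y 0 = y0 by apply/funext => p; have [] := JP p.
have YV p : velocity (Y^~ p) (fun t => p *m P *m X (Y t p)) by have [] := JP p.
have Yc (t : R) (p : 'rV[R]_m) : Y q.1 q.2 @[q --> (t, p)] --> Y t p.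
  have pPc : {for p, continuous (fun p' : 'rV[R]_m => p' *m P)}.
    apply: (@cvg_mulmx R _ (nbhs p)); first exact: cvg_id.
    exact: (@cvg_cst _ _ _ (nbhs p)).
  apply: (@ode_param_cont R m 'rV[R]_m (fun t p y => p *m P *m X y) Y p YV) => [T|s|].
  - exists (r%:R * (`|p *m P| + 1) * L).
    have /(@cvgrPdist_le _ _ _ (nbhs p) _)/(_ 1 ltr01) := pPc.
    apply: filterS => p' p'p s _ a a'; apply: lip.
    rewrite -(subrK (p *m P) (p' *m P)) (le_trans (ler_normD _ _))// addrC lerD2l.
    by rewrite distrC.
  - apply: cvg_mulmx.
      apply: (cvg_comp snd (fun p' : 'rV[R]_m => p' *m P) (G := nbhs p)); last exact: pPc.
      exact: cvg_snd.
    apply: (cvg_comp fst (fun s => X (Y s p)) (G := nbhs s)); first exact: cvg_fst.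
    apply: (cvg_comp (Y^~ p) X (G := nbhs (Y s p))); last exact: Xc.
    exact: velocity_cont (YV p) s.
  - by rewrite Y0; exact: smooth_mx_cont y0s I.
pose S (t : R) p := row_mx (Y t p) p.
have SV p : velocity (S^~ p) (fun t => b (S t p)).
  rewrite (_ : (fun t => b (S t p)) = fun t => row_mx (p *m P *m X (Y t p)) 0); last first.
    by apply/funext => t; rewrite /b /S row_mxKl row_mxKr.
  apply: velocity_row; first exact: YV.
  by move=> t j; rewrite mxE; exact: is_derive_cst.
have Sc (t : R) (p : 'rV[R]_m) : S q.1 q.2 @[q --> (t, p)] --> S t p.
  by apply: cvg_row_mx; [exact: Yc|exact: cvg_snd].
have S0s : smooth_mx setT (S 0).
  by apply: smooth_row_mx; [exact: openT|rewrite Y0|exact: smooth_mx_id openT].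
have Ys t : smooth_mx setT (Y t).
  move=> i j; apply: (smooth_ext openT _ (ode_smooth bs SV Sc S0s t i (lshift m j))) => p _.
  by rewrite row_mxEl.
exists Y; split => // v p.
have [Z ZP] := choice (fun i => variational i bs SV Sc S0s).
have Zl i t : lsubmx (Z i t p) = row i (jac (Y t) p).
  have [D _ _ _] := ZP i; rewrite rowE; apply/esym/(is_derive_jac openT (Ys t) I) => j.
  by have := D t p (lshift m j); under eq_fun do rewrite row_mxEl; rewrite mxE.
have Zr i t : rsubmx (Z i t p) = delta_mx 0 i.
  have [D _ _ _] := ZP i; apply/rowP => j; rewrite mxE.
  have [_ <-] := D t p (rshift m j); under eq_fun do rewrite row_mxEr.
  by have [_ ->] := is_derive_coord p (delta_mx 0 i) j.
have ZV i : velocity (fun t => row i (jac (Y t) p)) (fun t => row i P *m X (Y t p) +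
    row i (jac (Y t) p) *m jac (fun y => p *m P *m X y) (Y t p)).
  have [_ /(_ p) V _ _] := ZP i.
  have := velocity_lsubmx V.
  under eq_fun do rewrite Zl.
  under [X in velocity _ X -> _]eq_fun do rewrite jac_b row_mxKl Zl Zr row_mxKl row_mxKr -rowE.
  exact.
have := velocity_lincomb (v 0) ZV.
under eq_fun do rewrite -mulmx_sum_row.
suff -> : (fun t => \sum_i v 0 i *: (row i P *m X (Y t p) +
    row i (jac (Y t) p) *m jac (fun y => p *m P *m X y) (Y t p))) =
  (fun t => v *m P *m X (Y t p) +
           v *m jac (Y t) p *m jac (fun y => p *m P *m X y) (Y t p)) by [].
apply/funext => t; rewrite [v *m P]mulmx_sum_row [v *m jac _ _]mulmx_sum_row !mulmx_suml -big_split/=.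
by apply: eq_bigr => i _; rewrite scalerDr !scalemxAl.
Qed.

End FlowFamily.

Section Straightening.
Context {R : realType}.

(** Given the right inverse [P] of the matrix [a0] of the fields at [u0], the parameter
    [p] is split as $p = p(1 - Pa_0) + pPa_0$: the first part displaces the
    starting point and the second one is integrated, along the combination of
    the fields with coefficients $pP$, up to time one. The derivative at the
    origin is then the identity, and commutation shows that derivatives of the
    end point along the rows of [a0] are the fields themselves: their defect
    satisfies a homogeneous linear differential equation. *)
Theorem straighten m r (B : set 'rV[R]_m) (X : 'rV[R]_m -> 'M[R]_(r, m)) u0
    (P : 'M[R]_(m, r)) :
  open B -> B u0 -> smooth_mx B X -> X u0 *m P = 1%:M ->
  (forall u, B u -> forall i i',
     bracket (fun w => row i (X w)) (fun w => row i' (X w)) u = 0) ->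
  exists (D D' : set 'rV[R]_m) (Psi Phi : 'rV[R]_m -> 'rV[R]_m),
    [/\ local_diffeo D D' Psi Phi, D 0 /\ Psi 0 = u0, D' `<=` B &
        forall p, D p -> X u0 *m jac Psi p = X (Psi p)].
Proof.
move=> oB Bu0 Xs aP XX; set a0 := X u0 in aP *.
have [rho [chi [rho0 rhoB chis [chi1 chi0] chif]]] := cutoff_exists oB Bu0.
pose X' (u : 'rV[R]_m) : 'M[R]_(r, m) := chi u *: X u.
have X's : smooth_mx setT X'.
  move=> i j; apply: (smooth_ext openT _ (chif _ (Xs i j))) => u _; by rewrite mxE.
have X'0 u : 2 * rho < `|u - u0| -> X' u = 0.
  by move=> /ltW/chi0; rewrite /X' => ->; rewrite scale0r.
have X'E u : `|u - u0| <= rho -> X' u = X u.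
  by move=> /chi1; rewrite /X' => ->; rewrite scale1r.
have [L _ [_ Xlip]] := lipschitz_mx_of_support X's X'0.
pose y0 (p : 'rV[R]_m) := u0 + p *m (1%:M - P *m a0).
have y0s : smooth_mx setT y0.
  apply: smooth_mxD; [exact: openT|exact: smooth_mx_cst openT|].
  apply: smooth_mulmx; [exact: openT|exact: smooth_mx_id openT|].
  exact: smooth_mx_cst openT.
have jy0 (v p : 'rV[R]_m) : v *m jac y0 p = v *m (1%:M - P *m a0).
  apply: (is_derive_jac openT y0s I) => j.
  rewrite (_ : (fun w => y0 w 0 j) = fun w => u0 0 j + (w *m (1%:M - P *m a0)) 0 j); last first.
    by apply/funext => w; rewrite mxE.
  rewrite -[X in is_derive _ _ _ X]add0r; apply: is_deriveD.
  apply: (@is_derive_linear_comp R _ _ (mulmxr (1%:M - P *m a0)) (fun x => x 0 j)).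
  exact: is_derive_coord.
have [Y [Y0 YV Yc Ys JV]] := flow_family P X's y0s Xlip.
have u0E : X' u0 = a0 by apply: X'E; rewrite subrr normr0 ltW.
have Y00 t : Y t 0 = u0.
  rewrite (_ : u0 = Y 0 0); last by rewrite Y0 /y0 mul0mx addr0.
  apply: (@velocity_cst0 R _ (Y^~ 0)) => j s _.
  by have := YV 0 s j; rewrite !mul0mx mxE.
have near_good : \forall p \near (0 : 'rV[R]_m), forall t, `|t| <= 1 -> `|Y t p - u0| < rho.
  have rho2 : 0 < rho / 2 by rewrite divr_gt0.
  have := tube_near (fun t => Yc t 0) 1 rho2.
  apply: filterS => p H t t1; apply: le_lt_trans (_ : rho / 2 < rho); last by lra.
  by have := H t t1; rewrite Y00.
have [d d0 dP] : exists2 d, 0 < d & forall p, `|p - 0| < d ->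
    forall t, `|t| <= 1 -> `|Y t p - u0| < rho.
  have /nbhs_ballP[d /= d0 dP] := near_good.
  by exists d => // p pd; apply: dP; rewrite -ball_normE/= distrC.
pose G := [set p : 'rV[R]_m | `|p - 0| < d].
have oG : open G by exact: open_dist_lt.
have G0 : G 0 by rewrite /G/= subrr normr0.
have oball : open [set u : 'rV[R]_m | `|u - u0| < rho] by exact: open_dist_lt.
have sub_B u : `|u - u0| < rho -> B u.
  by move=> ur; apply: rhoB; apply: lt_trans ur _; lra.
have key (v p : 'rV[R]_m) : G p -> v *m (1%:M - P *m a0) = 0 ->
    v *m jac (Y 1) p = v *m P *m X (Y 1 p).
  move=> Gp v0.
  pose J (c : 'rV[R]_r) (t : R) := jac (fun y : 'rV[R]_m => c *m X' y) (Y t p).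
  (* The defect at time t, where the fields have been followed for the time t. *)
  pose E (t : R) := v *m jac (Y t) p - t *: (v *m P *m X' (Y t p)).
  pose dE (t : R) := (v *m P *m X' (Y t p) + v *m jac (Y t) p *m J (p *m P) t) -
     (v *m P *m X' (Y t p) + t *: (p *m P *m X' (Y t p) *m J (v *m P) t)).
  have cXs (c : 'rV[R]_r) : smooth_mx setT (fun y => c *m X' y).
    by apply: smooth_mulmx; [exact: openT|exact: smooth_mx_cst openT|].
  have EV : velocity E dE.
    apply: velocity_sub; first exact: JV.
    have V := velocity_comp (cXs (v *m P)) (YV p) => t j.
    rewrite (_ : (fun s => _) = (fun s : R => s * 1) * (fun s => (v *m P *m X' (Y s p)) 0 j)); last first.
      by apply/funext => s; rewrite mxE; congr (_ * _); rewrite mulr1.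
    have D1 := is_derive_mulr t 1; have D2 := V t j.
    rewrite [X in is_derive _ _ _ X](_ : _ =
      (t * 1) *: (p *m P *m X' (Y t p) *m J (v *m P) t) 0 j +
      (v *m P *m X' (Y t p)) 0 j *: (1 : R)); last first.
      by rewrite [LHS]mxE [X in _ + X]mxE addrC /GRing.scale/= !mulr1.
    exact: (@is_deriveM R R (fun s : R => s * 1)).
  have JE (c : 'rV[R]_r) t : `|t| <= 1 -> J c t = jac (fun y => c *m X y) (Y t p).
    move=> t1; apply: (jac_ext oball) => [w /= /ltW/X'E ->//|].
    exact: dP.
  have JC (c : 'rV[R]_r) : exists2 M, 0 <= M & forall t, `|t| <= 1 -> `|J c t| <= M.
    have [|M MP] := @segment_bounded R (fun t => `|J c t|) 1.
      move=> t; apply: (@cvg_norm _ _ _ (nbhs t)).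
      apply: (cvg_comp (Y^~ p) (jac (fun y => c *m X' y)) (G := nbhs (Y t p))).
        exact: velocity_cont (YV p) t.
      exact: smooth_mx_cont (smooth_jac openT (cXs c)) I.
    exists M => [|t t1]; last by have := MP t t1; rewrite normr_id.
    by have := MP 0; rewrite normr0 normr_id => /(_ ler01); exact: le_trans.
  have [M M0 MP] := JC (p *m P).
  have E1 : E 1 = 0.
    apply: (velocity_zero EV (L := m%:R * M)) => [|s|]; first by rewrite mulr_ge0.
      rewrite normr1 => s1.
      have -> : dE s = E s *m J (p *m P) s.
        have Bs := dP p Gp s s1; rewrite /dE /E !JE// (X'E _ (ltW Bs)).
        rewrite opprD addrACA subrr add0r mulmxBl -scalemxAl; congr (_ - _ *: _).
        apply: (commuting_lincomb _ _ oB Xs); first exact: sub_B.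
        by apply: XX; exact: sub_B.
      by rewrite (le_trans (mulmx_norm_le _ _))// mulrAC ler_wpM2r// ler_wpM2l// MP.
    by rewrite /E Y0 jy0 v0 scale0r subrr.
  have B1 : `|Y 1 p - u0| < rho by apply: dP; rewrite ?normr1.
  by move: E1; rewrite /E scale1r (X'E _ (ltW B1)) => /subr0_eq.
have J1 : jac (Y 1) 0 = 1%:M.
  apply/row_matrixP => i; rewrite !rowE mulmx1; set v := delta_mx 0 i.
  have j0 : jac (fun y : 'rV[R]_m => (0 : 'rV[R]_m) *m P *m X' y) u0 = 0.
    apply/row_matrixP => k; rewrite row0 rowE.
    have zs : smooth_mx setT (fun y : 'rV[R]_m => (0 : 'rV[R]_m) *m P *m X' y).
      by apply: smooth_mulmx => //; [exact: openT|exact: smooth_mx_cst openT].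
    apply: (is_derive_jac openT zs I) => j.
    rewrite (_ : (fun w => _) = cst 0); first by rewrite mxE; exact: is_derive_cst.
    by apply/funext => w; rewrite !mul0mx mxE.
  pose W (t : R) := v *m jac (Y t) 0 - t *: (v *m P *m a0).
  have WV j (s : R) : is_derive s 1 (fun s => W s 0 j) 0.
    have D1 := JV v 0 s j; rewrite Y00 u0E j0 mulmx0 addr0 in D1.
    have D2 := is_derive_mulr s ((v *m P *m a0) 0 j).
    rewrite -[X in is_derive _ _ _ X](subrr ((v *m P *m a0) 0 j)).
    rewrite (_ : (fun s => _) = (fun t => (v *m jac (Y t) 0) 0 j) -
      (fun t => t * (v *m P *m a0) 0 j)); last first.
      by apply/funext => t; rewrite /W [LHS]mxE [X in _ + X = _]mxE [X in _ - X = _]mxE.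
    exact: is_deriveB.
  have := @velocity_cst0 R _ W 1 (fun j s _ => WV j s).
  rewrite /W Y0 jy0 scale1r scale0r subr0 => /eqP; rewrite subr_eq => /eqP ->.
  by rewrite mulmxBr mulmx1 mulmxA subrK.
have Ju : jac (Y 1) 0 \in unitmx by rewrite J1 unitmx1.
have [D [D' [Phi [DD D0 DG]]]] :=
  inverse_function oG (smooth_mx_sub (@subsetT _ _) (Ys 1)) G0 Ju.
exists D, D', (Y 1), Phi; split => //.
- move=> u D'u; have [_ _ D'P _ _] := DD; have [Du Pu] := D'P u D'u.
  by rewrite -Pu; apply: sub_B; apply: dP; [exact: DG|rewrite normr1].
- move=> p /DG Gp.
  apply/row_matrixP => i; rewrite row_mul key//.
    by rewrite -row_mul aP row1 -rowE.
  by rewrite mulmxBr mulmx1 mulmxA -row_mul aP row1 -rowE subrr.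
Qed.

End Straightening.

(** * Linear algebra *)

Section LinearAlgebra.
Context {F : fieldType}.

(** The Gaussian elimination of [A] is $A = L\,(1\;0)\,U$ with an invertible [L],
    which is absorbed on the right as a block of a larger invertible matrix. *)
Lemma row_free_complete r m (A : 'M[F]_(r, m)) : row_free A ->
  exists2 N : 'M[F]_m, N \in unitmx & A = pid_mx r *m N.
Proof.
move=> Af; have rm : (r <= m)%N by rewrite -(eqP Af) rank_leq_col.
pose L := col_ebase A; have Lu : L \in unitmx by exact: col_ebase_unit.
pose ext (M : 'M[F]_r) : 'M[F]_m := pid_mx r *m M *m pid_mx r + copid_mx r.
have pp : (pid_mx r : 'M[F]_(r, m)) *m (pid_mx r : 'M[F]_(m, r)) = 1%:M.
  by rewrite mul_pid_mx minnn (minn_idPr rm) pid_mx_1.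
have cp : copid_mx r *m (pid_mx r : 'M[F]_(m, r)) = 0.
  by rewrite mul_copid_mx_pid.
have pc : (pid_mx r : 'M[F]_(r, m)) *m copid_mx r = 0.
  by rewrite mul_pid_mx_copid.
have cc : copid_mx r *m copid_mx r = copid_mx r :> 'M[F]_m by rewrite copid_mx_id.
have extM M M' : ext M *m ext M' = ext (M *m M').
  rewrite /ext mulmxDl [LHS](congr2 +%R (mulmxDr _ _ _) (mulmxDr _ _ _)) cc.
  rewrite -(mulmxA (pid_mx r *m M) (pid_mx r) (copid_mx r)) pc mulmx0 addr0.
  rewrite !(mulmxA (copid_mx r)) cp !mul0mx add0r; congr (_ + _).
  by rewrite -!mulmxA (mulmxA (pid_mx r) (pid_mx r)) pp mul1mx.
have extu : ext L \in unitmx.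
  have : ext L *m ext (invmx L) = 1%:M.
    rewrite extM mulmxV// /ext mulmx1 mul_pid_mx /copid_mx minnn.
    by rewrite minnn addrC subrK.
  by move/mulmx1_unit => [].
exists (ext L *m row_ebase A); first by rewrite unitmx_mul extu row_ebase_unit.
rewrite -[LHS]mulmx_ebase (eqP Af) mulmxA; congr (_ *m _).
by rewrite /ext mulmxDr pc addr0 !mulmxA pp mul1mx.
Qed.

Lemma row_free_transport r m (A B : 'M[F]_(r, m)) : row_free A -> row_free B ->
  exists2 N : 'M[F]_m, N \in unitmx & A *m N = B.
Proof.
move=> /row_free_complete[N Nu ->] /row_free_complete[N' Nu' ->].
exists (invmx N *m N'); first by rewrite unitmx_mul unitmx_inv Nu.
by rewrite mulmxA mulmxK.
Qed.

(** The product with the transpose of [sel s] extracts the block of coordinates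
    with indices [s i]; the product with [sel s] puts it back in place. *)
Definition sel r m (s : 'I_r -> 'I_m) : 'M[F]_(r, m) := \matrix_(i, j) (j == s i)%:R.

Lemma mul_sel_tr r r' m (s : 'I_r -> 'I_m) (s' : 'I_r' -> 'I_m) :
  sel s *m (sel s')^T = \matrix_(i, j) (s i == s' j)%:R.
Proof.
apply/matrixP => i j; rewrite !mxE (bigD1 (s i))//= big1 => [|k ki]; last first.
  by rewrite !mxE (negbTE ki) mul0r.
by rewrite !mxE eqxx mul1r addr0.
Qed.

Lemma sel_orthonormal r m (s : 'I_r -> 'I_m) : injective s -> sel s *m (sel s)^T = 1%:M.
Proof.
by move=> si; rewrite mul_sel_tr; apply/matrixP => i j; rewrite !mxE (inj_eq si).
Qed.

Lemma sel_orthogonal r r' m (s : 'I_r -> 'I_m) (s' : 'I_r' -> 'I_m) :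
  (forall i j, s i != s' j) -> sel s *m (sel s')^T = 0.
Proof.
by move=> ss'; rewrite mul_sel_tr; apply/matrixP => i j; rewrite !mxE (negbTE (ss' i j)).
Qed.

Lemma sel_comp r r' m (s : 'I_r -> 'I_m) (s' : 'I_r' -> 'I_r) :
  sel (s \o s') = sel s' *m sel s.
Proof.
apply/matrixP => i j; rewrite !mxE (bigD1 (s' i))//= big1 => [|k ki]; last first.
  by rewrite !mxE (negbTE ki) mul0r.
by rewrite !mxE eqxx mul1r addr0.
Qed.

Lemma sel_free r m (s : 'I_r -> 'I_m) : injective s -> row_free (sel s).
Proof. by move=> /sel_orthonormal E; apply/row_freeP; exists (sel s)^T. Qed.

Definition joint r r' m (s : 'I_r -> 'I_m) (s' : 'I_r' -> 'I_m) (i : 'I_(r + r')) : 'I_m :=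
  match fintype.split i with inl i1 => s i1 | inr i1 => s' i1 end.

Lemma joint_inj r r' m (s : 'I_r -> 'I_m) (s' : 'I_r' -> 'I_m) :
  injective s -> injective s' -> (forall i j, s i != s' j) -> injective (joint s s').
Proof.
move=> si s'i ss' i j; rewrite /joint => E; apply: (can_inj (@splitK _ _)); move: E.
case: (fintype.split i) => i1; case: (fintype.split j) => j1.
- by move=> /si ->.
- by move=> E; have := ss' i1 j1; rewrite E eqxx.
- by move=> E; have := ss' j1 i1; rewrite E eqxx.
- by move=> /s'i ->.
Qed.

Lemma sel_joint r r' m (s : 'I_r -> 'I_m) (s' : 'I_r' -> 'I_m) :
  sel (joint s s') = col_mx (sel s) (sel s').
Proof.
by apply/matrixP => i j; rewrite !mxE /joint; case: (fintype.split i) => i1; rewrite !mxE.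
Qed.

Lemma row_free_usubmx r r' m (A : 'M[F]_(r, m)) (B : 'M[F]_(r', m)) :
  row_free (col_mx A B) -> row_free A.
Proof.
move=> /row_freeP[P AP]; apply/row_freeP; exists (lsubmx P).
have := congr1 (fun M => lsubmx (usubmx M)) AP.
rewrite -[X in _ *m X]hsubmxK mul_col_row scalar_mx_block.
by rewrite !block_mxEv !col_mxKu !row_mxKl.
Qed.

End LinearAlgebra.

(** * The theorem of Frobenius *)

Section RelativeFrobenius.
Context {R : realType}.

(** Derivatives of the coefficients only contribute members of the span. *)
Lemma bracket_span m r (U : set 'rV[R]_m) (A : 'rV[R]_m -> 'M[R]_(r, m))
    (c c' : 'rV[R]_m -> 'rV[R]_r) u :
  open U -> smooth_mx U A -> smooth_mx U c -> smooth_mx U c' -> U u ->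
  (forall i i', (bracket (fun w => row i (A w)) (fun w => row i' (A w)) u <= A u)%MS) ->
  (bracket (fun w => c w *m A w) (fun w => c' w *m A w) u <= A u)%MS.
Proof.
move=> oU As cs c's Uu AA; rewrite /bracket.
rewrite (jac_mulmx oU c's As Uu) (jac_mulmx oU cs As Uu) !mulmxDr opprD addrACA.
rewrite addmx_sub//.
  by rewrite addmx_sub ?eqmx_opp// !mulmxA submxMl.
rewrite (bracket_lincomb _ _ oU As Uu).
by apply: summx_sub => i _; apply: summx_sub => i' _; by apply: scalemx_sub; exact: AA.
Qed.

Lemma bracket_span_outer m r q (U : set 'rV[R]_m) (f : 'rV[R]_m -> 'rV[R]_m)
    (A : 'rV[R]_m -> 'M[R]_(r, m)) (c : 'rV[R]_m -> 'rV[R]_r) (S : 'M[R]_(q, m)) u :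
  open U -> smooth_mx U f -> smooth_mx U A -> smooth_mx U c -> U u ->
  (A u <= S)%MS -> (forall i, (bracket f (fun w => row i (A w)) u <= S)%MS) ->
  (bracket f (fun w => c w *m A w) u <= S)%MS.
Proof.
move=> oU fs As cs Uu AS fAS; rewrite /bracket (jac_mulmx oU cs As Uu) mulmxDr -addrA.
rewrite addmx_sub//; first by rewrite mulmxA mulmx_sub.
rewrite (jac_lincomb _ oU As Uu) [c u *m A u]mulmx_sum_row mulmx_sumr mulmx_suml -sumrB.
apply: summx_sub => i _; rewrite -scalemxAr -scalemxAl -scalerBr.
by apply: scalemx_sub; exact: fAS.
Qed.

Lemma bracket_const m N (U : set 'rV[R]_m) (X Y : 'rV[R]_m -> 'rV[R]_m) (P : 'M[R]_(m, N)) u :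
  open U -> smooth_mx U X -> smooth_mx U Y -> U u ->
  (forall w, U w -> X w *m P = X u *m P) -> (forall w, U w -> Y w *m P = Y u *m P) ->
  bracket X Y u *m P = 0.
Proof.
move=> oU Xs Ys Uu XP YP; rewrite /bracket mulmxBl -!mulmxA.
rewrite -(jac_mulmxr P oU Ys Uu) -(jac_mulmxr P oU Xs Uu).
rewrite (jac_ext oU YP Uu) (jac_ext oU XP Uu) !jac_cst !mulmx0.
by rewrite subr0.
Qed.

(** The theorem of Frobenius, with at most one field [f] that is straightened
    along with the frame, modulo its span. An involutive frame, normalised so that a constant matrix [P] inverts it,
    commutes: brackets of its members lie in its span and are annihilated by
    [P], which is injective there. The same holds for a field [f] preserving the span of
    the frame, once its component along the frame is removed. *)
Theorem frobenius m r k (B : set 'rV[R]_m) (A : 'rV[R]_m -> 'M[R]_(r, m))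
    (f : 'rV[R]_m -> 'M[R]_(k, m)) u0 :
  (k <= 1)%N -> open B -> B u0 -> smooth_mx B A -> smooth_mx B f ->
  row_free (col_mx (A u0) (f u0)) ->
  (forall u, B u -> forall i i',
    (bracket (fun w => row i (A w)) (fun w => row i' (A w)) u <= A u)%MS) ->
  (forall u, B u -> forall j i,
    (bracket (fun w => row j (f w)) (fun w => row i (A w)) u <= A u)%MS) ->
  exists (a0 : 'M[R]_(r, m)) (f0 : 'M[R]_(k, m)) (D D' : set 'rV[R]_m)
      (Psi Phi : 'rV[R]_m -> 'rV[R]_m),
    [/\ row_free (col_mx a0 f0), local_diffeo D D' Psi Phi /\ D' `<=` B, D 0 /\ Psi 0 = u0 &
      forall p, D p -> (a0 *m jac Psi p :=: A (Psi p))%MS /\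
                        (f (Psi p) - f0 *m jac Psi p <= A (Psi p))%MS].
Proof.
move=> k1 oB Bu0 As fs Af AA fA.
have /row_freeP[P AP] := row_free_usubmx Af.
have APs : smooth_mx B (fun u => A u *m P) by apply: smooth_mulmx => //; exact: smooth_mx_cst.
have [|B' [oB' B'u0 B'B B'P]] := unit_near oB Bu0 APs; first by rewrite AP unitmx1.
have As' := smooth_mx_sub B'B As; have fs' := smooth_mx_sub B'B fs.
pose g u := invmx (A u *m P).
have gs : smooth_mx B' g.
  by apply: smooth_invmx => //; apply: smooth_mulmx => //; exact: smooth_mx_cst.
pose X u := g u *m A u.
have Xs : smooth_mx B' X by exact: smooth_mulmx.
have XP u : B' u -> X u *m P = 1%:M by move=> /B'P H; rewrite /X -mulmxA mulVmx.
have gu u : B' u -> g u \in unitmx by move=> /B'P; rewrite unitmx_inv.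
have XA u : B' u -> (X u :=: A u)%MS.
  by move=> /gu H; apply: eqmxMfull; rewrite row_full_unit.
pose F u := f u - f u *m P *m X u.
have fPs : smooth_mx B' (fun u => f u *m P) by apply: smooth_mulmx => //; exact: smooth_mx_cst.
have Fs : smooth_mx B' F by apply: smooth_mxB => //; exact: smooth_mulmx.
have FP u : B' u -> F u *m P = 0.
  by move=> B'u; rewrite /F mulmxBl -[X in _ - X]mulmxA XP// mulmx1 subrr.
have kill u (v : 'rV[R]_m) : B' u -> (v <= A u)%MS -> v *m P = 0 -> v = 0.
  move=> B'u; rewrite -(XA u B'u) => /submxP[c ->].
  by rewrite -mulmxA XP// mulmx1 => ->; rewrite mul0mx.
have XX u i i' : B' u -> bracket (fun w => row i (X w)) (fun w => row i' (X w)) u = 0.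
  move=> B'u; have Xrs j := smooth_row j oB' Xs; have grs j := smooth_row j oB' gs.
  apply: (kill u _ B'u).
    rewrite /X; have := bracket_span oB' As' (grs i) (grs i') B'u (AA u (B'B u B'u)).
    by under eq_fun do rewrite -row_mul; under [X in bracket _ X _]eq_fun do rewrite -row_mul.
  by apply: (bracket_const oB' (Xrs i) (Xrs i') B'u) => w B'w; rewrite -!row_mul !XP.
have FX u j i : B' u -> bracket (fun w => row j (F w)) (fun w => row i (X w)) u = 0.
  move=> B'u; have Xrs := smooth_row i oB' Xs; have grs := smooth_row i oB' gs.
  have frs := smooth_row j oB' fs'; have Frs := smooth_row j oB' Fs.
  have fPrs := smooth_row j oB' fPs.
  have H1 : (bracket (fun w => row j (f w)) (fun w => row i (X w)) u <= A u)%MS.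
    have := bracket_span_outer oB' frs As' grs B'u (submx_refl _) (fA u (B'B u B'u) j).
    by under [X in bracket _ X _]eq_fun do rewrite -row_mul.
  pose h w := row j (f w *m P *m g w).
  have hs : smooth_mx B' h by apply: smooth_row => //; exact: smooth_mulmx.
  have H2 : (bracket (fun w => h w *m A w) (fun w => row i (X w)) u <= A u)%MS.
    have := bracket_span oB' As' hs grs B'u (AA u (B'B u B'u)).
    by under [X in bracket _ X _]eq_fun do rewrite -row_mul.
  have FE w : row j (f w) = row j (F w) + h w *m A w.
    by rewrite /F /h /X -row_mul mulmxA raddfB/= subrK.
  have hAs : smooth_mx B' (fun w => h w *m A w) by exact: smooth_mulmx.
  apply: (kill u _ B'u).
    rewrite (_ : bracket _ _ _ = bracket (fun w => row j (f w)) (fun w => row i (X w)) u -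
        bracket (fun w => h w *m A w) (fun w => row i (X w)) u).
      by rewrite addmx_sub// eqmx_opp.
    rewrite /bracket [in RHS]FE (jac_ext openT (fun w _ => FE w) I) (jacD oB' Frs hAs B'u).
    by rewrite mulmxDl mulmxDr opprD addrACA addrK.
  apply: (bracket_const oB' Frs Xrs B'u) => w B'w; rewrite -!row_mul.
    by rewrite !FP.
  by rewrite !XP.
have bracketN (Y Z : 'rV[R]_m -> 'rV[R]_m) u : bracket Y Z u = - bracket Z Y u.
  by rewrite /bracket opprB.
pose S u := col_mx (X u) (F u).
have Ss : smooth_mx B' S.
  move=> i j; case: (split_ordP i) => i1 ->.
    by apply: (smooth_ext oB' _ (Xs i1 j)) => u _; rewrite col_mxEu.
  by apply: (smooth_ext oB' _ (Fs i1 j)) => u _; rewrite col_mxEd.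
have rowX i : (fun w => row (lshift k i) (S w)) = (fun w => row i (X w)).
  by apply/funext => w; rewrite rowKu.
have rowF i : (fun w => row (rshift r i) (S w)) = (fun w => row i (F w)).
  by apply/funext => w; rewrite rowKd.
have SS u : B' u -> forall i i', bracket (fun w => row i (S w)) (fun w => row i' (S w)) u = 0.
  move=> B'u i i'; case: (split_ordP i) => i1 ->; case: (split_ordP i') => i2 ->;
    rewrite ?rowX ?rowF.
  - exact: XX.
  - by rewrite bracketN FX// oppr0.
  - exact: FX.
  have -> : i1 = i2 by apply: val_inj; case: i1 i2 => [a ak] [c ck]/=; lia.
  by rewrite /bracket subrr.
have Sfree : row_free (S u0).
  have X0 : X u0 = A u0 by rewrite /X /g AP invmx1 mul1mx.
  pose T : 'M[R]_(r + k) := block_mx 1%:M 0 (- (f u0 *m P)) 1%:M.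
  have -> : S u0 = T *m col_mx (A u0) (f u0).
    rewrite mul_block_col !mul1mx mul0mx addr0 /S /F X0; congr col_mx.
    by rewrite mulNmx addrC.
  have Tu : row_full T by rewrite row_full_unit unitmxE det_lblock !det1 mulr1 unitr1.
  by rewrite /row_free (eqmxMfull _ Tu).
have /row_freeP[Q SQ] := Sfree.
have [D [D' [Psi [Phi [DD D0 D'B DP]]]]] := straighten oB' B'u0 Ss SQ SS.
exists (X u0), (F u0), D, D', Psi, Phi; split => //.
- by split => // u /D'B/B'B.
- move=> p Dp; have [_ /(_ p Dp)[D'p _] _ _ _] := DD.
  have B'p : B' (Psi p) by exact: D'B.
  have := DP p Dp; rewrite mul_col_mx => /eq_col_mx[-> ->].
  split; first exact: XA.
  by rewrite /F opprB addrC subrK -(XA _ B'p) submxMl.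
Qed.

End RelativeFrobenius.

(** * Charts and bump functions on a manifold *)

Section Charts.
Context {R : realType} {m : nat} (M : smooth_manifold R m).
Implicit Types (c d : chart R m M) (U : set M) (z w : M).

Lemma open_within (S T : topologicalType) (A : set S) (f : S -> T) (B : set T) :
  open A -> open B -> {within A, continuous f} -> open (A `&` f @^-1` B).
Proof.
move=> oA oB fc; rewrite openE => x [Ax Bfx]; rewrite /interior.
move: fc; rewrite continuous_open_subspace// => /(_ x); rewrite inE => /(_ Ax) C.
have Bn : nbhs (f x) B by exact: open_nbhs_nbhs.
near=> y; split.
  by near: y; exact: open_nbhs_nbhs.
by near: y; exact: (C _ Bn).
Unshelve. all: by end_near. Qed.

Lemma cinvK c u : (cmap c @` cdom c) u -> cdom c (cinv c u) /\ cmap c (cinv c u) = u.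
Proof. by move=> [w cw <-]; rewrite cmapK. Qed.

Lemma open_chart_image c U : open U -> open (cmap c @` (cdom c `&` U)).
Proof.
move=> oU; have := open_within (cimg_open (c := c)) oU (cinv_continuous (c := c)).
rewrite (_ : _ `&` _ = cmap c @` (cdom c `&` U))//.
apply/seteqP; split=> [u [/cinvK[du e] Uu]|_ [w [cw Uw] <-]]; first by exists (cinv c u).
by split; [exists w|rewrite /= cmapK].
Qed.

Lemma open_chart_preimage c D : open D -> open (cdom c `&` cmap c @^-1` D).
Proof.
by move=> oD; apply: open_within => //; [exact: cdom_open|exact: cmap_continuous].
Qed.

Lemma smooth_on_chart c U (f : M -> R) h : atlas c -> open U -> U `<=` cdom c ->
  (forall w, U w -> f w = h (cmap c w)) -> Cinfty (cmap c @` (cdom c `&` U)) h ->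
  smooth_on U f.
Proof.
move=> Ac oU Uc fh hs d Ad.
have oI : open (cmap d @` (cdom d `&` U)) by exact: open_chart_image.
apply: (smooth_ext (f := fun u => h (cmap c (cinv d u)))) => //.
  by move=> _ [w [dw Uw] <-]; rewrite cmapK// fh.
apply: (@smooth_comp R m m _ (cmap c @` (cdom c `&` U)) h
  (fun u => cmap c (cinv d u))) => //; first exact: open_chart_image.
  by move=> _ [w [dw Uw] <-]; rewrite cmapK//; exists w => //; split => //; exact: Uc.
move=> i j; rewrite ord1; have [T _] := atlas_compatible Ad Ac.
apply: smooth_sub (T j) => _ [w [dw Uw] <-]; exists w => //; split => //; exact: Uc.
Qed.

Lemma smooth_on_coord c j : atlas c -> smooth_on (cdom c) (fun w => cmap c w 0 j).
Proof.
move=> Ac; apply: (smooth_on_chart (h := fun u => u 0 j) Ac) => //; first exact: cdom_open.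
by apply: smooth_coord; rewrite setIid; exact: cimg_open.
Qed.

Lemma smooth_funP (f : smooth_fun M) : smooth_on setT f.
Proof. by have := smooth_fun_mem f; rewrite inE. Qed.

Lemma smooth_fun_exists (f : M -> R) : smooth_on setT f -> exists F : smooth_fun M, F =1 f.
Proof.
move=> fs; have fm : f \in @smoothT R m M by rewrite inE.
by exists (SmoothFun fm).
Qed.

(** The support is the image of a compact set by the inverse of a chart. It is
    closed since the manifold is Hausdorff, so the product of the bump function
    with a function on [U] is smooth on the complement too. *)
Lemma manifold_bump U z : open U -> U z ->
  exists (chi : M -> R) (N : set M), [/\ open N, N z /\ N `<=` U,
    (forall w, N w -> chi w = 1) /\ (forall w, ~ U w -> chi w = 0) &
    forall phi, smooth_on U phi -> smooth_on setT (fun w => chi w * phi w)].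
Proof.
move=> oU Uz; have [c Ac cz] := atlas_cover z.
pose V := cdom c `&` U; have oV : open V by apply: openI => //; exact: cdom_open.
pose u0 := cmap c z.
have oI : open (cmap c @` (cdom c `&` V)) by exact: open_chart_image.
have Iu0 : (cmap c @` (cdom c `&` V)) u0 by exists z.
have [r [h [r0 rI hs [h1 h0] _]]] := cutoff_exists oI Iu0.
pose K := cinv c @` [set u | `|u - u0| <= 2 * r].
have rI' u : `|u - u0| <= 2 * r -> (cmap c @` (cdom c `&` V)) u.
  by move=> ur; apply: rI; lra.
have KV : K `<=` V.
  by move=> _ [u /rI'[w [cw Vw] <-] <-]; rewrite cmapK.
have Kc : closed K.
  apply: compact_closed; first exact: manifold_hausdorff.
  apply: continuous_compact.
    apply: (@continuous_subspaceW _ _ _ (cmap c @` cdom c)); last exact: cinv_continuous.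
    by move=> u /rI'[w [cw _] <-]; exists w.
  apply: bounded_closed_compact.
    exists (`|u0| + 2 * r); split; first exact: num_real.
    move=> x xM u /= uK; rewrite (le_trans _ (ltW xM))//.
    by rewrite -[u](subrK u0) (le_trans (ler_normD _ _))// addrC lerD2l.
  rewrite -[X in closed X]setCK; apply: open_closedC.
  rewrite (_ : ~` _ = [set u : 'rV[R]_m | 2 * r < `|u - u0|]); first exact: open_dist_gt.
  by apply/seteqP; split => u /=; rewrite ltNge => /negP.
pose chi w := if pselect (cdom c w) then h (cmap c w) else 0.
have chi0 w : ~ K w -> chi w = 0.
  rewrite /chi; case: pselect => // cw Kw; apply: h0.
  rewrite leNgt; apply/negP => /ltW H; apply: Kw.
  by exists (cmap c w) => //; rewrite cmapK.
exists chi, (cdom c `&` cmap c @^-1` [set u | `|u - u0| < r]); split.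
- by apply: open_chart_preimage; exact: open_dist_lt.
- split; first by split => //=; rewrite subrr normr0.
  move=> w [cw /= /ltW wr]; have : K w.
    by exists (cmap c w); rewrite ?cmapK//=; lra.
  by move=> /KV[].
- split=> [w [cw /= /ltW/h1]|w Uw]; first by rewrite /chi; case: pselect.
  by apply: chi0 => /KV[].
move=> phi phis d Ad; apply: smooth_local => _ [w [dw _] <-].
have [Kw|nKw] := pselect (K w); last first.
  exists (cmap d @` (cdom d `&` ~` K)); first by exists w.
  have oD : open (cmap d @` (cdom d `&` ~` K)).
    by apply: open_chart_image; exact: closed_openC.
  apply: (smooth_ext oD _ (smooth_cst 0 oD)) => _ [x [dx Kx] <-].
  by rewrite cmapK// chi0// mul0r.
exists (cmap d @` (cdom d `&` V)); first by exists w => //; split => //; exact: KV.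
have oD : open (cmap d @` (cdom d `&` V)) by exact: open_chart_image.
apply: smoothM => //.
  apply: (smooth_on_chart (h := h) Ac oV) => //; first by move=> x [].
    by move=> x [cx _]; rewrite /chi; case: pselect.
  exact: smooth_sub hs.
apply: smooth_sub (phis d Ad) => _ [x [dx [_ Ux]] <-].
by exists x.
Qed.

Lemma smooth_extension (I : choiceType) U (phi : I -> M -> R) z : open U -> U z ->
  (forall i, smooth_on U (phi i)) ->
  exists (F : I -> smooth_fun M) (N : set M), [/\ open N, N z, N `<=` U &
    forall w, N w -> forall i, F i w = phi i w].
Proof.
move=> oU Uz phis; have [chi [N [oN [Nz NU] [chi1 _] chiS]]] := manifold_bump oU Uz.
have [F FE] := choice (fun i => smooth_fun_exists (chiS _ (phis i))).
exists F, N; split => // w Nw i.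
by rewrite FE chi1// mul1r.
Qed.

Lemma tangentD z v (f g : smooth_fun M) : tangent z v -> v (f + g) = v f + v g.
Proof. by move=> [vl _]; have := vl 1 f g; rewrite scale1r mul1r. Qed.

Lemma tangent0 z v : tangent z v -> v (0 : smooth_fun M) = 0.
Proof.
move=> vt; apply: (addrI (v 0)).
by rewrite -(tangentD _ _ vt) !addr0.
Qed.

Lemma tangentN z v (f : smooth_fun M) : tangent z v -> v (- f) = - v f.
Proof.
move=> vt; apply/eqP; rewrite -addr_eq0 -(tangentD _ _ vt) addNr.
by rewrite (tangent0 vt).
Qed.

(** The product of the difference of the functions with a bump function
    vanishes; apply the Leibniz rule to it. *)
Lemma tangent_local z v (f g : smooth_fun M) N : tangent z v -> open N -> N z ->
  (forall w, N w -> f w = g w) -> v f = v g.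
Proof.
move=> vt oN Nz fg.
have [chi [N' [_ [N'z _] [chi1 chi0] chiS]]] := manifold_bump oN Nz.
have cs : smooth_on setT chi.
  have s1 : smooth_on N (fun=> 1).
    move=> c Ac; apply: smooth_cst; exact: open_chart_image.
  have -> : chi = (fun w => chi w * 1) by apply/funext => w; rewrite mulr1.
  exact: chiS.
have [h hE] := smooth_fun_exists cs.
have : (f - g) * h = 0.
  apply/val_inj/funext => w; change (((f w - g w) * h w) = 0); rewrite hE.
  have [Nw|nNw] := pselect (N w); first by rewrite fg// subrr mul0r.
  by rewrite chi0// mulr0.
move=> /(congr1 v); rewrite (tangent0 vt) vt.2.
rewrite -[(f - g) z]/(f z - g z) fg// subrr mul0r add0r hE chi1// mulr1.
by rewrite (tangentD _ _ vt) (tangentN _ vt) => /subr0_eq.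
Qed.

End Charts.

(** * Tangent vectors and vector fields in a chart *)

Section TangentVectors.
Context {R : realType} {m : nat} (M : smooth_manifold R m).
Implicit Types (c d : chart R m M) (U : set M) (z w : M) (f g : smooth_fun M).

Local Notation image c := (cmap c @` cdom c).

Definition dvec c (v : 'rV[R]_m) w : functional M := \sum_j v 0 j *: coord_vec c j w.

Lemma dvecE c v w f :
  dvec c v w f = \sum_j v 0 j * partial j (fun u => f (cinv c u)) (cmap c w).
Proof. by rewrite /dvec fct_sumE. Qed.

Lemma dvecD c v v' w : dvec c (v + v') w = dvec c v w + dvec c v' w.
Proof.
rewrite /dvec -big_split/=; apply: eq_bigr => j _.
by rewrite mxE scalerDl.
Qed.

Lemma dvecZ c a v w : dvec c (a *: v) w = a *: dvec c v w.
Proof. by rewrite /dvec scaler_sumr; apply: eq_bigr => j _; rewrite mxE scalerA. Qed.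

Lemma dvec_lincomb c r (a : 'I_r -> R) (v : 'I_r -> 'rV[R]_m) w :
  dvec c (\sum_i a i *: v i) w = \sum_i a i *: dvec c (v i) w.
Proof.
have dvec0 : dvec c 0 w = 0.
  by rewrite /dvec big1// => j _; rewrite mxE scale0r.
rewrite (big_morph (fun v => dvec c v w) (fun v v' => dvecD c v v' w) dvec0).
by apply: eq_bigr => i _; exact: dvecZ.
Qed.

Lemma smooth_in_chart c f : atlas c -> Cinfty (image c) (fun u => f (cinv c u)).
Proof. by move=> Ac; have := smooth_funP f Ac; rewrite setIT. Qed.

Lemma near_chart c N w : open N -> N w -> cdom c w ->
  \forall u \near cmap c w, N (cinv c u) /\ cdom c (cinv c u) /\ cmap c (cinv c u) = u.
Proof.
move=> oN Nw cw; have := open_chart_image (c := c) oN => oI.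
have : nbhs (cmap c w) (cmap c @` (cdom c `&` N)).
  by apply: open_nbhs_nbhs; split => //; exists w.
by apply: filterS => _ [x [cx Nx] <-]; rewrite cmapK.
Qed.

Lemma dvec_local c v w f h N : cdom c w -> open N -> N w ->
  (forall x, N x -> cdom c x -> f x = h (cmap c x)) ->
  dvec c v w f = \sum_j v 0 j * partial j h (cmap c w).
Proof.
move=> cw oN Nw fh; rewrite dvecE; apply: eq_bigr => j _; congr (_ * _).
apply: near_eq_derive; have := near_chart oN Nw cw.
by apply: filterS => u [Nu [cu cuu]]; rewrite fh// cuu.
Qed.

Lemma sum_smooth_funE (I : Type) (r : seq I) (F : I -> smooth_fun M) w :
  (\sum_(i <- r) F i : smooth_fun M) w = \sum_(i <- r) F i w.
Proof.
by elim: r => [|i r IH]; rewrite ?big_nil// !big_cons -IH.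
Qed.

Lemma tangent_sum z v (I : Type) (r : seq I) (F : I -> smooth_fun M) : tangent z v ->
  v (\sum_(i <- r) F i) = \sum_(i <- r) v (F i).
Proof.
move=> vt; elim: r => [|i r IH]; rewrite ?big_nil ?(tangent0 vt)// !big_cons.
by rewrite (tangentD _ _ vt) IH.
Qed.

Lemma smooth_funB f g w : (f - g : smooth_fun M) w = f w - g w. Proof. by []. Qed.

Lemma smooth_funM f g w : (f * g : smooth_fun M) w = f w * g w. Proof. by []. Qed.

Lemma smooth_fun_cst (a : R) w : (a *: (1 : smooth_fun M)) w = a.
Proof. exact: mulr1. Qed.

Lemma tangent_cst z v (a : R) : tangent z v -> v (a *: (1 : smooth_fun M)) = 0.
Proof.
move=> [vl vM]; have v1 : v 1 = 0.
  have := vM 1 1; rewrite mulr1 -[(1 : smooth_fun M) z]/(1 : R) mul1r mulr1.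
  by move=> E; apply: (addrI (v 1)); rewrite addr0 -E.
have v0 : v (0 : smooth_fun M) = 0 by exact: (@tangent0 _ _ M z v (conj vl vM)).
by have := vl a 1 0; rewrite addr0 v1 v0 mulr0 addr0.
Qed.

(** By the lemma of Hadamard a function is, near the point, a constant plus a
    combination of the centred coordinates with smooth coefficients, whose values
    at the point are the partial derivatives. *)
Lemma tangent_dvec c w v : atlas c -> cdom c w -> tangent w v ->
  exists a, v = dvec c a w.
Proof.
move=> Ac cw vt; set u0 := cmap c w.
have [hu [N [oN Nw Nc huE]]] :=
  smooth_extension (cdom_open c) cw (fun j => smooth_on_coord j Ac).
exists (\row_j v (hu j)); apply/funext => f.
have oI := cimg_open (c := c); have Iu0 : image c u0 by exists w.
have [r [h [r0 rI hs [h1 h0] hF]]] := cutoff_exists oI Iu0.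
pose F u := f (cinv c u).
have Gs := hF _ (smooth_in_chart f Ac).
pose G x := h (x + u0) * F (x + u0).
have shift_s : smooth_mx setT (fun x : 'rV[R]_m => x + u0).
  by apply: smooth_mxD; [exact: openT|exact: smooth_mx_id openT|exact: smooth_mx_cst openT].
have Gs' : Cinfty setT G.
  exact: (smooth_comp openT openT (fun _ _ => I) shift_s Gs).
have [g [gs g0 gE]] := hadamard Gs'.
have phis j : smooth_on (cdom c) (fun x => g (cmap c x - u0) 0 j).
  apply: (smooth_on_chart (h := fun u => g (u - u0) 0 j) Ac) => //; first exact: cdom_open.
  rewrite setIid.
  have us : smooth_mx (image c) (fun u => u - u0).
    by apply: smooth_mxB => //; [exact: smooth_mx_id|exact: smooth_mx_cst].
  exact: (smooth_comp oI openT (fun _ _ => I) us (gs 0 j)).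
have [hg [N2 [oN2 N2w N2c hgE]]] := smooth_extension (cdom_open c) cw phis.
pose K (a : R) : smooth_fun M := a *: (1 : smooth_fun M).
pose k j := u0 0 j.
pose f' : smooth_fun M := K (f w) + \sum_j (hu j - K (k j)) * hg j.
pose N3 := (N `&` N2) `&` (cdom c `&` cmap c @^-1` [set u | `|u - u0| < r]).
have -> : v f = v f'.
  apply: (tangent_local (N := N3) vt) => //.
  - apply: openI; first exact: openI.
    by apply: open_chart_preimage; exact: open_dist_lt.
  - by split => //; split => //=; rewrite subrr normr0.
  move=> x [[Nx N2x] [cx /= xr]].
  rewrite [RHS]/(K (f w) x + (\sum_j (hu j - K (k j)) * hg j : smooth_fun M) x).
  rewrite smooth_fun_cst sum_smooth_funE.
  have := gE (cmap c x - u0); rewrite /G subrK add0r.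
  rewrite !h1 ?subrr ?normr0 ?mul1r; [|exact: ltW..].
  rewrite /F !cmapK// => ->; congr (_ + _); apply: eq_bigr => j _.
  by rewrite smooth_funM smooth_funB smooth_fun_cst huE// hgE// !mxE.
rewrite /f' (tangentD _ _ vt) (tangent_cst _ vt) add0r (tangent_sum _ _ vt) dvecE.
apply: eq_bigr => j _; rewrite vt.2.
rewrite smooth_funB smooth_fun_cst huE// subrr mul0r add0r.
rewrite (tangentD _ _ vt) (tangentN _ vt) (tangent_cst _ vt) oppr0 addr0 mxE.
congr (_ * _); rewrite hgE// subrr g0.
have D1 : is_derive u0 (delta_mx 0 j) F (partial j F u0).
  by apply: derivableP; exact: (smooth_derivable (smooth_in_chart f Ac)).
have [_ <-] : is_derive 0 (delta_mx 0 j) G (partial j F u0); last by [].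
apply: (@is_derive_near _ _ (fun x => F (x + u0))).
  have : nbhs (0 : 'rV[R]_m) [set x : 'rV[R]_m | `|x - 0| < r].
    by apply: open_nbhs_nbhs; split; [exact: open_dist_lt|rewrite /= subrr normr0].
  apply: filterS => x /= xr; rewrite /G h1 ?mul1r//.
  by rewrite addrK; move: xr; rewrite subr0 => /ltW.
move/is_derive_epsP : D1 => D1; apply/is_derive_epsP => e e0.
by apply: filterS (D1 e e0) => t; rewrite addr0 add0r.
Qed.

Lemma dvec_coord c w a (F : smooth_fun M) j N : cdom c w -> open N -> N w ->
  (forall x, N x -> F x = cmap c x 0 j) -> dvec c a w F = a 0 j.
Proof.
move=> cw oN Nw FE.
rewrite (dvec_local _ (h := fun u => u 0 j) cw oN Nw) => [|x Nx _]; last exact: FE.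
rewrite (bigD1 j)//= big1 ?addr0 => [|i ij].
  by have [_] := is_derive_coord (cmap c w) (delta_mx 0 j) j; rewrite /partial => ->; rewrite mxE !eqxx mulr1.
have [_] := is_derive_coord (cmap c w) (delta_mx 0 i) j; rewrite /partial => ->.
by rewrite mxE eqxx eq_sym (negbTE ij) mulr0.
Qed.

Lemma coord_functions c w : atlas c -> cdom c w ->
  exists (F : 'I_m -> smooth_fun M) (N : set M), [/\ open N, N w, N `<=` cdom c &
    forall x, N x -> forall j, F j x = cmap c x 0 j].
Proof.
move=> Ac cw.
exact: (smooth_extension (cdom_open c) cw (fun j => smooth_on_coord j Ac)).
Qed.

Lemma dvec_inj c w : atlas c -> cdom c w -> injective (fun a => dvec c a w).
Proof.
move=> Ac cw a b /= ab; have [F [N [oN Nw _ FE]]] := coord_functions Ac cw.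
apply/rowP => j; have Fj x (Nx : N x) := FE x Nx j.
by rewrite -(dvec_coord a cw oN Nw Fj) ab (dvec_coord b cw oN Nw Fj).
Qed.

(** The components of a smooth family of tangent vectors are smooth, since they
    are its values on the coordinates, extended to smooth functions. *)
Lemma components c U (X : M -> functional M) : atlas c -> open U ->
  (forall w, U w -> tangent w (X w)) ->
  (forall f, smooth_on U (fun w => X w f)) ->
  exists xi : 'rV[R]_m -> 'rV[R]_m,
    smooth_mx (cmap c @` (cdom c `&` U)) xi /\
    forall w, U w -> cdom c w -> X w = dvec c (xi (cmap c w)) w.
Proof.
move=> Ac oU Xt Xs.
have ex (u : 'rV[R]_m) : exists a, (cmap c @` (cdom c `&` U)) u ->
    X (cinv c u) = dvec c a (cinv c u).
  have [[w [cw Uw] <-]|nu] := pselect ((cmap c @` (cdom c `&` U)) u); last by exists 0.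
  by rewrite cmapK//; have [a ->] := tangent_dvec Ac cw (Xt w Uw); exists a.
have [xi xiP] := choice ex; exists xi; split; last first.
  move=> w Uw cw; rewrite -{1 3}(cmapK (c := c) cw); rewrite -xiP ?cmapK//.
  by exists w.
move=> i j; rewrite ord1; apply: smooth_local => _ [w [cw Uw] <-].
have [F [N [oN Nw Nc FE]]] := coord_functions Ac cw.
exists (cmap c @` (cdom c `&` (U `&` N))); first by exists w.
have oUN : open (U `&` N) by exact: openI.
apply: (smooth_ext (open_chart_image (c := c) oUN) (f := fun u => X (cinv c u) (F j))).
  move=> _ [x [cx [Ux Nx]] <-].
  rewrite (xiP (cmap c x)) ?cmapK//; last by exists x.
  by apply: (dvec_coord _ (N := N)) => // y Ny; exact: FE.
apply: smooth_sub (Xs (F j) c Ac) => _ [x [cx [Ux Nx]] <-].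
by exists x.
Qed.

Lemma value_tangent (X : vfield M) w : tangent w (value_at X w).
Proof.
split=> [a f g|f g]; rewrite /value_at; first by rewrite linearP.
by rewrite vfieldM.
Qed.

Lemma field_components c (X : vfield M) : atlas c ->
  exists xi, smooth_mx (image c) xi /\
    forall w, cdom c w -> value_at X w = dvec c (xi (cmap c w)) w.
Proof.
move=> Ac; have [|f|xi] := @components c setT (value_at X) Ac openT.
- by move=> w _; exact: value_tangent.
- exact: smooth_funP.
by rewrite setIT => -[xis xiE]; exists xi; split => // w; exact: xiE.
Qed.

(** Apply the commutator of the derivations to the coordinates. *)
Lemma lie_components c (X Y : vfield M) xi eta zeta : atlas c ->
  smooth_mx (image c) xi -> smooth_mx (image c) eta ->
  (forall w, cdom c w -> value_at X w = dvec c (xi (cmap c w)) w) ->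
  (forall w, cdom c w -> value_at Y w = dvec c (eta (cmap c w)) w) ->
  (forall w, cdom c w -> value_at (lie X Y) w = dvec c (zeta (cmap c w)) w) ->
  forall u, image c u -> zeta u = bracket xi eta u.
Proof.
move=> Ac xis etas XE YE ZE _ [w cw <-].
have [F [N [oN Nw Nc FE]]] := coord_functions Ac cw.
apply/rowP => j; have Fj x (Nx : N x) := FE x Nx j.
have oI := cimg_open (c := c).
have Iw : image c (cmap c w) by exists w.
rewrite -(dvec_coord (zeta (cmap c w)) cw oN Nw Fj) -ZE//.
rewrite [LHS]/(X (Y (F j)) w - Y (X (F j)) w).
have app (Z : vfield M) ze (Z' : vfield M) ze' : smooth_mx (image c) ze' ->
    (forall w, cdom c w -> value_at Z w = dvec c (ze (cmap c w)) w) ->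
    (forall w, cdom c w -> value_at Z' w = dvec c (ze' (cmap c w)) w) ->
    Z (Z' (F j)) w = (ze (cmap c w) *m jac ze' (cmap c w)) 0 j.
  move=> ze's ZE' Z'E; rewrite -[LHS]/(value_at Z w (Z' (F j))) ZE'//.
  rewrite (dvec_local _ (h := fun u => ze' u 0 j) cw oN Nw).
    by rewrite mxE; apply: eq_bigr => k _; rewrite mxE.
  move=> x Nx cx; rewrite -[LHS]/(value_at Z' x (F j)) Z'E//.
  by apply: (dvec_coord _ (N := N)).
by rewrite (app X xi Y eta)// (app Y eta X xi)// !mxE.
Qed.

End TangentVectors.

(** * New charts and fields on the whole manifold *)

Section NewCharts.
Context {R : realType} {m : nat} (M : smooth_manifold R m).
Implicit Types (c d : chart R m M) (U : set M) (z w : M).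

Lemma open_within_cvg (S T : topologicalType) (A : set S) (f : S -> T) x :
  open A -> {within A, continuous f} -> A x -> {for x, continuous f}.
Proof.
move=> oA fc Ax; move: fc; rewrite continuous_open_subspace// => /(_ x).
by rewrite inE; exact.
Qed.

Lemma diffeo_continuous D D' (Psi Phi : 'rV[R]_m -> 'rV[R]_m) p :
  local_diffeo D D' Psi Phi -> D p -> {for p, continuous Psi}.
Proof. by move=> [_ _ _ Ps _] Dp; exact: smooth_mx_cont Ps Dp. Qed.

Lemma diffeo_sym D D' (Psi Phi : 'rV[R]_m -> 'rV[R]_m) :
  local_diffeo D D' Psi Phi -> local_diffeo D' D Phi Psi.
Proof. by move=> [[oD oD'] DD DD' Ps Phs]; split. Qed.

(** The maximality of the atlas makes a chart of the composite of a chart with a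
    local diffeomorphism. *)
Lemma new_chart c D D' (Psi Phi : 'rV[R]_m -> 'rV[R]_m) : atlas c ->
  local_diffeo D D' Psi Phi -> D' `<=` cmap c @` cdom c ->
  exists c', [/\ atlas c', cdom c' = cdom c `&` cmap c @^-1` D',
    (forall w, cmap c' w = Phi (cmap c w)) & forall p, cinv c' p = cinv c (Psi p)].
Proof.
move=> Ac LD D'c; have [[oD oD'] DD DD' Ps Phs] := LD.
pose dom := cdom c `&` cmap c @^-1` D'.
pose map w := Phi (cmap c w); pose inv p := cinv c (Psi p).
have odom : open dom by exact: open_chart_preimage.
have mapD w : dom w -> D (map w) by move=> [_ /DD'[]].
have mapK w : dom w -> inv (map w) = w.
  by move=> [cw /DD'[_]]; rewrite /inv /map => ->; rewrite cmapK.
have invD p : D p -> dom (inv p) /\ map (inv p) = p.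
  move=> Dp; have [D'p PhiK] := DD p Dp.
  by have [cp cpK] := cinvK (D'c _ D'p); rewrite /dom /map /inv /= cpK.
have img : map @` dom = D.
  apply/seteqP; split=> [_ [w dw <-]|p Dp]; first exact: mapD.
  by have [dp pK] := invD p Dp; exists (inv p).
have oimg : open (map @` dom) by rewrite img.
have mapC : {within dom, continuous map}.
  rewrite continuous_open_subspace// => w; rewrite inE => -[cw D'w].
  apply: continuous_comp; first exact: open_within_cvg (cdom_open c) (cmap_continuous (c := c)) cw.
  exact: diffeo_continuous (diffeo_sym LD) D'w.
have invC : {within map @` dom, continuous inv}.
  rewrite img continuous_open_subspace// => p; rewrite inE => Dp.
  apply: continuous_comp; first exact: diffeo_continuous LD Dp.
  by apply: open_within_cvg (cimg_open (c := c)) (cinv_continuous (c := c)) _;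
    exact: D'c (DD p Dp).1.
pose c' := Chart odom oimg mapK mapC invC.
exists c'; split => //; apply: atlas_maximal => d Ad.
have [Tcd Tdc] := atlas_compatible Ac Ad.
split=> j.
  apply: (@smooth_comp R m m _ (cmap c @` (cdom c `&` cdom d))
    (fun u => cmap d (cinv c u) 0 j) Psi) => //.
  - by apply: (open_chart_image (c := c')); exact: cdom_open.
  - by apply: open_chart_image; exact: cdom_open.
  - move=> _ [w [[cw /DD'[_ PK]] dw] <-]; by exists w.
  - by apply: smooth_mx_sub Ps => _ [w [/mapD dw _] <-].
apply: (@smooth_comp R m m _ D' (fun u => Phi u 0 j) (fun u => cmap c (cinv d u))) => //.
- exact: open_chart_image.
- by move=> _ [w [dw [cw D'w]] <-]; rewrite cmapK.
- move=> i k; rewrite ord1; apply: smooth_sub (Tdc k) => _ [w [dw [cw _]] <-].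
  by exists w.
Qed.

(** The chain rule for $f\circ c^{-1}\circ\Psi$. *)
Lemma dvec_new_chart c c' D D' (Psi Phi : 'rV[R]_m -> 'rV[R]_m) v w : atlas c ->
  local_diffeo D D' Psi Phi -> D' `<=` cmap c @` cdom c ->
  (forall x, cmap c' x = Phi (cmap c x)) -> (forall p, cinv c' p = cinv c (Psi p)) ->
  cdom c w -> D' (cmap c w) ->
  dvec c' v w = dvec c (v *m jac Psi (cmap c' w)) w.
Proof.
move=> Ac [[oD oD'] DD DD' Ps Phs] D'c cmE ciE cw D'w; apply/funext => f.
have [Dw PK] := DD' _ D'w.
pose F u : 'rV[R]_1 := \row_(_ < 1) f (cinv c u).
have Fs : smooth_mx (cmap c @` cdom c) F.
  move=> i j; apply: (smooth_ext (f := fun u => f (cinv c u))).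
  - exact: cimg_open.
  - by move=> u _; rewrite mxE.
  - exact: smooth_in_chart.
have E (G : 'rV[R]_m -> R) (a : 'rV[R]_m) u :
    \sum_j a 0 j * partial j G u = (a *m jac (fun x => \row_(_ < 1) G x) u) 0 0.
  have GE j : G = (fun x => (\row_(_ < 1) G x : 'rV[R]_1) 0 j).
    by apply/funext => x; rewrite mxE.
  by rewrite mxE; apply: eq_bigr => j _; rewrite mxE -GE.
rewrite !dvecE !E cmE -mulmxA; congr ((_ *m _) 0 0).
rewrite (_ : (fun x => _) = fun x => F (Psi x)); last first.
  by apply/funext => x; rewrite ciE.
rewrite (jac_comp oD (cimg_open (c := c)) Ps Fs) ?PK//.
Qed.

End NewCharts.

Section GlobalFields.
Context {R : realType} {m : nat} (M : smooth_manifold R m).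
Implicit Types (U : set M) (z w : M).

Lemma vfield_exists (X : M -> functional M) : (forall w, tangent w (X w)) ->
  (forall f, smooth_on setT (fun w => X w f)) ->
  exists Y : vfield M, forall w, value_at Y w = X w.
Proof.
move=> Xt Xs; have [Y YE] := choice (fun f => smooth_fun_exists (Xs f)).
have Yl : linear Y.
  move=> a f g; apply/val_inj/funext => w; rewrite /=.
  rewrite [LHS]YE (Xt w).1.
  by rewrite -!YE.
pose L : {linear smooth_fun M -> smooth_fun M} :=
  HB.pack Y (GRing.isLinear.Build R (smooth_fun M) (smooth_fun M) *:%R Y Yl).
have LM f g : L (f * g) = f * L g + L f * g.
  apply/val_inj/funext => w; rewrite /=.
  by rewrite [LHS]YE (Xt w).2 -!YE.
by exists (VField LM) => w; apply/funext => f; exact: YE.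
Qed.

Lemma field_extension k U (X : 'I_k -> M -> functional M) z : open U -> U z ->
  (forall i w, U w -> tangent w (X i w)) ->
  (forall i f, smooth_on U (fun w => X i w f)) ->
  exists (Y : 'I_k -> vfield M) (chi : M -> R) (N : set M),
    [/\ open N, N z /\ N `<=` U, forall w, N w -> chi w = 1,
      forall i w, U w -> value_at (Y i) w = chi w *: X i w &
      forall i w, ~ U w -> value_at (Y i) w = 0].
Proof.
move=> oU Uz Xt Xs; have [chi [N [oN [Nz NU] [chi1 chi0] chiS]]] := manifold_bump oU Uz.
have ex i : exists Y : vfield M, forall w, value_at Y w = fun f => chi w * X i w f.
  apply: vfield_exists => [w|f]; last exact: chiS.
  split=> [a f g|f g]; have [Uw|/chi0 ->] := pselect (U w).
  - by rewrite (Xt i w Uw).1 mulrDr mulrCA.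
  - by rewrite !mul0r mulr0 addr0.
  - by rewrite (Xt i w Uw).2 mulrDr mulrCA -mulrA.
  - by rewrite !mul0r mulr0 addr0.
have [Y YE] := choice ex.
exists Y, chi, N; split => // i w Uw; rewrite YE//.
by apply/funext => f; rewrite chi0// mul0r.
Qed.

End GlobalFields.

(** * Symmetry of second derivatives *)

Section SecondDerivatives.
Context {R : realType}.

(** If $f = f(0) + \sum_j x_j g_j$, both mixed
    derivatives at the origin are $\partial_i g_j(0) + \partial_j g_i(0)$. *)
Lemma partial_comm m (U : set 'rV[R]_m) f u i j : open U -> Cinfty U f -> U u ->
  partial i (partial j f) u = partial j (partial i f) u.
Proof.
move=> oU fs Uu; have [r [h [r0 rI hs [h1 h0] hF]]] := cutoff_exists oU Uu.
pose G x := h (x + u) * f (x + u).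
have shift_s : smooth_mx setT (fun x : 'rV[R]_m => x + u).
  by apply: smooth_mxD; [exact: openT|exact: smooth_mx_id openT|exact: smooth_mx_cst openT].
have Gs : Cinfty setT G by exact: (smooth_comp openT openT (fun _ _ => I) shift_s (hF _ fs)).
have [g [gs _ gE]] := hadamard Gs.
have shiftE k (F : 'rV[R]_m -> R) x :
    partial k (fun y => F (y + u)) x = partial k F (x + u).
  rewrite /partial /derive; set a := (fun h => _); set b := (fun h => _).
  by have -> : a = b by apply/funext => t; rewrite /a /b /= addrA.
have Df k l x : is_derive x (delta_mx 0 l) (fun y => g y 0 k) (partial l (fun y => g y 0 k) x).
  by apply: derivableP; apply: (@smooth_derivable R m setT _ x l (gs 0 k)).
have DDf q k l : is_derive (0 : 'rV[R]_m) (delta_mx 0 k) (partial l (fun y => g y 0 q))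
    (partial k (partial l (fun y => g y 0 q)) 0).
  by apply: derivableP; apply: (@smooth_derivable R m setT _ 0 k (smooth_partial l (gs 0 q))).
have dG l x : partial l G x =
    \sum_k (x 0 k * partial l (fun y => g y 0 k) x + (k == l)%:R * g x 0 k).
  have -> : G = cst (G 0) + \sum_k (fun y : 'rV[R]_m => y 0 k) * (fun y => g y 0 k).
    by apply/funext => y; rewrite [LHS]gE fct_sumE /= .
  have dk k := is_deriveM (is_derive_coord x (delta_mx 0 l) k) (Df k l x).
  have [_ E] := is_deriveD (is_derive_cst (G 0) x (delta_mx 0 l)) (is_derive_sum dk).
  rewrite [LHS]E add0r; apply: eq_bigr => k _; rewrite mxE eqxx /=.
  by rewrite [X in _ + X]mulrC.
have ddG k l : partial k (partial l G) 0 =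
    \sum_q ((q == k)%:R * partial l (fun y => g y 0 q) 0 +
            (q == l)%:R * partial k (fun y => g y 0 q) 0).
  have -> : partial l G = \sum_q ((fun y : 'rV[R]_m => y 0 q) * partial l (fun y => g y 0 q) +
      cst ((q == l)%:R : R) * (fun y => g y 0 q)).
    by apply/funext => x; rewrite dG fct_sumE.
  have dk q := is_deriveD (is_deriveM (is_derive_coord 0 (delta_mx 0 k) q) (DDf q k l))
    (is_deriveM (is_derive_cst ((q == l)%:R : R) 0 (delta_mx 0 k)) (Df q k 0)).
  have [_ E] := is_derive_sum dk; rewrite [LHS]E; apply: eq_bigr => q _.
  by rewrite !mxE eqxx /= scale0r add0r scaler0 addr0 [X in X + _ = _]mulrC.
have ddf k l : partial k (partial l f) u = partial k (partial l G) 0.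
  rewrite -[in LHS](add0r u) -shiftE; apply: near_eq_derive.
  have : nbhs (0 : 'rV[R]_m) [set x : 'rV[R]_m | `|x - 0| < r].
    by apply: open_nbhs_nbhs; split; [exact: open_dist_lt|rewrite /= subrr normr0].
  apply: filterS => x /= xr; rewrite -shiftE; apply: near_eq_derive.
  have : nbhs x [set y : 'rV[R]_m | `|y - 0| < r].
    by apply: open_nbhs_nbhs; split; [exact: open_dist_lt|].
  apply: filterS => y /=; rewrite subr0 => /ltW yr.
  by rewrite /G h1 ?mul1r// addrK.
rewrite (ddf i j) (ddf j i) (ddG i j) (ddG j i).
by apply: eq_bigr => q _; exact: addrC.
Qed.

Lemma hessian_sym m N (U : set 'rV[R]_m) (h : 'rV[R]_m -> 'rV[R]_N) (x y : 'rV[R]_m) u :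
  open U -> smooth_mx U h -> U u ->
  x *m jac (fun w => y *m jac h w) u = y *m jac (fun w => x *m jac h w) u.
Proof.
move=> oU hs Uu; have jhs := smooth_jac oU hs.
rewrite !(jac_lincomb _ oU jhs Uu) !mulmx_sumr; apply/rowP => j; rewrite !summxE.
under eq_bigr do rewrite -scalemxAr !mxE mulr_sumr.
under [RHS]eq_bigr do rewrite -scalemxAr !mxE mulr_sumr.
rewrite exchange_big /=; apply: eq_bigr => i _; apply: eq_bigr => k _.
rewrite mulrCA; congr (_ * (_ * _)); rewrite !mxE.
have rowE' l : (fun w => row l (jac h w) 0 j) = partial l (fun w => h w 0 j).
  by apply/funext => w; rewrite !mxE.
by rewrite !rowE'; exact: partial_comm oU (hs 0 j) Uu.
Qed.

(** In the commutator of two derivations the second derivatives of [h] cancel, by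
    symmetry. *)
Lemma bracket_jac m N (U : set 'rV[R]_m) (X Y : 'rV[R]_m -> 'rV[R]_m)
    (h : 'rV[R]_m -> 'rV[R]_N) u :
  open U -> smooth_mx U X -> smooth_mx U Y -> smooth_mx U h -> U u ->
  bracket X Y u *m jac h u =
  X u *m jac (fun w => Y w *m jac h w) u - Y u *m jac (fun w => X w *m jac h w) u.
Proof.
move=> oU Xs Ys hs Uu; have jhs := smooth_jac oU hs.
rewrite (jac_mulmx oU Xs jhs Uu) (jac_mulmx oU Ys jhs Uu) !mulmxDr.
rewrite (hessian_sym (X u) (Y u) oU hs Uu) opprD addrACA subrr addr0.
by rewrite /bracket mulmxBl !mulmxA.
Qed.

End SecondDerivatives.


(** * The normal form in coordinates *)

Section NormalForm.
Context {R : realType}.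

Lemma jac_id m (u : 'rV[R]_m) : jac id u = 1%:M.
Proof.
apply/matrixP => i j; rewrite !mxE.
by have [_ E] := is_derive_coord u (delta_mx 0 i) j; rewrite [LHS]E !mxE eqxx eq_sym.
Qed.

Lemma diffeo_jac m D D' (Psi Phi : 'rV[R]_m -> 'rV[R]_m) u :
  local_diffeo D D' Psi Phi -> D' u -> jac Psi (Phi u) *m jac Phi u = 1%:M.
Proof.
move=> [[oD oD'] DD DD' Ps Phs] D'u; have [Du uK] := DD' u D'u.
have := jac_comp oD oD' Ps Phs Du; rewrite uK => /(_ D'u) <-.
by rewrite -(jac_id (Phi u)); apply: (jac_ext oD) => // w /DD[].
Qed.

Lemma smooth_bracket m (U : set 'rV[R]_m) (X Y : 'rV[R]_m -> 'rV[R]_m) :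
  open U -> smooth_mx U X -> smooth_mx U Y -> smooth_mx U (bracket X Y).
Proof.
by move=> oU Xs Ys; apply: smooth_mxB => //; apply: smooth_mulmx => //; exact: smooth_jac.
Qed.

Lemma smooth_col_mx m r r' N (U : set 'rV[R]_m) (A : 'rV[R]_m -> 'M[R]_(r, N))
    (A' : 'rV[R]_m -> 'M[R]_(r', N)) :
  open U -> smooth_mx U A -> smooth_mx U A' -> smooth_mx U (fun u => col_mx (A u) (A' u)).
Proof.
move=> oU As As' i j; case: (split_ordP i) => i1 ->.
  by apply: (smooth_ext oU _ (As i1 j)) => u _; rewrite col_mxEu.
by apply: (smooth_ext oU _ (As' i1 j)) => u _; rewrite col_mxEd.
Qed.

Variables (m n : nat) (hnm : (2 * n <= m)%N).

Local Notation Et := (sel (t_idx hnm) : 'M[R]_(_, m)).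
Local Notation Ex := (sel (x_idx hnm) : 'M[R]_(_, m)).
Local Notation Ey := (sel (y_idx hnm) : 'M[R]_(_, m)).

Lemma t_idx_inj : injective (t_idx hnm).
Proof. by move=> i j /(congr1 val)/= /val_inj. Qed.

Lemma x_idx_inj : injective (x_idx hnm).
Proof. by move=> i j /(congr1 val)/= /addnI/val_inj. Qed.

Lemma y_idx_inj : injective (y_idx hnm).
Proof. by move=> i j /(congr1 val)/= /addnI/val_inj. Qed.

Lemma t_idx_x_idx i j : t_idx hnm i != x_idx hnm j.
Proof. by apply/eqP => /(congr1 val)/=; have := ltn_ord i; lia. Qed.

Lemma t_idx_y_idx i j : t_idx hnm i != y_idx hnm j.
Proof. by apply/eqP => /(congr1 val)/=; have := ltn_ord i; lia. Qed.

Lemma x_idx_y_idx i j : x_idx hnm i != y_idx hnm j.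
Proof. by apply/eqP => /(congr1 val)/=; have := ltn_ord i; lia. Qed.

Lemma idx_cases (j : 'I_m) :
  [\/ exists i, j = t_idx hnm i, exists i, j = x_idx hnm i | exists i, j = y_idx hnm i].
Proof.
have [jt|jt] := ltnP j (m - 2 * n).
  by apply: Or31; exists (Ordinal jt); exact: val_inj.
have [jx|jx] := ltnP j (m - n).
  have H : (j - (m - 2 * n) < n)%N by lia.
  by apply: Or32; exists (Ordinal H); apply: val_inj => /=; lia.
have H : (j - (m - n) < n)%N by have := ltn_ord j; lia.
by apply: Or33; exists (Ordinal H); apply: val_inj => /=; lia.
Qed.

Let tx := sel_orthogonal t_idx_x_idx (F := R).
Let ty := sel_orthogonal t_idx_y_idx (F := R).
Let xy := sel_orthogonal x_idx_y_idx (F := R).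
Let tt := sel_orthonormal t_idx_inj (F := R).
Let xx := sel_orthonormal x_idx_inj (F := R).
Let yy := sel_orthonormal y_idx_inj (F := R).

Lemma selC0 r r' (s : 'I_r -> 'I_m) (s' : 'I_r' -> 'I_m) :
  sel s *m (sel s')^T = 0 :> 'M[R]_(r, r') -> sel s' *m (sel s)^T = 0 :> 'M[R]_(r', r).
Proof. by move=> E; rewrite -[LHS]trmxK trmx_mul trmxK E trmx0. Qed.

Lemma sel_complete : Et^T *m Et + Ex^T *m Ex + Ey^T *m Ey = 1%:M.
Proof.
set S := LHS.
have St : Et *m S = Et by rewrite !mulmxDr !mulmxA tt tx ty !mul0mx mul1mx !addr0.
have Sx : Ex *m S = Ex.
  by rewrite !mulmxDr !mulmxA xx (selC0 tx) xy !mul0mx mul1mx add0r addr0.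
have Sy : Ey *m S = Ey.
  by rewrite !mulmxDr !mulmxA yy (selC0 ty) (selC0 xy) !mul0mx mul1mx !add0r.
have rowE' r (s : 'I_r -> 'I_m) i : row (s i) (1%:M : 'M[R]_m) = row i (sel s).
  by apply/rowP => j; rewrite !mxE eq_sym.
have rowS r (s : 'I_r -> 'I_m) i : sel s *m S = sel s -> row (s i) S = row (s i) 1%:M.
  by move=> E; rewrite -[in LHS](mul1mx S) row_mul rowE' -row_mul E.
apply/row_matrixP => j; have [[i ->]|[i ->]|[i ->]] := idx_cases j; exact: rowS.
Qed.

Definition lie_frame (phi : 'rV[R]_m -> 'rV[R]_m) (a : 'rV[R]_m -> 'M[R]_(n, m)) u :
    'M[R]_(n + n, m) :=
  col_mx (a u) (\matrix_i bracket phi (fun w => row i (a w)) u).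

(** The coordinates $t$ come from the theorem of Frobenius for the frame $A$ of
    $W$ and the transverse fields [f], the coordinates $x$ from the same theorem for
    the frame [a] of $V$, and $y=\phi x$. As [a] annihilates $x$,
    $a_i y=a_i(\phi x)=-[\phi,a_i]x$, which is invertible once $x$ is chosen dual to the
    brackets at the base point; this makes $(t,x,y)$ a coordinate system in which
    [a] spans the $\partial/\partial y^i$. *)
Theorem normal_form k (iota : 'I_k -> 'I_(m - 2 * n)) (B : set 'rV[R]_m)
    (a : 'rV[R]_m -> 'M[R]_(n, m)) (phi : 'rV[R]_m -> 'rV[R]_m)
    (f : 'rV[R]_m -> 'M[R]_(k, m)) (sigma : 'rV[R]_k) u0 :
  let A := lie_frame phi a in
  (k <= 1)%N -> injective iota -> open B -> B u0 ->
  smooth_mx B a -> smooth_mx B phi -> smooth_mx B f ->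
  row_free (col_mx (A u0) (f u0)) ->
  (forall u, B u -> forall i i',
    (bracket (fun w => row i (a w)) (fun w => row i' (a w)) u <= a u)%MS) ->
  (forall u, B u -> forall i i',
    (bracket (fun w => row i (A w)) (fun w => row i' (A w)) u <= A u)%MS) ->
  (forall u, B u -> forall j i,
    (bracket (fun w => row j (f w)) (fun w => row i (A w)) u <= A u)%MS) ->
  (forall u, B u -> (phi u - sigma *m f u <= A u)%MS) ->
  exists (D D' : set 'rV[R]_m) (Theta g : 'rV[R]_m -> 'rV[R]_m) (Fy : 'rV[R]_m -> 'rV[R]_n),
    [/\ local_diffeo D D' Theta g, D u0 /\ D `<=` B, smooth_mx D' Fy &
      forall u, D u -> (a u *m jac Theta u :=: Ey)%MS /\
        phi u *m jac Theta u =
          sigma *m sel iota *m Et + Theta u *m Ey^T *m Ex + Fy (Theta u) *m Ey].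
Proof.
move=> A k1 iota_inj oB Bu0 as_ phis fs Af aa AA fA phiA.
have As : smooth_mx B A.
  apply: smooth_col_mx => // i j; have ars := smooth_row i oB as_.
  by apply: (smooth_ext oB _ (smooth_bracket oB phis ars 0 j)) => u _; rewrite mxE.
have Afree := row_free_usubmx Af.
have afree := row_free_usubmx Afree.
(* The functions t: straightening makes a0 and f0 the constant values of A and
   of f modulo A, and kt is a basis of the linear forms that vanish on a0, dual
   to f0. *)
have [a0 [f0 [D1 [D1' [Psi1 [Phi1 [af0 [LD1 D1'B] [D10 Psi10] str1]]]]]]] :=
  frobenius k1 oB Bu0 As fs Af AA fA.
pose s1 := joint (joint (y_idx hnm) (x_idx hnm)) (t_idx hnm \o iota).
have s1_inj : injective s1.
  apply: joint_inj; last 1 first.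
  - move=> i j; rewrite /joint eq_sym; case: (fintype.split i) => i1.
      exact: t_idx_y_idx.
    exact: t_idx_x_idx.
  - apply: joint_inj => [||i j]; [exact: y_idx_inj|exact: x_idx_inj|].
    by rewrite eq_sym x_idx_y_idx.
  - exact: inj_comp t_idx_inj iota_inj.
have [N Nu] := row_free_transport (sel_free (F := R) s1_inj) af0.
rewrite !sel_joint sel_comp mul_col_mx => /eq_col_mx[a0E f0E].
pose kt := invmx N *m Et^T.
have a0kt : a0 *m kt = 0.
  rewrite -a0E /kt mulmxA mulmxK// mul_col_mx (selC0 ty) (selC0 tx).
  exact: col_mx0.
have f0kt : f0 *m kt = sel iota.
  by rewrite -f0E /kt mulmxA mulmxK// -mulmxA tt mulmx1.
have kt_ker (v : 'rV[R]_m) : v *m kt = 0 -> (v <= a0)%MS.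
  move=> vk; have vt : v *m invmx N *m Et^T = 0 by rewrite -mulmxA.
  rewrite -[v](mulmxKV Nu) -[v *m invmx N]mulmx1 -sel_complete.
  rewrite !mulmxDr !mulmxDl !mulmxA vt !mul0mx add0r -(mulmxA _ Ex) -(mulmxA _ Ey).
  rewrite -a0E mul_col_mx -addsmxE addmx_sub// mulmx_sub//.
    exact: addsmxSr.
  exact: addsmxSl.
pose T u := Phi1 u *m kt.
have [[oD1 oD1'] D1D D1'D Psi1s Phi1s] := LD1.
have Ts : smooth_mx D1' T by apply: smooth_mulmx => //; exact: smooth_mx_cst.
have jT u : D1' u -> jac T u = jac Phi1 u *m kt by move=> D'u; exact: jac_mulmxr oD1' Phi1s D'u.
have str1' u : D1' u -> (A u *m jac Phi1 u <= a0)%MS /\ (f u *m jac Phi1 u - f0 <= a0)%MS.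
  move=> D'u; have [Du uK] := D1'D u D'u; have [] := str1 _ Du; rewrite uK => AE fE.
  have J := diffeo_jac LD1 D'u.
  have a0J : (A u *m jac Phi1 u :=: a0)%MS.
    by apply: eqmx_trans (eqmxMr _ (eqmx_sym AE)) _; rewrite -mulmxA J mulmx1.
  split; first by rewrite a0J.
  by rewrite -a0J -[f0]mulmx1 -J mulmxA -mulmxBl submxMr.
have AT u : D1' u -> A u *m jac T u = 0.
  move=> D'u; rewrite jT// mulmxA; have [/submxP[c ->] _] := str1' u D'u.
  by rewrite -mulmxA a0kt mulmx0.
have phiT u : D1' u -> phi u *m jac T u = sigma *m sel iota.
  move=> D'u; have /submxP[c E] := phiA u (D1'B u D'u).
  rewrite -[phi u](subrK (sigma *m f u)) E mulmxDl -(mulmxA c) AT// mulmx0 add0r.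
  have [_ /submxP[c' E']] := str1' u D'u.
  rewrite jT// -(mulmxA sigma) (mulmxA (f u)) -[f u *m _](subrK f0) E' mulmxDl.
  by rewrite -(mulmxA c') a0kt mulmx0 add0r f0kt.
have T_ker (v : 'rV[R]_m) : D1' u0 -> v *m jac T u0 = 0 -> (v <= A u0)%MS.
  move=> D'u; rewrite jT// mulmxA => /kt_ker va0.
  have [Du uK] := D1'D u0 D'u; have [AE _] := str1 _ Du.
  have /mulmx1C J := diffeo_jac LD1 D'u.
  by rewrite -[v]mulmx1 -J mulmxA -{3}uK -AE submxMr.
(* The functions x: they are linear in coordinates that straighten a, hence
   annihilated by a, and their coefficients kx are dual to the brackets at u0. *)
have [|||v0 [f0' [D2 [D2' [Psi2 [Phi2 [vf0 [LD2 D2'B] [D20 Psi20] str2]]]]]]] :=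
    @frobenius R m n 0 B a (fun=> 0) u0 isT oB Bu0 as_ (smooth_mx_cst 0 oB).
- by rewrite /row_free rank_col_mx0 addn0.
- exact: aa.
- by move=> u _ [].
have [[oD2 oD2'] D2D D2'D Psi2s Phi2s] := LD2.
have D2'u0 : D2' u0 by rewrite -Psi20; exact: (D2D 0 D20).1.
have D1'u0 : D1' u0 by rewrite -Psi10; exact: (D1D 0 D10).1.
have str2' u : D2' u -> (a u *m jac Phi2 u :=: v0)%MS.
  move=> D'u; have [Du uK] := D2'D u D'u; have [] := str2 _ Du; rewrite uK => aE _.
  apply: eqmx_trans (eqmxMr _ (eqmx_sym aE)) _.
  by rewrite -mulmxA (diffeo_jac LD2 D'u) mulmx1.
have /row_freeP[Q AQ] := Afree.
pose P := jac Psi2 (Phi2 u0) *m Q; pose kx := rsubmx P.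
have AP : A u0 *m jac Phi2 u0 *m P = 1%:M.
  rewrite /P mulmxA -(mulmxA (A u0)) (mulmx1C (diffeo_jac LD2 D2'u0)).
  by rewrite mulmx1.
pose X u := Phi2 u *m kx.
have Xs : smooth_mx D2' X by apply: smooth_mulmx => //; exact: smooth_mx_cst.
have jX u : D2' u -> jac X u = jac Phi2 u *m kx by move=> D'u; exact: jac_mulmxr oD2' Phi2s D'u.
have AX : A u0 *m jac X u0 = col_mx 0 1%:M.
  rewrite jX// mulmxA; have := AP; rewrite -[P]hsubmxK mul_mx_row.
  rewrite scalar_mx_block block_mxEh => /(congr1 rsubmx).
  by rewrite !row_mxKr.
have v0kx : v0 *m kx = 0.
  have : (v0 <= a u0 *m jac Phi2 u0)%MS by rewrite str2'.
  move=> /submxP[c ->]; rewrite -!mulmxA -(jX u0)//.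
  by have := AX; rewrite /A /lie_frame mul_col_mx => /eq_col_mx[-> _]; rewrite mulmx0.
have aX u : D2' u -> a u *m jac X u = 0.
  move=> D'u; rewrite jX// mulmxA.
  have : (a u *m jac Phi2 u <= v0)%MS by rewrite str2'.
  by move=> /submxP[c ->]; rewrite -mulmxA v0kx mulmx0.
pose U := D1' `&` D2'.
have oU : open U by exact: openI.
have UB : U `<=` B by move=> u [/D1'B].
have phis' := smooth_mx_sub UB phis; have as' := smooth_mx_sub UB as_.
have Xs' : smooth_mx U X by apply: smooth_mx_sub Xs => u [].
have Ts' : smooth_mx U T by apply: smooth_mx_sub Ts => u [].
pose Y u := phi u *m jac X u.
have Ys : smooth_mx U Y by apply: smooth_mulmx => //; exact: smooth_jac.
have aY u : U u -> a u *m jac Y u = - (dsubmx (A u) *m jac X u).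
  move=> Uu; rewrite /A /lie_frame col_mxKd; apply/row_matrixP => i.
  have ars := smooth_row i oU as'.
  have aiX : jac (fun w => row i (a w) *m jac X w) u = 0.
    rewrite -(jac_cst (0 : 'rV[R]_n) u); apply: (jac_ext oU) => // w [_ D2w].
    by rewrite -row_mul aX// row0.
  rewrite raddfN/= !row_mul rowK (bracket_jac oU phis' ars Xs' Uu) aiX.
  by rewrite mulmx0 sub0r opprK.
pose Theta u := T u *m Et + X u *m Ex + Y u *m Ey.
have TEs := smooth_mulmx oU Ts' (smooth_mx_cst Et oU).
have XEs := smooth_mulmx oU Xs' (smooth_mx_cst Ex oU).
have YEs := smooth_mulmx oU Ys (smooth_mx_cst Ey oU).
have Ths : smooth_mx U Theta by apply: smooth_mxD => //; exact: smooth_mxD.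
have jTh u : U u -> jac Theta u = jac T u *m Et + jac X u *m Ex + jac Y u *m Ey.
  move=> Uu; rewrite (jacD oU (smooth_mxD oU TEs XEs) YEs Uu) (jacD oU TEs XEs Uu).
  by rewrite (jac_mulmxr _ oU Ts' Uu) (jac_mulmxr _ oU Xs' Uu) (jac_mulmxr _ oU Ys Uu).
have ThtE r (M1 : 'M[R]_(r, _)) (M2 M3 : 'M[R]_(r, n)) :
    (M1 *m Et + M2 *m Ex + M3 *m Ey) *m Et^T = M1.
  rewrite !mulmxDl -!mulmxA tt (selC0 tx) (selC0 ty) !mulmx0 mulmx1.
  by rewrite !addr0.
have ThxE r (M1 : 'M[R]_(r, _)) (M2 M3 : 'M[R]_(r, n)) :
    (M1 *m Et + M2 *m Ex + M3 *m Ey) *m Ex^T = M2.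
  rewrite !mulmxDl -!mulmxA tx xx (selC0 xy) !mulmx0 mulmx1.
  by rewrite addr0 add0r.
have ThyE r (M1 : 'M[R]_(r, _)) (M2 M3 : 'M[R]_(r, n)) :
    (M1 *m Et + M2 *m Ex + M3 *m Ey) *m Ey^T = M3.
  by rewrite !mulmxDl -!mulmxA ty xy yy !mulmx0 mulmx1 !add0r.
have Uu0 : U u0 by [].
have aY0 : a u0 *m jac Y u0 = - 1%:M.
  by rewrite aY// mul_dsub_mx AX col_mxKd.
have jTh_unit : jac Theta u0 \in unitmx.
  rewrite -row_free_unit; apply: inj_row_free => v; rewrite jTh// !mulmxDr !mulmxA => E.
  have vT : v *m jac T u0 = 0 by rewrite -[LHS](ThtE _ _ (v *m jac X u0) (v *m jac Y u0)) E mul0mx.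
  have vX : v *m jac X u0 = 0 by rewrite -[LHS](ThxE _ (v *m jac T u0) _ (v *m jac Y u0)) E mul0mx.
  have vY : v *m jac Y u0 = 0 by rewrite -[LHS](ThyE _ (v *m jac T u0) (v *m jac X u0)) E mul0mx.
  have /submxP[c vE] := T_ker v D1'u0 vT.
  move: vX vY; rewrite vE -mulmxA AX -[c]hsubmxK mul_row_col mulmx0 add0r mulmx1 => ->.
  rewrite /A /lie_frame mul_row_col mul0mx addr0 -mulmxA aY0 mulmxN mulmx1.
  by move=> /eqP; rewrite oppr_eq0 => /eqP ->; rewrite mul0mx.
have [D [D' [g [LD Du0 DU]]]] := inverse_function oU Ths Uu0 jTh_unit.
have [[oD oD'] DD DD' _ gs] := LD.
exists D, D', Theta, g, (fun p => phi (g p) *m jac Y (g p)); split.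
- exact: LD.
- by split => // u /DU/UB.
- apply: smooth_mulmx => //.
    by apply: (smooth_mx_comp oD' oU _ gs phis') => p /DD'[/DU].
  by apply: (smooth_mx_comp oD' oU _ gs (smooth_jac oU Ys)) => p /DD'[/DU].
move=> u Du; have Uu := DU u Du; have [D1u D2u] := Uu; split; last first.
  by rewrite (DD u Du).2 jTh// !mulmxDr !mulmxA phiT// [in RHS]/Theta ThyE.
(* The frame has full rank throughout D2', not only at u0. *)
have aTh : a u *m jac Theta u = a u *m jac Y u *m Ey.
  have aT : a u *m jac T u = 0.
    by have := AT u D1u; rewrite /A /lie_frame mul_col_mx -col_mx0 => /eq_col_mx[].
  by rewrite jTh// !mulmxDr !mulmxA aX// aT !mul0mx !add0r.
rewrite aTh; apply: eqmxMfull.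
have jfree : row_free (jac Theta u).
  have := diffeo_jac LD (DD u Du).1; rewrite (DD u Du).2 => /mulmx1_unit[H _].
  by rewrite row_free_unit.
have ra : (n <= \rank (a u))%N.
  have := row_free_usubmx vf0; rewrite /row_free => /eqP {1}<-.
  by rewrite -(str2' u D2u) mxrankM_maxl.
rewrite /row_full eqn_leq rank_leq_col (leq_trans ra)//.
by rewrite -(mxrankMfree (a u) jfree) aTh mxrankM_maxl.
Qed.

End NormalForm.

(** * Sections and frames *)

Section Assembly.
Context {R : realType} {m : nat} (M : smooth_manifold R m).
Implicit Types (c : chart R m M) (w z : M).

Lemma dvec_mul c r (A : 'M[R]_(r, m)) (x : 'rV[R]_r) w :
  dvec c (x *m A) w = \sum_i x 0 i *: dvec c (row i A) w.
Proof. by rewrite mulmx_sum_row dvec_lincomb. Qed.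

Lemma dvec_delta c j w : dvec c (delta_mx 0 j) w = coord_vec c j w.
Proof.
rewrite /dvec (bigD1 j)//= big1 => [|i ij].
  by rewrite mxE !eqxx scale1r addr0.
by rewrite mxE (negbTE ij) andbF scale0r.
Qed.

Lemma dvec_sel c r (s : 'I_r -> 'I_m) (x : 'rV[R]_r) w :
  dvec c (x *m sel s) w = \sum_i x 0 i *: coord_vec c (s i) w.
Proof.
rewrite dvec_mul; apply: eq_bigr => i _; congr (_ *: _).
rewrite -dvec_delta; congr (dvec c _ w).
by apply/rowP => j; rewrite !mxE.
Qed.

Lemma span_dvec c r (A : 'M[R]_(r, m)) w :
  span_fam (fun i => dvec c (row i A) w) = [set dvec c x w | x in [set x | (x <= A)%MS]].
Proof.
apply/seteqP; split=> [_ [b ->]|_ [x /= /submxP[b ->] <-]].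
  exists ((\row_i b i) *m A); first exact: submxMl.
  by rewrite dvec_mul; apply: eq_bigr => i _; rewrite mxE.
by exists (fun i => b 0 i); rewrite dvec_mul.
Qed.

Lemma span_coord c r (s : 'I_r -> 'I_m) w :
  span_fam (fun i => coord_vec c (s i) w) =
  [set dvec c x w | x in [set x | (x <= (sel s : 'M[R]_(r, m)))%MS]].
Proof.
rewrite -span_dvec; congr (span_fam _); apply/funext => i; rewrite -dvec_delta.
by congr (dvec c _ w); apply/rowP => j; rewrite !mxE.
Qed.

Lemma span_fam_in k (e : 'I_k -> functional M) i : span_fam e (e i).
Proof.
exists (fun j => (j == i)%:R); rewrite (bigD1 i)//= eqxx scale1r big1 ?addr0// => j ji.
by rewrite (negbTE ji) scale0r.
Qed.

Lemma lin_indep_row_free c w k (A : 'M[R]_(k, m)) :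
  lin_indep (fun i => dvec c (row i A) w) -> row_free A.
Proof.
move=> ind; apply: inj_row_free => v vA; apply/rowP => i; rewrite mxE.
by apply: (ind (fun i => v 0 i)); rewrite -dvec_mul vA -(scale0r (0 : 'rV[R]_m)) dvecZ scale0r.
Qed.

Lemma has_dim_rank c w k r (S : set (functional M)) (A : 'M[R]_(r, m)) : has_dim k S ->
  (forall v, S v -> exists2 x, (x <= A)%MS & v = dvec c x w) -> (k <= \rank A)%N.
Proof.
move=> [e eind SE] SA.
have ex i : exists x, (x <= A)%MS /\ e i = dvec c x w.
  by have [|x xA ->] := SA (e i); [rewrite SE; exact: span_fam_in|exists x].
have [x xP] := choice ex; pose E : 'M[R]_(k, m) := \matrix_i x i.
have Ef : row_free E.
  apply: (@lin_indep_row_free c w).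
  rewrite (_ : (fun i => _) = e)//; apply/funext => i.
  by rewrite rowK (xP i).2.
rewrite -(eqP Ef) mxrankS//; apply/row_subP => i; rewrite rowK; exact: (xP i).1.
Qed.

End Assembly.

Section BracketOfSections.
Context {R : realType}.

(** Near [u], the coefficients of [eta] in the frame are smooth, so that the Leibniz
    rule applies. *)
Lemma bracket_section m n (B : set 'rV[R]_m) (a : 'rV[R]_m -> 'M[R]_(n, m))
    (phi eta : 'rV[R]_m -> 'rV[R]_m) u :
  open B -> smooth_mx B a -> smooth_mx B phi -> smooth_mx B eta -> B u ->
  row_free (a u) -> (forall w, B w -> (eta w <= a w)%MS) ->
  (bracket phi eta u <= lie_frame phi a u)%MS.
Proof.
move=> oB as_ phis etas Bu af etaa; have /row_freeP[P aP] := af.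
have aPs : smooth_mx B (fun w => a w *m P) by apply: smooth_mulmx => //; exact: smooth_mx_cst.
have [|B' [oB' B'u B'B B'P]] := unit_near oB Bu aPs; first by rewrite aP unitmx1.
have as' := smooth_mx_sub B'B as_; have etas' := smooth_mx_sub B'B etas.
pose c w := eta w *m P *m invmx (a w *m P).
have Ps := smooth_mx_cst P oB'.
have cs : smooth_mx B' c.
  apply: smooth_mulmx => //; first exact: smooth_mulmx.
  by apply: smooth_invmx => //; exact: smooth_mulmx.
have etaE w : B' w -> eta w = c w *m a w.
  move=> B'w; have /submxP[b E] := etaa w (B'B w B'w).
  by rewrite /c E -(mulmxA b) mulmxK// B'P.
have -> : bracket phi eta u = bracket phi (fun w => c w *m a w) u.
  by rewrite /bracket etaE// (jac_ext oB' etaE B'u).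
apply: (bracket_span_outer oB' (smooth_mx_sub B'B phis) as' cs B'u) => [|i].
  by rewrite /lie_frame -addsmxE addsmxSl.
by rewrite /lie_frame -addsmxE (submx_trans _ (addsmxSr _ _))// (eq_row_sub i)// rowK.
Qed.

End BracketOfSections.

(** * The normal form on a manifold *)

Section LocalForm.
Context {R : realType}.

Lemma bracket_ext m (U : set 'rV[R]_m) (X X' Y Y' : 'rV[R]_m -> 'rV[R]_m) u :
  open U -> U u -> (forall w, U w -> X w = X' w) -> (forall w, U w -> Y w = Y' w) ->
  bracket X Y u = bracket X' Y' u.
Proof.
move=> oU Uu XE YE; have jX := jac_ext oU XE Uu; have jY := jac_ext oU YE Uu.
by rewrite /bracket jX jY (XE u Uu) (YE u Uu).
Qed.

Lemma smooth_rows m r N (U : set 'rV[R]_m) (X : 'I_r -> 'rV[R]_m -> 'rV[R]_N) :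
  open U -> (forall i, smooth_mx U (X i)) -> smooth_mx U (fun u => \matrix_i X i u).
Proof.
by move=> oU Xs i j; apply: (smooth_ext oU _ (Xs i 0 j)) => u _; rewrite mxE.
Qed.

Lemma values_span_dvec m (M : smooth_manifold R m) (c : chart R m M) (S : set (vfield M)) z v :
  atlas c -> cdom c z -> values_span S z v -> exists x, v = dvec c x z.
Proof.
move=> Ac cz [k [e [eS [b ->]]]].
have ex i : exists x, e i = dvec c x z.
  by have [X _ <-] := eS i; exact: (tangent_dvec Ac cz (value_tangent X z)).
have [x xE] := choice ex; exists (\sum_i b i *: x i).
by rewrite dvec_lincomb; apply: eq_bigr => i _; rewrite xE.
Qed.

(** Otherwise the space would contain every tangent vector. *)
Lemma has_dim_proper m (M : smooth_manifold R m) (c : chart R m M) k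
    (S : set (functional M)) z v :
  has_dim k S -> (forall s, S s -> exists x, s = dvec c x z) ->
  (exists x, v = dvec c x z) -> ~ S v -> (k < m)%N.
Proof.
move=> [e eind SE] Sd [x ->]; rewrite SE; apply: contra_notP => /negP; rewrite -leqNgt => mk.
have ex i : exists y, e i = dvec c y z by apply: Sd; rewrite SE; exact: span_fam_in.
have [y yE] := choice ex; pose E : 'M[R]_(k, m) := \matrix_i y i.
have eE : e = fun i => dvec c (row i E) z by apply/funext => i; rewrite rowK.
have Ef : row_free E by apply: (@lin_indep_row_free _ _ _ c z); rewrite -eE.
rewrite eE span_dvec; exists x => //=; apply: submx_full.
by rewrite /row_full eqn_leq rank_leq_col (eqP Ef).
Qed.

(** Both cases of the theorem at once: [k] is zero when [F] belongs to [W], and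
    the only member of [Gs] is [F] when it is transverse. The hypotheses pass to the
    components of a frame of [V] by globally defined sections, which exist by
    means of bump functions, because the bracket of fields is computed from their
    components and the span of [W] is that of the frame and its brackets
    with [F]. *)
Theorem local_form (m n k : nat) (hnm : (2 * n <= m)%N) (M : smooth_manifold R m)
    (V : M -> set (functional M)) (F : vfield M) (Gs : 'I_k -> vfield M)
    (sigma : 'rV[R]_k) (F0 : vfield M) (iota : 'I_k -> 'I_(m - 2 * n)) z :
  let W := plus_lie F (sections V) in
  smooth_distribution n V -> has_dim (2 * n) (values_span W z) ->
  involutive_fields (sections V) -> involutive_fields W ->
  (k <= 1)%N -> injective iota ->
  (forall j X, W X -> W (lie (Gs j) X)) ->
  (forall s : 'rV[R]_k, values_span W z (\sum_j s 0 j *: value_at (Gs j) z) -> s = 0) ->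
  W F0 -> (forall w, value_at F w = value_at F0 w + \sum_j sigma 0 j *: value_at (Gs j) w) ->
  exists c : chart R m M, [/\ atlas c, cdom c z,
     forall w, cdom c w ->
       V w = span_fam (fun i => coord_vec c (y_idx hnm i) w) &
     exists Fy : 'I_n -> 'rV[R]_m -> R,
       (forall i, Cinfty (cmap c @` cdom c) (Fy i)) /\
       forall w, cdom c w ->
         value_at F w =
           \sum_j sigma 0 j *: coord_vec c (t_idx hnm (iota j)) w
           + \sum_(i < n) cmap c w 0 (y_idx hnm i) *: coord_vec c (x_idx hnm i) w
           + \sum_(i < n) Fy i (cmap c w) *: coord_vec c (y_idx hnm i) w].
Proof.
move=> W V_dist W_dim V_invol W_invol k1 iota_inj GW Gind WF0 FE.
have [c Ac cz] := atlas_cover z; set u0 := cmap c z.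
have [comp compP] := choice (fun X => field_components X Ac).
have comps X := (compP X).1; have compE X := (compP X).2.
have oI := cimg_open (c := c).
(* Membership in W is a statement on fields defined on the whole manifold: the
   local frame X is replaced by chi X, which is a frame where chi is one. *)
have [Vt /(_ z)[U [oU Uz [X [Xt Xs VX]]]]] := V_dist.
have [Y [chi [N [oN [Nz NU] chi1 YE Y0]]]] := field_extension oU Uz Xt Xs.
have V0 w : V w 0.
  have [_ [e _ ->]] := Vt w; exists (fun=> 0).
  by rewrite big1// => i _; rewrite scale0r.
have VY i : sections V (Y i).
  move=> w; have [Uw|Uw] := pselect (U w); last by rewrite Y0.
  rewrite YE// VX//; exists (fun j => chi w * (j == i)%:R).
  rewrite (bigD1 i)//= eqxx mulr1 big1 ?addr0// => j ji.
  by rewrite (negbTE ji) mulr0 scale0r.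
pose Z := lie F F.
(* The zero field, written as a bracket. *)
have ZE f : Z f = 0 by exact: subrr.
have VZ : sections V Z.
  move=> w; rewrite (_ : value_at Z w = 0); first exact: V0.
  by apply/funext => f; rewrite /value_at ZE.
have FZ f : lie F Z f = 0 by rewrite -[LHS]/(F (Z f) - Z (F f)) !ZE linear0 subr0.
have WY i : W (Y i).
  by exists (Y i), Z; split => // f; rewrite -[RHS]/(Y i f + lie F Z f) FZ addr0.
have WFY i : W (lie F (Y i)).
  by exists Z, (Y i); split => // f; rewrite -[RHS]/(Z f + lie F (Y i) f) ZE add0r.
pose B := cmap c @` (cdom c `&` N).
have oB : open B by exact: open_chart_image.
have Bu0 : B u0 by exists z.
have BI u : B u -> (cmap c @` cdom c) u by move=> [w [cw _] <-]; exists w.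
pose a u := \matrix_i comp (Y i) u; pose phi := comp F; pose f u := \matrix_j comp (Gs j) u.
pose Ai (i : 'I_(n + n)) := match fintype.split i with
  inl i1 => Y i1 | inr i1 => lie F (Y i1) end.
pose A := lie_frame phi a.
have arow i : (fun u => row i (a u)) = comp (Y i) by apply/funext => u; rewrite rowK.
have frow i : (fun u => row i (f u)) = comp (Gs i) by apply/funext => u; rewrite rowK.
have compB X1 X2 u : (cmap c @` cdom c) u -> comp (lie X1 X2) u = bracket (comp X1) (comp X2) u.
  exact: (lie_components Ac (comps X1) (comps X2) (compE X1) (compE X2) (compE _)).
have AE i u : (cmap c @` cdom c) u -> row i (A u) = comp (Ai i) u.
  move=> Iu; rewrite /A /lie_frame /Ai; case: fintype.splitP => i1 iE.
    have -> : i = lshift n i1 by exact: val_inj.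
    by rewrite rowKu rowK.
  have -> : i = rshift n i1 by exact: val_inj.
  by rewrite rowKd rowK arow compB.
have WAi i : W (Ai i) by rewrite /Ai; case: fintype.split.
have AA i i' u : (cmap c @` cdom c) u ->
    bracket (fun w => row i (A w)) (fun w => row i' (A w)) u = comp (lie (Ai i) (Ai i')) u.
  by move=> Iu; rewrite (compB _ _ _ Iu); exact: (bracket_ext oI Iu (AE i) (AE i')).
have fA j i u : (cmap c @` cdom c) u ->
    bracket (fun w => row j (f w)) (fun w => row i (A w)) u = comp (lie (Gs j) (Ai i)) u.
  by move=> Iu; rewrite (compB _ _ _ Iu) frow; exact: (bracket_ext oI Iu (fun _ _ => erefl) (AE i)).
have inj w x y : cdom c w -> dvec c x w = dvec c y w -> x = y.
  by move=> cw; exact: (dvec_inj Ac cw).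
have VE w : N w -> cdom c w -> V w = span_fam (fun i => dvec c (row i (a (cmap c w))) w).
  move=> Nw cw; rewrite (VX w (NU w Nw)); congr (span_fam _); apply/funext => i.
  by rewrite rowK -compE// YE ?chi1 ?scale1r//; exact: NU.
have secV X1 u : sections V X1 -> B u -> (comp X1 u <= a u)%MS.
  move=> VX1 [w [cw Nw] <-]; have := VX1 w; rewrite VE// span_dvec => -[x /= xa].
  by rewrite compE// => /(inj _ _ _ cw) <-.
have a_free u : B u -> row_free (a u).
  move=> [w [cw Nw] <-]; rewrite /row_free eqn_leq rank_leq_row /=.
  apply: (has_dim_rank (c := c) (w := w) (Vt w).2) => v.
  by rewrite VE// span_dvec => -[x xa <-]; exists x.
have as_ : smooth_mx B a by exact: (smooth_mx_sub BI (smooth_rows oI (fun i => comps (Y i)))).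
have phis : smooth_mx B phi by exact: (smooth_mx_sub BI (comps F)).
have fs : smooth_mx B f by exact: (smooth_mx_sub BI (smooth_rows oI (fun j => comps (Gs j)))).
have aA u : (a u <= A u)%MS by rewrite /A /lie_frame -addsmxE addsmxSl.
have compD X1 X2 X3 u : (cmap c @` cdom c) u -> (forall w, value_at X1 w = value_at X2 w + value_at X3 w) ->
    comp X1 u = comp X2 u + comp X3 u.
  move=> [w cw <-] E; apply: (inj w _ _ cw).
  by rewrite dvecD -!compE//; exact: E.
have WA X1 u : W X1 -> B u -> (comp X1 u <= A u)%MS.
  move=> [V1 [V2 [VV1 VV2 E]]] Bu.
  rewrite (compD X1 V1 (lie F V2) u (BI u Bu)); last first.
    by move=> w; apply/funext => g; rewrite /value_at E.
  rewrite addmx_sub//; first exact: submx_trans (secV _ _ VV1 Bu) (aA u).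
  rewrite compB; last exact: BI.
  apply: (bracket_section oB as_ phis _ Bu (a_free u Bu)).
    exact: (smooth_mx_sub BI (comps V2)).
  by move=> w Bw; exact: secV.
have spanA v : values_span W z v -> exists2 x, (x <= A u0)%MS & v = dvec c x z.
  move=> [k' [e [eW [b ->]]]].
  have ex i : exists X1, W X1 /\ value_at X1 z = e i.
    by have [X1 WX1 X1e] := eW i; exists X1.
  have [X1 X1P] := choice ex.
  exists (\sum_i b i *: comp (X1 i) u0).
    apply: summx_sub => i _; apply: scalemx_sub; apply: WA => //; exact: (X1P i).1.
  rewrite dvec_lincomb; apply: eq_bigr => i _; congr (_ *: _).
  by rewrite -(X1P i).2 compE.
have A_free : row_free (A u0).
  have := has_dim_rank W_dim spanA; rewrite mul2n -addnn => rA.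
  by rewrite /row_free eqn_leq rank_leq_row.
have Aspan x : (x <= A u0)%MS -> values_span W z (dvec c x z).
  move=> /submxP[b ->]; exists (n + n)%N, (fun i => value_at (Ai i) z); split.
    by move=> i; exists (Ai i).
  exists (fun i => b 0 i); rewrite dvec_mul; apply: eq_bigr => i _; congr (_ *: _).
  by rewrite AE ?compE//; exact: BI.
have fE (s : 'rV[R]_k) w : cdom c w ->
    \sum_j s 0 j *: value_at (Gs j) w = dvec c (s *m f (cmap c w)) w.
  move=> cw; rewrite dvec_mul; apply: eq_bigr => j _.
  by rewrite rowK -compE.
have Af_free : row_free (col_mx (A u0) (f u0)).
  apply: inj_row_free => v; rewrite -[v]hsubmxK mul_row_col => /eqP.
  rewrite addrC addr_eq0 => /eqP E; have v2 : rsubmx v = 0.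
    by apply: Gind; rewrite fE// E; apply: Aspan; rewrite -mulNmx submxMl.
  move: E; rewrite v2 mul0mx => /esym/eqP; rewrite oppr_eq0 => /eqP E.
  have /eqP := E; rewrite -(mul0mx _ (A u0)) => /eqP/(row_free_inj A_free) ->.
  exact: row_mx0.
have phiA u : B u -> (phi u - sigma *m f u <= A u)%MS.
  move=> Bu; rewrite (_ : _ - _ = comp F0 u); first exact: WA.
  have [w cw wu] := BI u Bu; apply: (inj w) => //; rewrite -{}wu.
  apply: (addIr (dvec c (sigma *m f (cmap c w)) w)).
  by rewrite -dvecD subrK -!compE// FE fE.
have aa u : B u -> forall i i',
    (bracket (fun w => row i (a w)) (fun w => row i' (a w)) u <= a u)%MS.
  move=> Bu i i'; rewrite !arow -compB; last exact: BI.
  by apply: secV => //; exact: V_invol.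
have AA' u : B u -> forall i i',
    (bracket (fun w => row i (A w)) (fun w => row i' (A w)) u <= A u)%MS.
  move=> Bu i i'; rewrite AA; last exact: BI.
  by apply: WA => //; exact: W_invol.
have fA' u : B u -> forall j i,
    (bracket (fun w => row j (f w)) (fun w => row i (A w)) u <= A u)%MS.
  move=> Bu j i; rewrite fA; last exact: BI.
  by apply: WA => //; exact: GW.
have [D [D' [Th [g [Fy [LD [Du0 DB] Fys nf]]]]]] :=
  normal_form hnm k1 iota_inj oB Bu0 as_ phis fs Af_free aa AA' fA' phiA.
have DI : D `<=` cmap c @` cdom c by move=> u /DB/BI.
have [c' [Ac' domE mapE invE]] := new_chart Ac (diffeo_sym LD) DI.
have dvE w x : cdom c w -> D (cmap c w) ->
    dvec c x w = dvec c' (x *m jac Th (cmap c w)) w.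
  move=> cw Dw; rewrite (dvec_new_chart _ Ac (diffeo_sym LD) DI mapE invE cw Dw) mapE.
  have [_ DD _ _ _] := LD; have [D'w wK] := DD _ Dw.
  have := diffeo_jac LD D'w; rewrite wK => J.
  by rewrite -mulmxA J mulmx1.
exists c'; split => //.
- by rewrite domE.
- move=> w; rewrite domE => -[cw /= Dw]; have [w' [cw' Nw'] E] := DB _ Dw.
  have Nw : N w by rewrite -(cmapK (c := c) cw) -E cmapK.
  rewrite VE// span_dvec span_coord; have [aE _] := nf _ Dw.
  apply/seteqP; split=> [_ [x /= xa <-]|_ [x /= xy <-]].
    by exists (x *m jac Th (cmap c w)); rewrite ?dvE//= -aE submxMr.
  move: xy; rewrite -aE => /submxP[b ->].
  by exists (b *m a (cmap c w)); [exact: submxMl|rewrite dvE// mulmxA].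
have D'map w : cdom c' w -> D' (cmap c' w).
  by rewrite domE mapE => -[cw /= Dw]; have [_ DD _ _ _] := LD; exact: (DD _ Dw).1.
exists (fun i p => Fy p 0 i); split=> [i|w c'w].
  by apply: smooth_sub (Fys 0 i) => _ [w c'w <-]; exact: D'map.
have := c'w; rewrite domE => -[cw /= Dw]; have [_ phiE] := nf _ Dw.
rewrite compE// dvE// -/phi phiE !dvecD -(mulmxA sigma) -sel_comp !dvec_sel mapE.
congr (_ + _ + _); apply: eq_bigr => i _; congr (_ *: _).
rewrite !mxE (bigD1 (y_idx hnm i))//= !mxE eqxx mulr1 big1 ?addr0// => j ji.
by rewrite !mxE (negbTE ji) mulr0.
Qed.

End LocalForm.

Theorem theorem1 (R : realType) (m n : nat) (hnm : (2 * n <= m)%N)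
  (M : smooth_manifold R m) (V : M -> set (functional M)) (F : vfield M)
  (V_dist : smooth_distribution n V)
  (FV_disjoint : forall X : vfield M,
     sections V X -> sections V (lie F X) -> X =1 (fun=> 0))
  (W : set (vfield M)) (W_def : W = plus_lie F (sections V))
  (W_dist : forall z, has_dim (2 * n) (values_span W z))
  (V_invol : involutive_fields (sections V))
  (W_invol : involutive_fields W) :
  (W F ->
   forall N : set M, N = [set z | V z (value_at F z)] -> N !=set0 ->
   forall z, N z ->
   exists c : chart R m M, [/\ atlas c, cdom c z,
     forall w, cdom c w ->
       V w = span_fam (fun i => coord_vec c (y_idx hnm i) w) &
     exists Fy : 'I_n -> 'rV[R]_m -> R,
       (forall i, Cinfty (cmap c @` cdom c) (Fy i)) /\
       forall w, cdom c w ->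
         value_at F w =
           \sum_(i < n) cmap c w 0 (y_idx hnm i) *: coord_vec c (x_idx hnm i) w
           + \sum_(i < n) Fy i (cmap c w) *: coord_vec c (y_idx hnm i) w])
  /\
  ((forall z, ~ values_span W z (value_at F z)) ->
   (forall X, W X -> W (lie F X)) ->
   forall z,
   exists c : chart R m M, [/\ atlas c, cdom c z,
     forall w, cdom c w ->
       V w = span_fam (fun i => coord_vec c (y_idx hnm i) w) &
     exists (p : 'I_(m - 2 * n)) (Fy : 'I_n -> 'rV[R]_m -> R),
       [/\ val p = 0%N,
         forall i, Cinfty (cmap c @` cdom c) (Fy i) &
         forall w, cdom c w ->
           value_at F w =
             coord_vec c (t_idx hnm p) w
             + \sum_(i < n)
                 cmap c w 0 (y_idx hnm i) *: coord_vec c (x_idx hnm i) w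
             + \sum_(i < n) Fy i (cmap c w) *: coord_vec c (y_idx hnm i) w]]).
Proof.
subst W; split=> [WF N _ _ z _|FW FWW z].
  pose iota (i : 'I_0) : 'I_(m - 2 * n) := False_rect _ (notF (ltn_ord i)).
  have iota_inj : injective iota by case.
  have [|||c [Ac cz VE [Fy [Fys FE]]]] := local_form (F := F) (Gs := fun=> F)
    (sigma := 0) hnm V_dist (W_dist z) V_invol W_invol (leq0n 1) iota_inj _ _ WF.
  - by case.
  - by move=> s _; apply/rowP => -[].
  - by move=> w; rewrite big_ord0 addr0.
  exists c; split => //; exists Fy; split => // w cw.
  by rewrite FE// big_ord0 add0r.
have [c Ac cz] := atlas_cover z.
have p0 : (0 < m - 2 * n)%N.
  rewrite subn_gt0; apply: (@has_dim_proper R m M c _ _ z (value_at F z) (W_dist z)).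
  - by move=> s; exact: values_span_dvec Ac cz.
  - exact: (tangent_dvec Ac cz (value_tangent F z)).
  - exact: FW.
pose p := Ordinal p0.
have iota_inj : injective (fun _ : 'I_1 => p) by move=> i j _; rewrite !ord1.
have Z0 g : lie F F g = 0 by exact: subrr.
have VZ : sections V (lie F F).
  move=> w; rewrite (_ : value_at (lie F F) w = 0).
    have [_ [e _ ->]] := V_dist.1 w; exists (fun=> 0).
    by rewrite big1// => i _; rewrite scale0r.
  by apply/funext => g; rewrite /value_at Z0.
have WZ : plus_lie F (sections V) (lie F F).
  exists (lie F F), (lie F F); split => // g.
  rewrite -[RHS]/(lie F F g + (F (lie F F g) - lie F F (F g))) !Z0.
  by rewrite linear0 subr0 addr0.
have [|||c' [Ac' cz' VE [Fy [Fys FE]]]] := local_form (F := F) (Gs := fun _ : 'I_1 => F)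
    (sigma := const_mx 1) hnm V_dist (W_dist z) V_invol W_invol (leqnn 1) iota_inj _ _ WZ.
- by move=> _ X; exact: FWW.
- move=> s; rewrite big_ord1 => Ws; apply/rowP => i; rewrite ord1 mxE.
  apply/eqP/negPn/negP => s0; apply: (FW z).
  case: Ws => [k [e [eW [b E]]]]; exists k, e; split => //.
  exists (fun i => (s 0 0)^-1 * b i).
  rewrite (eq_bigr (fun i => (s 0 0)^-1 *: (b i *: e i))) => [|j _]; last by rewrite scalerA.
  by rewrite -scaler_sumr -E scalerA mulVf// scale1r.
- move=> w; rewrite big_ord1 mxE scale1r (_ : value_at (lie F F) w = 0) ?add0r//.
  by apply/funext => g; rewrite /value_at Z0.
exists c'; split => //; exists p, Fy; split => // w cw.
by rewrite FE// big_ord1 mxE scale1r.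
Qed.
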